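(* Let $\lambda>0$ and let $\Omega$ be a bounded, measurable subset of $\mathbb{R}^2$. Then there is a minimizer $\Sigma$ of $E(\Sigma)=\mathrm{Per}(\Sigma)+\lambda|\Sigma\vartriangle\Omega|$ over measurable subsets of $\mathbb{R}^2$ such that $$\bigcup\left\{B_{\frac{2}{\lambda}}(x): x\in\mathbb{R}^2,\ B_{\frac{2}{\lambda}}(x)\subset\Omega\right\}\subset\Sigma\quad\text{and}\quad\bigcup\left\{B_{\frac{2}{\lambda}}(x): x\in\mathbb{R}^2,\ B_{\frac{2}{\lambda}}(x)\subset\Omega^c\right\}\subset\Sigma^c.$$
   Context: For a Lebesgue measurable set $\Sigma\subset\mathbb{R}^2$, $\mathrm{Per}(\Sigma)=\int|\nabla\chi_\Sigma|\,dx\in[0,\infty]$ is the perimeter of $\Sigma$ in $\mathbb{R}^2$ (the total variation of its characteristic function). $|\cdot|$ denotes Lebesgue measure, $\vartriangle$ is symmetric difference, and $A^c=\mathbb{R}^2\setminus A$. A minimizer of $E$ is a measurable set $\Sigma$ with $E(\Sigma)\le E(\Sigma')$ for all measurable $\Sigma'\subset\mathbb{R}^2$. $B_r(x)$ is the Euclidean ball of radius $r$ centered at $x$ (open or closed; the statement is meant for either). *)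

(* Defs.v *)
From mathcomp Require Import all_boot all_order all_algebra.
From mathcomp Require Import all_classical all_reals all_analysis.
Import Order.TTheory GRing.Theory Num.Theory.
Import numFieldNormedType.Exports.

Set Implicit Arguments.
Unset Strict Implicit.
Unset Printing Implicit Defensive.

Local Open Scope classical_set_scope.
Local Open Scope ring_scope.

Section plane.
Context {R : realType}.

(* The canonical norm of [R * R] is the sup norm; balls and the pointwise
   length of vector fields use the Euclidean one instead. *)
Definition euclid_norm (x : R * R) : R := Num.sqrt (x.1 ^+ 2 + x.2 ^+ 2).

(* [cl = true] gives the closed ball, [cl = false] the open one. *)
Definition euclid_ball (cl : bool) (x : R * R) (r : R) : set (R * R) :=
  [set y | euclid_norm (y - x) < r ?<= if cl].

(* [lebesgue_measure \x lebesgue_measure] lives on the Borel sets of the plane;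
   the Caratheodory extension of its outer measure is its completion. *)
Definition borel_lebesgue2 :
    {measure set (measurableTypeR R * measurableTypeR R) -> \bar R} :=
  (@lebesgue_measure R \x @lebesgue_measure R)%E.

Definition lebesgue2 :
    {measure set (caratheodory_type (borel_lebesgue2^*)%mu) -> \bar R} :=
  @completed_measure_extension _ _ _ borel_lebesgue2.

Definition lebesgue_measurable2 (A : set (R * R)) : Prop :=
  (borel_lebesgue2^*)%mu.-cara.-measurable A.

Definition C1_plane (f : R * R -> R * R) : Prop :=
  [/\ forall x, differentiable f x,
      continuous (fun x => 'D_((1, 0) : R * R) f x) &
      continuous (fun x => 'D_((0, 1) : R * R) f x)].

Definition divergence (f : R * R -> R * R) (x : R * R) : R :=
  ('D_((1, 0) : R * R) f x).1 + ('D_((0, 1) : R * R) f x).2.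

Definition admissible_field (f : R * R -> R * R) : Prop :=
  [/\ C1_plane f,
      compact (closure [set x | f x != 0]) &
      forall x, euclid_norm (f x) <= 1].

(* Total variation of the characteristic function of [A], as the supremum of
   [\int \chi_A div f]. *)
Definition perimeter (A : set (R * R)) : \bar R :=
  ereal_sup [set (\int[lebesgue2]_(x in A) (divergence f x)%:E)%E |
    f in admissible_field].

Definition energy (lambda : R) (Omega Sigma : set (R * R)) : \bar R :=
  (perimeter Sigma + lambda%:E * lebesgue2 (Sigma `+` Omega))%E.

Definition energy_minimizer (lambda : R) (Omega Sigma : set (R * R)) : Prop :=
  lebesgue_measurable2 Sigma /\
  forall Sigma' : set (R * R), lebesgue_measurable2 Sigma' ->
    (energy lambda Omega Sigma <= energy lambda Omega Sigma')%E.

Definition ball_union (cl : bool) (r : R) (A : set (R * R)) : set (R * R) :=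
  \bigcup_(x in [set x | euclid_ball cl x r `<=` A]) euclid_ball cl x r.

End plane.

(* Main.v *)
(* Existence is proved without compactness.  The energy E is submodular, so if
   E(S_n) <= inf E + 2^-n then a finite union S_n, ..., S_(n+k) has energy at
   most inf E + 2^(1-n), because the intersections occurring on the way have
   energy at least inf E.  Lower semicontinuity along monotone limits then shows
   that limsup S_n is a minimizer.  For the submodularity of the perimeter, the
   indicators of A and B are mollified to u and v; test fields f and g for the
   union and the intersection are combined, with weights depending on u - v,
   into test fields for u and v, up to the divergence of a field with compact
   support.

   Let B be an open ball of radius r = 2 / lambda and center x0.  Replacing a
   test field inside B by the calibration (x - x0) / r, of divergence 2 / r, gives
   Per(A u B) <= Per(A) + lambda |B \ A|.  Hence adding to a minimizer a ball
   contained in Omega leaves the energy minimal, and so does adding countably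
   many; by Lindelof these cover the union of all such open balls.  Balls in the
   complement are handled by taking complements.  Closed balls add only a null
   set: each of its points is moved into the union U of the open balls by all
   small steps in some coordinate direction, while |U symdiff (U + z)| is locally
   small for small z. *)

Require Import Defs.
From HB Require Import structures.
From mathcomp Require Import all_boot all_order all_algebra.
From mathcomp Require Import all_classical all_reals all_analysis.
From mathcomp Require Import measurable_realfun ring lra.
Import Order.TTheory GRing.Theory Num.Theory.
Import numFieldNormedType.Exports.

Set Implicit Arguments.
Unset Strict Implicit.
Unset Printing Implicit Defensive.

Local Open Scope classical_set_scope.
Local Open Scope ring_scope.

(** * Borel sets and integrals on the plane *)

Section area_def.
Context {R : realType}.

(** Submodularity arguments subtract energies, which is unsafe while values may be [+oo]. Perimeter
    and energy bounds are therefore real numbers tested against one admissible field at a time; the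
    supremum over fields appears only in the final translation to [perimeter] and [energy]. This
    part of the work is done with Borel sets and [area]: a Lebesgue measurable set is replaced by a
    Borel set that differs from it by a null set. Only the final set lives in the completion, since
    an uncountable union of closed balls need not be Borel.

    The two smoothings in the proof of submodularity have different roles. Mollifying the sets makes
    [u - v] differentiable, and [ramp] makes the positive part of [u - v] differentiable; the weight
    is the derivative of [ramp], and this choice is what cancels the terms with the gradient of the
    weight.

    In the comparison with a ball, the given field is first scaled by some [k < 1]. Near the sphere
    its radial component then stays below that of the calibration, so that a cutoff between the two
    fields has a gradient of the right sign; afterwards [k] tends to 1. *)

Definition area : set (measurableTypeR R * measurableTypeR R) -> \bar R :=
  (@lebesgue_measure R \x @lebesgue_measure R)%E.
HB.instance Definition _ := Measure.on area.

Lemma area_setX (A B : set (measurableTypeR R)) : measurable A -> measurable B ->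
  area (A `*` B) = (lebesgue_measure A * lebesgue_measure B)%E.
Proof. exact: product_measure1E. Qed.

Definition box (n : R) : set (R * R) := [set x | `|x| <= n].

Lemma box_setX n : box n = `[-n, n]%classic `*` `[-n, n]%classic.
Proof.
apply/seteqP; split=> -[x y]; rewrite /box/= !in_itv/= prod_normE/= ge_max.
  by rewrite !ler_norml => /andP[].
by rewrite !ler_norml => -[-> ->].
Qed.

Lemma measurable_box n : measurable (box n : set (measurableTypeR R * measurableTypeR R)).
Proof. by rewrite box_setX; apply: measurableX; apply: measurable_itv. Qed.

Lemma area_box n : 0 <= n -> area (box n) = ((n *+ 2) ^+ 2)%:E.
Proof.
move=> n0; rewrite box_setX area_setX; [|exact: measurable_itv..].
rewrite !lebesgue_measure_itv/= lte_fin.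
have [nn|nn] := ltP (- n) n.
  by rewrite -!EFinB -EFinM; congr EFin; ring.
have -> : n = 0 by lra.
by rewrite mul0e mul0rn expr0n.
Qed.

Lemma sigma_finite_area : sigma_finite setT area.
Proof.
exists (fun n => box n%:R).
  apply/esym; rewrite -subTset => x _; exists (Num.bound `|x|) => //=.
  by apply/ltW/archi_boundP.
move=> n; split; first exact: measurable_box.
by rewrite area_box// ltry.
Qed.
HB.instance Definition _ := Measure_isSigmaFinite.Build _ _ _ area sigma_finite_area.

End area_def.

Notation plane R := (measurableTypeR R * measurableTypeR R)%type.

Section integrals.
Context {R : realType}.
Implicit Types (f g : R * R -> R) (A : set (R * R)).

Definition mfun f := measurable_fun [set: plane R] (f : plane R -> R).

Definition integ f : R := \int[area]_x f x.

(** This class is closed under linear combinations, translations and products with bounded Borel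
    functions, and its members are integrable. Hence [integ] can be real valued and linear with no
    finiteness side conditions. *)
Definition nice f := mfun f /\ exists N : R, exists C : R,
  (forall x : R * R, `|f x| <= C) /\ (forall x : R * R, N < `|x| -> f x = 0).

Lemma integrable_indic_area (A : set (plane R)) : measurable A ->
  (area A < +oo)%E -> area.-integrable [set: plane R] (fun x => (\1_A x)%:E).
Proof.
move=> mA Aoo; apply/integrableP; split.
  exact/measurable_EFinP/measurable_indic.
under eq_integral do rewrite gee0_abs ?lee_fin//.
by rewrite integral_indic// setIT.
Qed.

Lemma nice_integrable f : nice f -> area.-integrable [set: plane R] (EFin \o f).
Proof.
move=> [mf [N [C [fC fN]]]].
have mb := measurable_box (Num.max N 0).
have ig : area.-integrable [set: plane R] (EFin \o (fun x => C * \1_(box (Num.max N 0)) x)).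
  rewrite (_ : EFin \o _ = (fun x : plane R => (C%:E * (\1_(box (Num.max N 0)) x)%:E)%E)) //.
  apply: integrableZl => //.
  by apply: integrable_indic_area; rewrite ?area_box ?ltry// le_max lexx orbT.
apply: (le_integrable _ _ _ ig) => //.
- exact/measurable_EFinP.
- move=> x _ /=; rewrite lee_fin indicE.
  case: (boolP (x \in box _)) => xb.
    by rewrite mulr1 (le_trans (fC x))// ler_norm.
  rewrite fN ?normr0 ?normr_ge0//.
  move: xb; rewrite notin_setE /box/= => /negP; rewrite -ltNge gt_max => /andP[]//.
Qed.

Lemma niceD f g : nice f -> nice g -> nice (fun x => f x + g x).
Proof.
move=> [mf [N [C [fC fN]]]] [mg [N' [C' [gC gN]]]]; split.
  exact: measurable_funD.
exists (Num.max N N'), (C + C'); split=> x.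
  by rewrite (le_trans (ler_normD _ _))// lerD.
by rewrite gt_max => /andP[Nx N'x]; rewrite fN// gN// addr0.
Qed.

Lemma niceMb b f C : mfun b -> (forall x, `|b x| <= C) -> nice f ->
  nice (fun x => b x * f x).
Proof.
move=> mb bC [mf [N [C' [fC fN]]]]; split; first exact: measurable_funM.
exists N, (C * C'); split=> x; first by rewrite normrM ler_pM.
by move=> /fN ->; rewrite mulr0.
Qed.

Lemma niceZ c f : nice f -> nice (fun x => c * f x).
Proof. by apply: (@niceMb (cst c) _ `|c|) => //; exact: measurable_cst. Qed.

Lemma niceN f : nice f -> nice (fun x => - f x).
Proof. by move/(niceZ (-1)); under eq_fun do rewrite mulN1r. Qed.

Lemma niceB f g : nice f -> nice g -> nice (fun x => f x - g x).
Proof. by move=> nf /niceN; exact: niceD. Qed.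

Lemma nice_norm f : nice f -> nice (fun x => `|f x|).
Proof.
move=> [mf [N [C [fC fN]]]]; split.
  exact: measurableT_comp.
exists N, C; split=> x; first by rewrite normr_id.
by move=> /fN ->; rewrite normr0.
Qed.

Lemma nice_indic A f : measurable (A : set (plane R)) -> nice f ->
  nice (fun x => \1_A x * f x).
Proof.
move=> mA; apply: (@niceMb _ _ 1); first exact: measurable_indic.
by move=> x; rewrite indicE; case: (_ \in _); rewrite ?normr1 ?normr0.
Qed.

Lemma nice_box n : nice (\1_(box n)).
Proof.
split; first by apply: measurable_indic; exact: measurable_box.
exists n, 1; split=> x; rewrite indicE.
  by case: (_ \in _); rewrite ?normr1 ?normr0.
by rewrite /box => nx; rewrite memNset//= => /(lt_le_trans nx); rewrite ltxx.
Qed.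

Lemma integD f g : nice f -> nice g ->
  integ (fun x => f x + g x) = integ f + integ g.
Proof. by move=> nf ng; apply: RintegralD => //; exact: nice_integrable. Qed.

Lemma integB f g : nice f -> nice g ->
  integ (fun x => f x - g x) = integ f - integ g.
Proof. by move=> nf ng; apply: RintegralB => //; exact: nice_integrable. Qed.

Lemma integZ c f : nice f -> integ (fun x => c * f x) = c * integ f.
Proof. by move=> nf; apply: RintegralZl => //; exact: nice_integrable. Qed.

Lemma integN f : nice f -> integ (fun x => - f x) = - integ f.
Proof. by move=> nf; rewrite -mulN1r -integZ//; under eq_fun do rewrite -mulN1r. Qed.

Lemma le_integ f g : nice f -> nice g -> (forall x, f x <= g x) ->
  integ f <= integ g.
Proof. by move=> nf ng fg; apply: le_Rintegral => //; exact: nice_integrable. Qed.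

Lemma le_normr_integ f : nice f -> `|integ f| <= integ (fun x => `|f x|).
Proof. by move=> nf; apply: le_normr_Rintegral => //; exact: nice_integrable. Qed.

Lemma EFin_integ f : nice f -> (integ f)%:E = (\int[area]_x (f x)%:E)%E.
Proof.
move=> nf; rewrite /integ /Rintegral fineK//.
by apply: integrable_fin_num => //; exact: nice_integrable.
Qed.

Lemma integ_indic A : measurable (A : set (plane R)) ->
  integ \1_A = fine (area A).
Proof. by move=> mA; rewrite /integ /Rintegral integral_indic// setIT. Qed.

End integrals.

Section open_plane.
Context {R : realType}.
Implicit Types (U A : set (R * R)) (N : R).

(** A countable base of the plane, with [set0] for codes that decode to nothing. It serves twice:
    open sets are Borel, and an arbitrary union of open balls is a countable one. *)
Definition qbox (i : nat) : set (R * R) :=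
  if unpickle i is Some (p, q, n) then
    ball (ratr p : R, ratr q : R) (n.+1%:R^-1 : R) else set0.

Lemma measurable_qbox i : measurable (qbox i : set (plane R)).
Proof.
rewrite /qbox; case: unpickle => [[[p q] n]|]; last exact: measurable0.
have -> : ball (ratr p : R, ratr q : R) (n.+1%:R^-1 : R) =
  ball (ratr p : R) (n.+1%:R^-1 : R) `*` ball (ratr q : R) (n.+1%:R^-1 : R) by [].
by apply: measurableX; exact: measurable_ball.
Qed.

Lemma open_qbox U x : open U -> U x -> exists i, qbox i x /\ qbox i `<=` U.
Proof.
move=> oU Ux; have /nbhs_ballP[e /= e0 eU] := open_nbhs_nbhs (conj oU Ux).
(* The rational center may be as far from [x] as the radius, so twice the radius has to stay below
   [e]. *)
pose n := Num.bound (2 / e).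
have n0 : 0 < n.+1%:R^-1 :> R by rewrite invr_gt0.
have ne : n.+1%:R^-1 * 2 < e.
  rewrite mulrC ltr_pdivrMr// mulrC -ltr_pdivrMr//.
  rewrite (lt_trans (archi_boundP _))// ?ltr_nat// divr_ge0// ltW//.
have rb (y : R) : exists p : rat, ball (ratr p : R) n.+1%:R^-1 y.
  move: n0; set d := n.+1%:R^-1 => d0.
  have [|q] := @rat_in_itvoo _ (y - d) (y + d); first by lra.
  rewrite in_itv/= => /andP[yq qy]; exists q; rewrite /ball/= ltr_norml.
  by apply/andP; split; lra.
have [p xp] := rb x.1; have [q xq] := rb x.2.
exists (pickle (p, q, n)); rewrite /qbox pickleK; split => // y yb.
apply: eU; apply: (@le_ball _ _ _ (n.+1%:R^-1 * 2)); first exact: ltW.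
rewrite mulr2n mulrDr mulr1; apply: (@ball_triangle R (R * R)%type (ratr p, ratr q)) => //.
by apply: ball_sym; split.
Qed.

Lemma open_measurable_plane U : open U -> measurable (U : set (plane R)).
Proof.
move=> oU.
have -> : U = \bigcup_i (if `[< qbox i `<=` U >] then qbox i else set0).
  apply/seteqP; split=> [x /(open_qbox oU)[i [xi iU]]|x [i _]].
    by exists i => //; rewrite asboolT.
  by case: ifPn => // /asboolP; apply.
apply: bigcupT_measurable => i; case: ifPn => // _; exact: measurable_qbox.
Qed.

Lemma continuous_mfun (f : R * R -> R) : continuous f -> mfun f.
Proof.
move=> cf; apply: (measurability _ (RGenOpens.measurableE R)).
move=> _ [_ [a [b ->] <-]]; rewrite setTI; apply: open_measurable_plane.
by apply: open_comp; [move=> + _; exact: cf|exact: interval_open].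
Qed.

Lemma compact_box n : compact (@box R n).
Proof. by rewrite box_setX; apply: compact_setX; exact: segment_compact. Qed.

Lemma continuous_nice (f : R * R -> R) N : continuous f ->
  (forall x : R * R, N < `|x| -> f x = 0) -> nice f.
Proof.
move=> cf fN; split; first exact: continuous_mfun.
have : compact (f @` box N).
  by apply: continuous_compact (@compact_box N); exact: continuous_subspaceT.
move=> /compact_bounded[M [_ Mf]].
exists N, (`|M| + 1); split=> // x.
have [xN|/fN ->] := leP `|x| N; last by rewrite normr0 addr_ge0.
by apply: Mf; [rewrite (le_lt_trans (ler_norm _))// ltrDl|exists x].
Qed.

End open_plane.

(** * C1 functions and the divergence theorem *)

Section C1_calculus.
Context {R : realType}.
Implicit Types (u v : R * R -> R) (F : R -> R).

(** The partial derivatives are carried as arguments, so that the calculus rules produce explicit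
    divergences which [ring] can compare. *)
Definition C1 u u1 u2 := [/\ continuous u1, continuous u2 &
  forall x, is_diff x u (fun h => h.1 * u1 x + h.2 * u2 x)].

Lemma C1_eq u u1 u2 v1 v2 : C1 u u1 u2 -> u1 =1 v1 -> u2 =1 v2 -> C1 u v1 v2.
Proof. by move=> + /funext <- /funext <-. Qed.

Lemma C1_continuous u u1 u2 : C1 u u1 u2 -> continuous u.
Proof. by move=> [_ _ du] x; apply: differentiable_continuous; case: (du x). Qed.

Lemma C1_cst (c : R) : C1 (cst c) (cst 0) (cst 0).
Proof.
split; [exact: cst_continuous..|move=> x].
apply: (is_diff_eq (is_diff_cst _ _)).
by apply/funext => h /=; rewrite !mulr0 addr0.
Qed.

Lemma fst_is_diff (x : R * R) : is_diff x (fst : R * R -> R) fst.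
Proof.
have cf : continuous (fst : R * R -> R) by move=> y; exact: cvg_fst.
split; [exact: (@linear_differentiable _ _ _ fst)|exact: (@diff_lin _ _ _ fst)].
Qed.

Lemma snd_is_diff (x : R * R) : is_diff x (snd : R * R -> R) snd.
Proof.
have cf : continuous (snd : R * R -> R) by move=> y; exact: cvg_snd.
split; [exact: (@linear_differentiable _ _ _ snd)|exact: (@diff_lin _ _ _ snd)].
Qed.

Lemma C1_fst : C1 fst (cst 1) (cst 0).
Proof.
split; [exact: cst_continuous..|move=> x].
apply: (is_diff_eq (fst_is_diff _)).
by apply/funext => h /=; rewrite mulr1 mulr0 addr0.
Qed.

Lemma C1_snd : C1 snd (cst 0) (cst 1).
Proof.
split; [exact: cst_continuous..|move=> x].
apply: (is_diff_eq (snd_is_diff _)).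
by apply/funext => h /=; rewrite mulr1 mulr0 add0r.
Qed.

Lemma C1D u u1 u2 v v1 v2 : C1 u u1 u2 -> C1 v v1 v2 ->
  C1 (fun x => u x + v x) (fun x => u1 x + v1 x) (fun x => u2 x + v2 x).
Proof.
move=> [cu1 cu2 du] [cv1 cv2 dv]; split.
- by move=> x; apply: cvgD; [exact: cu1|exact: cv1].
- by move=> x; apply: cvgD; [exact: cu2|exact: cv2].
move=> x; apply: (is_diff_eq (is_diffD (du x) (dv x))).
by apply/funext => h /=; rewrite fctE; ring.
Qed.

Lemma C1M u u1 u2 v v1 v2 : C1 u u1 u2 -> C1 v v1 v2 ->
  C1 (fun x => u x * v x) (fun x => u x * v1 x + v x * u1 x)
    (fun x => u x * v2 x + v x * u2 x).
Proof.
move=> Cu Cv; have cu := C1_continuous Cu; have cv := C1_continuous Cv.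
case: Cu Cv => [cu1 cu2 du] [cv1 cv2 dv]; split.
- by move=> x; apply: cvgD; apply: cvgM; [exact: cu|exact: cv1|exact: cv|exact: cu1].
- by move=> x; apply: cvgD; apply: cvgM; [exact: cu|exact: cv2|exact: cv|exact: cu2].
move=> x; apply: (is_diff_eq (is_diffM (du x) (dv x))).
by apply/funext => h /=; rewrite !fctE /GRing.scale/=; ring.
Qed.

Lemma C1Z c u u1 u2 : C1 u u1 u2 ->
  C1 (fun x => c * u x) (fun x => c * u1 x) (fun x => c * u2 x).
Proof.
by move=> /(C1M (C1_cst c)) /C1_eq; apply => x /=; rewrite mulr0 addr0.
Qed.

Lemma C1B u u1 u2 v v1 v2 : C1 u u1 u2 -> C1 v v1 v2 ->
  C1 (fun x => u x - v x) (fun x => u1 x - v1 x) (fun x => u2 x - v2 x).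
Proof.
move=> Cu Cv.
have -> : (fun x => u x - v x) = (fun x => u x + -1 * v x).
  by apply/funext => x; rewrite mulN1r.
by apply: (C1_eq (C1D Cu (C1Z (-1) Cv))) => x; rewrite mulN1r.
Qed.

Lemma C1_comp F F' u u1 u2 : continuous F' ->
  (forall t : R, is_derive t 1 F (F' t)) -> C1 u u1 u2 ->
  C1 (fun x => F (u x)) (fun x => F' (u x) * u1 x) (fun x => F' (u x) * u2 x).
Proof.
move=> cF' dF Cu; have cu := C1_continuous Cu; case: Cu => [cu1 cu2 du].
have cFu : continuous (fun x => F' (u x)).
  by move=> x; apply: continuous_comp; [exact: cu|exact: cF'].
split.
- by move=> x; apply: cvgM; [exact: cFu|exact: cu1].
- by move=> x; apply: cvgM; [exact: cFu|exact: cu2].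
move=> x.
have dFx : is_diff (u x) F (fun t => t * F' (u x)).
  have [dF1 dF2] := dF (u x); split; first exact/derivable1_diffP.
  by rewrite deriv1E// derive1E dF2.
apply: (is_diff_eq (is_diff_comp (du x) dFx)).
by apply/funext => h /=; ring.
Qed.

Lemma C1_derive u u1 u2 x : C1 u u1 u2 ->
  [/\ derivable u x (1, 0), 'D_(1, 0) u x = u1 x,
      derivable u x (0, 1) & 'D_(0, 1) u x = u2 x].
Proof.
move=> [_ _ /(_ x)[du eu]]; split.
- exact: diff_derivable.
- by rewrite deriveE// eu/=; ring.
- exact: diff_derivable.
- by rewrite deriveE// eu/=; ring.
Qed.

Lemma C1_plane_components (f : R * R -> R * R) : C1_plane f ->
  C1 (fun x => (f x).1) (fun x => ('D_((1, 0) : R * R) f x).1)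
    (fun x => ('D_((0, 1) : R * R) f x).1) /\
  C1 (fun x => (f x).2) (fun x => ('D_((1, 0) : R * R) f x).2)
    (fun x => ('D_((0, 1) : R * R) f x).2).
Proof.
move=> [df c1 c2].
have dfE x h : 'd f x h = h.1 *: 'D_((1, 0) : R * R) f x + h.2 *: 'D_((0, 1) : R * R) f x.
  rewrite !deriveE// -!linearZ -linearD; congr ('d f x _).
  by case: h => a b; apply/pair_equal_spec; split=> /=; rewrite /GRing.scale/=; ring.
have d x : is_diff x f (fun h : R * R => h.1 *: 'D_((1, 0) : R * R) f x + h.2 *: 'D_((0, 1) : R * R) f x).
  by split=> //; apply/funext => h; exact: dfE.
split; split=> [x|x|x].
- by apply: (continuous_comp (c1 x)); exact: cvg_fst.
- by apply: (continuous_comp (c2 x)); exact: cvg_fst.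
- exact: is_diff_comp (d x) (fst_is_diff _).
- by apply: (continuous_comp (c1 x)); exact: cvg_snd.
- by apply: (continuous_comp (c2 x)); exact: cvg_snd.
- exact: is_diff_comp (d x) (snd_is_diff _).
Qed.

Lemma C1_pair u u1 u2 v v1 v2 : C1 u u1 u2 -> C1 v v1 v2 ->
  C1_plane (fun x => (u x, v x)) /\
  (forall x, divergence (fun x => (u x, v x)) x = u1 x + v2 x).
Proof.
move=> [cu1 cu2 du] [cv1 cv2 dv].
have d x := is_diff_pair (du x) (dv x).
have e1 x : 'D_((1, 0) : R * R) (fun x => (u x, v x)) x = (u1 x, v1 x).
  have [dx ex] := d x; rewrite deriveE// ex /=.
  by apply/pair_equal_spec; split=> /=; ring.
have e2 x : 'D_((0, 1) : R * R) (fun x => (u x, v x)) x = (u2 x, v2 x).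
  have [dx ex] := d x; rewrite deriveE// ex /=.
  by apply/pair_equal_spec; split=> /=; ring.
split; first split.
- by move=> x; case: (d x).
- by under eq_fun do rewrite e1; move=> x; exact: (cvg_pair (cu1 x) (cv1 x)).
- by under eq_fun do rewrite e2; move=> x; exact: (cvg_pair (cu2 x) (cv2 x)).
by move=> x; rewrite /divergence e1 e2.
Qed.

End C1_calculus.

Section divergence_theorem.
Context {R : realType}.
Implicit Types (u : R * R -> R) (f : R -> R) (N : R).

Lemma C1_slices u u1 u2 x y : C1 u u1 u2 ->
  is_derive x (1 : R) (fun t => u (t, y)) (u1 (x, y)) /\
  is_derive y (1 : R) (fun t => u (x, t)) (u2 (x, y)).
Proof.
move=> [_ _ du].
have conv f (t d : R) : is_diff t f (fun h => h * d) -> is_derive t (1 : R) f d.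
  move=> [df ef]; split; first exact/derivable1_diffP.
  by rewrite deriveE// ef mul1r.
split; apply: conv.
- have dp := is_diff_pair (is_diff_id x) (is_diff_cst y x).
  apply: (is_diff_eq (is_diff_comp dp (du _))).
  by apply/funext => h /=; rewrite mul0r addr0.
- have dp := is_diff_pair (is_diff_cst x y) (is_diff_id y).
  apply: (is_diff_eq (is_diff_comp dp (du _))).
  by apply/funext => h /=; rewrite mul0r add0r.
Qed.

Lemma C1_support u u1 u2 N : C1 u u1 u2 -> (forall x : R * R, N < `|x| -> u x = 0) ->
  forall x : R * R, N < `|x| -> u1 x = 0 /\ u2 x = 0.
Proof.
move=> Cu u0 x Nx.
have near0 : \near x, u x = cst 0 x.
  have : \forall y \near x, N < `|y|.
    have cn : (fun y : R * R => `|y|) @ x --> `|x| by exact: norm_continuous.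
    exact: (cvgr_gt `|x| cn _ Nx).
  by apply: filterS => y /u0.
have [_ <- _ <-] := C1_derive x Cu.
split.
- by rewrite (near_eq_derive _ near0) derive_cst.
- by rewrite (near_eq_derive _ near0) derive_cst.
Qed.

Lemma integral_derive_bounded_support f f' N : continuous f' ->
  (forall x, is_derive x (1 : R) f (f' x)) -> (forall x, N < `|x| -> f x = 0) ->
  (forall x, N < `|x| -> f' x = 0) ->
  (* The proof applies the fundamental theorem of calculus on an interval whose two ends lie outside
     the support; [N] may be negative, hence the half-length [|N| + 1]. *)
  (\int[@lebesgue_measure R]_x (f' x)%:E = 0)%E.
Proof.
move=> cf' df f0 f'0; pose M : R := `|N| + 1.
have M0 : 0 < M by rewrite ltr_wpDl.
have NM : N < M by rewrite (le_lt_trans (ler_norm N))// ltrDl.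
transitivity (\int[@lebesgue_measure R]_(x in `[(- M)%R, M]) (f' x)%:E)%E.
  rewrite [RHS]integral_mkcond; apply: eq_integral => x _.
  rewrite patchE; case: ifPn => // /negP xM.
  rewrite f'0// (lt_trans NM)// ltNge; apply/negP => xM'.
  by apply: xM; rewrite inE/= in_itv/= -ler_norml.
have cf : continuous f.
  move=> x; apply/differentiable_continuous/derivable1_diffP.
  by case: (df x).
rewrite (@continuous_FTC2 _ _ f).
- rewrite !f0 ?subee// ?normrN gtr0_norm//.
- by rewrite (lt_trans _ M0)// oppr_lt0.
- exact: continuous_subspaceT.
- split=> [x _||]; first by case: (df x).
  + exact/cvg_at_right_filter/cf.
  + exact/cvg_at_left_filter/cf.
- by move=> x _; rewrite derive1E; case: (df x).
Qed.

Lemma C1_nice_partials u u1 u2 N : C1 u u1 u2 -> (forall x : R * R, N < `|x| -> u x = 0) ->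
  nice u1 /\ nice u2.
Proof.
move=> Cu u0; have u10 := C1_support Cu u0; case: Cu => [c1 c2 _]; split.
- by apply: (continuous_nice c1) => x /u10[].
- by apply: (continuous_nice c2) => x /u10[].
Qed.

(** Fubini, integrating first along the direction of differentiation, where each slice is the
    derivative of a function with bounded support. *)
Lemma integ_partials u u1 u2 N : C1 u u1 u2 -> (forall x : R * R, N < `|x| -> u x = 0) ->
  integ u1 = 0 /\ integ u2 = 0.
Proof.
move=> Cu u0; have u10 := C1_support Cu u0.
have [n1 n2] := C1_nice_partials Cu u0.
have big1 x y : N < `|x| -> N < `|(x, y) : R * R|.
  by move=> Nx; rewrite prod_normE lt_max Nx.
have big2 x y : N < `|y| -> N < `|(x, y) : R * R|.
  by move=> Nx; rewrite prod_normE lt_max Nx orbT.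
have cs1 (y : R) : continuous (fun t : R => (t, y)).
  move=> t; have [d _] := is_diff_pair (is_diff_id t) (is_diff_cst y t).
  exact: (differentiable_continuous d).
have cs2 (y : R) : continuous (fun t : R => (y, t)).
  move=> t; have [d _] := is_diff_pair (is_diff_cst y t) (is_diff_id t).
  exact: (differentiable_continuous d).
case: (Cu) => [c1 c2 _]; split; apply: EFin_inj; rewrite EFin_integ//.
- have <- := integral21_prod_meas1 (nice_integrable n1).
  apply: integral0_eq => y _.
  apply: (@integral_derive_bounded_support (fun t => u (t, y)) _ N) => [t|t|t|t].
  + by apply: (@continuous_comp _ _ _ (fun t => (t, y)) u1); [exact: cs1|exact: c1].
  + by case: (C1_slices t y Cu).
  + by move=> /(big1 _ y)/u0.
  + by move=> /(big1 _ y)/u10[].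
- have <- := integral12_prod_meas1 (nice_integrable n2).
  apply: integral0_eq => y _.
  apply: (@integral_derive_bounded_support (fun t => u (y, t)) _ N) => [t|t|t|t].
  + by apply: (@continuous_comp _ _ _ (fun t => (y, t)) u2); [exact: cs2|exact: c2].
  + by case: (C1_slices y t Cu).
  + by move=> /(big2 y)/u0.
  + by move=> /(big2 y)/u10[].
Qed.

End divergence_theorem.

(** * Translations *)

Section translation.
Context {R : realType}.
Implicit Types (A B : set (R * R)) (z : R * R) (N : R).

Definition shift_set z A : set (R * R) := [set x | A (x + z)].

Lemma measurable_shift z :
  measurable_fun [set: plane R] ((fun x : R * R => x + z) : plane R -> plane R).
Proof.
apply: (@measurable_fun_pair _ _ _ (plane R) (measurableTypeR R) (measurableTypeR R)
  (fun x => x.1 + z.1) (fun x => x.2 + z.2)).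
- by apply: measurable_funD; [exact: measurable_fst|exact: measurable_cst].
- by apply: measurable_funD; [exact: measurable_snd|exact: measurable_cst].
Qed.

Lemma measurable_shift_set z A : measurable (A : set (plane R)) ->
  measurable (shift_set z A : set (plane R)).
Proof. by move=> mA; have := measurable_shift z measurableT mA; rewrite setTI. Qed.

(** By uniqueness of Lebesgue measure it is enough to compare the lengths of half-open intervals;
    the planar version then follows from uniqueness of the product measure. *)
Lemma lebesgue_measure_shift (t : R) (X : set (measurableTypeR R)) : measurable X ->
  lebesgue_measure [set x : R | X (x + t)] = lebesgue_measure X.
Proof.
have mt : measurable_fun [set: measurableTypeR R]
    ((fun x : R => x + t) : measurableTypeR R -> measurableTypeR R).
  by apply: measurable_funD => //; exact: measurable_cst.
move=> mX; apply/esym; have := @lebesgue_measure_unique R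
  (measure_function_pushforward__canonical__measure_function_Measure
     (@lebesgue_measure R) mt) _ _ mX.
apply => /= _ [[a b]] _ <-; rewrite /pushforward.
have -> : (fun x => x + t) @^-1` `]a, b]%classic = `]a - t, b - t]%classic.
  by apply/seteqP; split=> x /=; rewrite !in_itv/= ltrBlDr lerBrDr.
rewrite !lebesgue_measure_itv/= !lte_fin ltrD2r.
by case: ifP => // _; rewrite -!EFinB; congr EFin; ring.
Qed.

Lemma area_shift z A : measurable (A : set (plane R)) ->
  area (shift_set z A) = area A.
Proof.
move=> mA; apply/esym; have := @product_measure_unique _ _ _ _ _
  (@lebesgue_measure R) (@lebesgue_measure R)
  (measure_function_pushforward__canonical__measure_function_Measure
     (@area R) (measurable_shift z)) _ _ mA.
apply => /= X Y mX mY; rewrite /pushforward.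
rewrite -(lebesgue_measure_shift z.1 mX) -(lebesgue_measure_shift z.2 mY).
rewrite -area_setX//.
- have mt : measurable_fun [set: measurableTypeR R]
      ((fun x : R => x + z.1) : measurableTypeR R -> measurableTypeR R).
    by apply: measurable_funD => //; exact: measurable_cst.
  by have := mt measurableT _ mX; rewrite setTI.
- have mt : measurable_fun [set: measurableTypeR R]
      ((fun x : R => x + z.2) : measurableTypeR R -> measurableTypeR R).
    by apply: measurable_funD => //; exact: measurable_cst.
  by have := mt measurableT _ mY; rewrite setTI.
Qed.

Lemma nice_shift z (f : R * R -> R) : nice f -> nice (fun x => f (x + z)).
Proof.
move=> [mf [N [C [fC fN]]]]; split.
  exact: (measurableT_comp (mf : measurable_fun _ _) (measurable_shift z)).
exists (N + `|z|), C; split=> [x|x xN]; first exact: fC.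
rewrite fN// -(ltrD2r `|z|) (lt_le_trans xN)//.
by rewrite -{1}(addrK z x) (le_trans (ler_normB _ _)).
Qed.

Lemma integ_shift z (f : R * R -> R) : nice f ->
  integ (fun x => f (x + z)) = integ f.
Proof.
move=> nf; apply: EFin_inj; rewrite !EFin_integ//; last exact: nice_shift.
have mz := measurable_shift z.
have <- : (\int[pushforward (@area R) ((fun x : R * R => (x + z)%R) : plane R -> plane R)]_x (f x)%:E
    = \int[area]_x (f x)%:E)%E.
  apply: eq_measure_integral => //= A mA _.
  exact: area_shift.
rewrite (integral_pushforward mz)//.
- by apply/measurable_EFinP; case: nf.
- exact: (nice_integrable (nice_shift z nf)).
Qed.

End translation.

(** * Continuity of translations in measure *)

Section translation_continuity.
Context {R : realType}.
Implicit Types (A B : set (R * R)) (z : R * R) (N : R).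

(** Local continuity of [z |-> \1_A (x + z)] in L1. Restricting to boxes admits sets of infinite
    area, so that the class can be closed under complements; measurability is included because the
    class is to be shown a sigma-algebra. *)
Definition translation_continuous A := measurable (A : set (plane R)) /\
  forall N (e : R), 0 < e -> exists2 d : R, 0 < d & forall z, `|z| < d ->
    (area (box N `&` (shift_set z A `+` A)) <= e%:E)%E.

Lemma setYP (T : Type) (X Y : set T) x : (X `+` Y) x <-> ~ (X x <-> Y x).
Proof.
rewrite setY_def /=; have [Xx|Xx] := pselect (X x);
  have [Yx|Yx] := pselect (Y x); tauto.
Qed.

Lemma measurableY (A B : set (plane R)) : measurable A -> measurable B ->
  measurable (A `+` B).
Proof.
by move=> mA mB; rewrite setY_def; apply: measurableU; exact: measurableD.
Qed.

Lemma measurable_boxI N A : measurable (A : set (plane R)) ->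
  measurable (box N `&` A : set (plane R)).
Proof. by apply: measurableI; exact: measurable_box. Qed.

Lemma le_area A B : measurable (A : set (plane R)) ->
  measurable (B : set (plane R)) -> A `<=` B -> (area A <= area B)%E.
Proof. by move=> mA mB AB; apply: le_measure => //; rewrite inE. Qed.

Lemma area_boxI_lty N A : measurable (A : set (plane R)) ->
  (area (box N `&` A) < +oo)%E.
Proof.
move=> mA; apply: (@le_lt_trans _ _ (area (box `|N|))).
  apply: le_area; [exact: measurable_boxI|exact: measurable_box|].
  by move=> x [xN _]; rewrite /box/= (le_trans xN)// ler_norm.
by rewrite area_box// ltry.
Qed.

Lemma area_vanish (F : (set (plane R))^nat) (e : R) :
  (forall n, measurable (F n)) -> (area (F 0%N) < +oo)%E ->
  (forall n, F n.+1 `<=` F n) -> \bigcap_n F n = set0 -> 0 < e ->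
  exists n, (area (F n) <= e%:E)%E.
Proof.
move=> mF F0 dF capF e0.
have ndF : {homo F : n m / (n <= m)%N >-> (m <= n)%O}.
  by apply/nonincreasing_seqP => n; apply/subsetPset.
have := nonincreasing_cvg_mu F0 mF (bigcapT_measurable mF) ndF.
rewrite capF measure0 => /fine_cvgP[[n _ nf] /cvgr_lt - /(_ e e0)[m _ me]].
exists (maxn n m); rewrite -[leLHS]fineK ?lee_fin.
  by apply/ltW/me; exact: leq_maxr.
by apply: nf; exact: leq_maxl.
Qed.

Lemma translation_continuousC A : translation_continuous A ->
  translation_continuous (~` A).
Proof.
move=> [mA tA]; split; first exact: measurableC.
move=> N e /(tA N)[d d0 dA]; exists d => // z /dA.
suff -> : shift_set z (~` A) `+` ~` A = shift_set z A `+` A by [].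
apply/seteqP; split=> x; rewrite !setYP /shift_set/=;
  have [Ax|Ax] := pselect (A x); have [Axz|Axz] := pselect (A (x + z)); tauto.
Qed.

Lemma translation_continuousU A B : translation_continuous A ->
  translation_continuous B -> translation_continuous (A `|` B).
Proof.
move=> [mA tA] [mB tB]; split; first exact: measurableU.
move=> N e e0; have e2 : 0 < e / 2 by rewrite divr_gt0.
have [d1 d10 d1A] := tA N _ e2; have [d2 d20 d2B] := tB N _ e2.
exists (Num.min d1 d2); first by rewrite lt_min d10 d20.
move=> z; rewrite lt_min => /andP[/d1A h1 /d2B h2].
have m1 := measurable_boxI N (measurableY (measurable_shift_set z mA) mA).
have m2 := measurable_boxI N (measurableY (measurable_shift_set z mB) mB).
have m3 := measurable_boxI N (measurableY (measurable_shift_set z (measurableU _ _ mA mB)) (measurableU _ _ mA mB)).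
rewrite [e]splitr EFinD; apply: le_trans (leeD h1 h2).
apply: le_trans (measureU2 _ m1 m2).
apply: le_area => //; first exact: measurableU.
move=> x [xN]; rewrite setYP /shift_set/= => AB.
have [Ax|Ax] := pselect ((shift_set z A `+` A) x); first by left.
suff BB : (shift_set z B `+` B) x by right.
apply/setYP => Bx; apply: AB.
have {}Ax : A (x + z) <-> A x by apply: contrapT => h; exact/Ax/setYP.
by move: Bx; rewrite /shift_set/=; tauto.
Qed.

Lemma translation_continuous0 : translation_continuous set0.
Proof.
split=> // N e e0; exists 1 => // z _.
suff -> : shift_set z set0 `+` set0 = set0 by rewrite setI0 measure0 lee_fin ltW.
by apply/seteqP; split=> x //; rewrite setYP /shift_set/=; tauto.
Qed.

(** A finite union [W n] is translation continuous, and the remainder [D n] has small area in a box,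
    hence so has its translate. The remainder is controlled on [box (N + 1)] because a step shorter
    than 1 may leave [box N]. *)
Lemma translation_continuous_bigcup (A : (set (R * R))^nat) :
  (forall n, translation_continuous (A n)) ->
  translation_continuous (\bigcup_n A n).
Proof.
move=> tA; have mA : measurable (\bigcup_n A n : set (plane R)).
  by apply: bigcupT_measurable => n; case: (tA n).
split=> // N e e0; have e3 : 0 < e / 3 by rewrite divr_gt0.
pose W n := \big[setU/set0]_(i < n) A i.
have tW n : translation_continuous (W n).
  rewrite /W; elim/big_ind : _ => //; first exact: translation_continuous0.
  by move=> ? ?; exact: translation_continuousU.
pose D n := \bigcup_n A n `\` W n.
have mD n : measurable (D n : set (plane R)).
  by apply: measurableD => //; case: (tW n).
have [n nD] : exists n, (area (box (N + 1) `&` D n) <= (e / 3)%:E)%E.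
  apply: (@area_vanish (fun n => box (N + 1) `&` D n)) => //.
  - by move=> n; exact: measurable_boxI.
  - exact: area_boxI_lty.
  - move=> n x [xN [Ax Wx]]; split=> //; split=> // Wnx; apply: Wx.
    by rewrite /W big_ord_recr/=; left.
  - rewrite -subset0 => x Dx; have [_ [[i _ Aix] _]] := Dx 0%N I.
    have [_ [_]] := Dx i.+1 I; apply.
    by rewrite /W big_ord_recr/=; right.
have [_ /(_ N _ e3)[d d0 dW]] := tW n.
exists (Num.min d 1); first by rewrite lt_min d0 ltr01.
move=> z; rewrite lt_min => /andP[/dW Wz z1].
have mWn : measurable (W n : set (plane R)) by case: (tW n).
have mWz := measurable_boxI N (measurableY (measurable_shift_set z mWn) mWn).
have mDz := measurable_boxI N (measurable_shift_set z (mD n)).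
have mDn := measurable_boxI (N + 1) (mD n).
have Dz : (area (box N `&` shift_set z (D n)) <= (e / 3)%:E)%E.
  apply: le_trans nD; rewrite -(area_shift z mDn).
  apply: le_area => //; first exact: measurable_shift_set.
  move=> x [xN Dx]; split=> //.
  by rewrite /box/= (le_trans (ler_normD _ _))// lerD// ltW.
have -> : e = e / 3 + (e / 3 + e / 3) by field.
rewrite !EFinD; apply: le_trans (leeD Wz (leeD Dz nD)).
apply: (@le_trans _ _ (area (box N `&` (shift_set z (W n) `+` W n)) +
    area ((box N `&` shift_set z (D n)) `|` (box (N + 1) `&` D n)))%E); last first.
  by apply: leeD => //; exact: measureU2.
apply: le_trans (measureU2 _ mWz (measurableU _ _ mDz mDn)).
apply: le_area.
- exact: measurable_boxI (measurableY (measurable_shift_set z mA) mA).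
- by apply: measurableU => //; exact: measurableU.
move=> x [xN] /setYP Ax.
have [Dx|Dx] := pselect (D n x).
  by right; right; split=> //; rewrite /box/= (le_trans xN)// lerDl.
have [Dxz|Dxz] := pselect (D n (x + z)); first by right; left.
suff WW : (shift_set z (W n) `+` W n) x by left.
apply/setYP => WW; apply: Ax.
have WA y : W n y -> (\bigcup_n A n) y.
  by rewrite /W -bigcup_mkord => -[i _ Ay]; exists i.
have DW y : ~ D n y -> (\bigcup_n A n) y -> W n y.
  by move=> nDy Ay; apply: contrapT => nW; exact: nDy.
by split=> [/(DW _ Dxz)/WW.1/WA|/(DW _ Dx)/WW.2/WA].
Qed.

(** A translated slab differs from the original only near its two edges; these strips contain the
    points that change sides. *)
Lemma area_strips N (a d : R) : 0 <= N -> 0 <= d ->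
  (area (box N `&` [set x : R * R | `|x.1 - a|%R <= d]%R) <= (d *+ 2 * N *+ 2)%R%:E)%E /\
  (area (box N `&` [set x : R * R | `|x.2 - a|%R <= d]%R) <= (d *+ 2 * N *+ 2)%R%:E)%E.
Proof.
have itvE (t b : R) : 0 <= t -> lebesgue_measure (`[b - t, b + t]%classic : set R) = (t *+ 2)%:E.
  move=> t0; rewrite lebesgue_measure_itv/= lte_fin.
  have [_|h] := ltP (b - t) (b + t); first by rewrite -EFinB; congr EFin; ring.
  have -> : t = 0 by lra.
  by rewrite mul0rn.
move=> N0 d0.
have mI b t : measurable (`[b - t, b + t]%classic : set (measurableTypeR R)).
  exact: measurable_itv.
have := area_setX (mI a d) (mI 0 N); rewrite !itvE// => e1.
have := area_setX (mI 0 N) (mI a d); rewrite !itvE// => e2.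
have aE (x b t : R) : (`|x - b| <= t) = (x \in `[b - t, b + t]).
  by rewrite in_itv/= ler_distl.
have eb (x : R * R) : box N x -> x.1 \in `[0 - N, 0 + N] /\ x.2 \in `[0 - N, 0 + N].
  by rewrite box_setX /= => -[]; rewrite sub0r add0r.
have mb := @measurable_box R N.
have ms1 : measurable ([set x | `|x.1 - a| <= d] : set (plane R)).
  have -> : [set x : R * R | `|x.1 - a| <= d] = `[a - d, a + d] `*` setT.
    by apply/seteqP; split=> x /=; rewrite aE// => -[].
  exact: measurableX.
have ms2 : measurable ([set x | `|x.2 - a| <= d] : set (plane R)).
  have -> : [set x : R * R | `|x.2 - a| <= d] = setT `*` `[a - d, a + d].
    by apply/seteqP; split=> x /=; rewrite aE// => -[].
  exact: measurableX.
split.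
- rewrite -mulrnAr EFinM -e1; apply: le_area.
  + exact: measurableI.
  + exact: measurableX.
  by move=> x [/eb[_ x2]]; rewrite /= aE.
- rewrite -mulrnAr mulrC EFinM -e2; apply: le_area.
  + exact: measurableI.
  + exact: measurableX.
  by move=> x [/eb[x1 _]]; rewrite /= aE.
Qed.

Lemma sigma_algebra_translation_continuous (p : R * R -> R) :
  sigma_algebra [set: R] [set S : set R | translation_continuous (p @^-1` S)].
Proof.
split=> [|S|S /= tS] /=.
- by rewrite preimage_set0; exact: translation_continuous0.
- by rewrite setTD preimage_setC; exact: translation_continuousC.
- by rewrite preimage_bigcup; exact: translation_continuous_bigcup.
Qed.

Lemma translation_continuous_itv (p : R * R -> R) (a b : R) :
  measurable_fun [set: plane R] (p : plane R -> R) ->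
  (forall x z, p (x + z) = p x + p z) -> (forall x, `|p x| <= `|x|) ->
  (forall N a d, 0 <= N -> 0 <= d ->
    (area (box N `&` [set x : R * R | `|p x - a|%R <= d]%R) <= (d *+ 2 * N *+ 2)%R%:E)%E) ->
  translation_continuous (p @^-1` `]a, b]).
Proof.
move=> mp pD pn ps.
have mS : measurable (p @^-1` `]a, b] : set (plane R)).
  by rewrite -[X in measurable X]setTI; apply: mp => //; exact: measurable_itv.
have mst c d : measurable ([set x | `|p x - c| <= d] : set (plane R)).
  have -> : [set x | `|p x - c| <= d] = p @^-1` `[c - d, c + d].
    by apply/seteqP; split=> x /=; rewrite in_itv/= ler_distl.
  by rewrite -[X in measurable X]setTI; apply: mp => //; exact: measurable_itv.
split=> // N e e0; pose M := `|N| + 1.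
have M0 : 0 < M by rewrite ltr_wpDl.
(* Each of the two strips of half-width [|z|] has area at most [4 * |z| * M] in [box M], and for
   [|z| < e / (8 * M)] this is at most [e / 2]. *)
exists (e / (8 * M)); first by rewrite divr_gt0// mulr_gt0.
move=> z zd.
have s0 : (`|z| *+ 2 * M *+ 2 <= e / 2)%R.
  have zM : `|z| * (8 * M) <= e by rewrite -ler_pdivlMr ?mulr_gt0// ltW.
  have -> : `|z| *+ 2 * M *+ 2 = `|z| * (8 * M) / 2 by field.
  by rewrite ler_pM2r.
rewrite [e]splitr EFinD.
have h c : (area (box M `&` [set x : R * R | `|p x - c| <= `|z|]%R) <= (e / 2)%:E)%E.
  by rewrite (le_trans (ps _ _ _ _ _))// ?lee_fin// ltW.
apply: le_trans (leeD (h a) (h b)).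
apply: le_trans (measureU2 _ _ _); [|exact: measurable_boxI..].
apply: le_area.
- apply: measurable_boxI; apply: measurableY => //; exact: measurable_shift_set.
- by apply: measurableU; exact: measurable_boxI.
move=> x [xN]; rewrite setYP /shift_set/= !in_itv/= pD => xz.
have xM : box M x by rewrite /box/= (le_trans xN)// (le_trans (ler_norm _))// lerDl.
have := pn z; rewrite ler_norml => /andP[z1 z2].
have [xa|xa] := leP `|p x - a| `|z|; first by left.
have [xb|xb] := leP `|p x - b| `|z|; first by right.
exfalso; apply: xz; move: xa xb; rewrite !ltr_normr => /orP xa /orP xb.
by split=> /andP[? ?]; apply/andP; split; case: xa; case: xb => ? ?; lra.
Qed.

(** The translation continuous sets form a sigma-algebra. It contains the preimages of half-open
    intervals under both coordinates, and these generate the Borel sets of the plane. *)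
Lemma measurable_translation_continuous A : measurable (A : set (plane R)) ->
  translation_continuous A.
Proof.
have tcC : sigma_algebra [set: R * R] translation_continuous.
  split=> [|S|S tS]; first exact: translation_continuous0.
  - by rewrite setTD; exact: translation_continuousC.
  - exact: translation_continuous_bigcup.
have coord (p : R * R -> R) (S : set (measurableTypeR R)) :
    (forall a b, translation_continuous (p @^-1` `]a, b])) ->
    measurable S -> translation_continuous (p @^-1` S).
  move=> pab; apply: (@smallest_sub _ _ _
    [set S | translation_continuous (p @^-1` S)]).
    exact: sigma_algebra_translation_continuous.
  by move=> _ [[a b] _ <-] /=; exact: pab.
have n1 (x : R * R) : `|x.1| <= `|x| by rewrite prod_normE le_max lexx.
have n2 (x : R * R) : `|x.2| <= `|x| by rewrite prod_normE le_max lexx orbT.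
apply: (@smallest_sub _ _ _ translation_continuous) => // B [|] [S mS <-]; rewrite setTI.
- apply: coord mS => a b; apply: translation_continuous_itv => //.
  by move=> N c d N0 d0; case: (area_strips c N0 d0).
- apply: coord mS => a b; apply: translation_continuous_itv => //.
  by move=> N c d N0 d0; case: (area_strips c N0 d0).
Qed.

End translation_continuity.

(** * Mollification *)

Section bump.
Context {R : realType}.

Definition posp (t : R) := Num.max t 0.

Lemma posp_ge0 t : 0 <= posp t. Proof. by rewrite le_max lexx orbT. Qed.

Lemma posp_lip q d : `|posp (q + d) - posp q| <= `|d|.
Proof.
rewrite /posp; case: (leP (q + d) 0) => h1; case: (leP q 0) => h2.
- by rewrite subrr normr0.
- by rewrite sub0r normrN gtr0_norm// ler0_norm; lra.
- by rewrite subr0 !gtr0_norm; lra.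
- by rewrite [q + d]addrC addrK.
Qed.

(** The square of the positive part is C1 with the Lipschitz derivative [2 * posp]. All smooth
    cutoffs below are built from it, and this remainder bound is uniform in [q]. *)
Lemma posp_sqr_taylor q d :
  `|posp (q + d) ^+ 2 - posp q ^+ 2 - 2 * posp q * d| <= d ^+ 2.
Proof.
rewrite /posp ler_norml; case: (leP (q + d) 0) => h1; case: (leP q 0) => h2;
  apply/andP; split; nra.
Qed.

Variable e : R.
Hypothesis e0 : 0 < e.

Definition bumpq (x : R * R) := e ^+ 2 - x.1 ^+ 2 - x.2 ^+ 2.
(** A C1 bump supported in the Euclidean disc of radius [e], a polynomial on that disc; [bump1] and
    [bump2] are its partial derivatives. *)
Definition bump (x : R * R) := posp (bumpq x) ^+ 2.
Definition bump1 (x : R * R) := - 4 * x.1 * posp (bumpq x).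
Definition bump2 (x : R * R) := - 4 * x.2 * posp (bumpq x).

Lemma posp_bumpq_le x : posp (bumpq x) <= e ^+ 2.
Proof. by rewrite /posp /bumpq ge_max sqr_ge0 andbT; nra. Qed.

Lemma posp_bumpq_eq0 x : e <= `|x| -> posp (bumpq x) = 0.
Proof.
rewrite prod_normE le_max => h; apply/max_idPr; rewrite /bumpq.
have sq (t : R) : e <= `|t| -> e ^+ 2 <= t ^+ 2.
  by move=> et; rewrite -(real_normK (num_real t)) ler_sqr ?nnegrE// ltW.
by case/orP: h => /sq; have := sqr_ge0 x.1; have := sqr_ge0 x.2; lra.
Qed.

(** The estimate is uniform in [x] and carries an indicator, so it can be integrated: convolutions
    with [bump] are then differentiated without a limit theorem. The box has half-side [e + 1]
    because [x + h] may enter the support from distance 1. *)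
Lemma bump_estimate : exists C : R, forall x h : R * R, `|h| <= 1 ->
  [/\ `|bump (x + h) - bump x - (h.1 * bump1 x + h.2 * bump2 x)|
        <= C * `|h| ^+ 2 * \1_(box (e + 1)) x,
      `|bump1 (x + h) - bump1 x| <= C * `|h| * \1_(box (e + 1)) x &
      `|bump2 (x + h) - bump2 x| <= C * `|h| * \1_(box (e + 1)) x].
Proof.
pose L := e + 1; pose D := 4 * L + 2.
have L0 : 0 < L by rewrite ltr_wpDr.
have D0 : 0 < D by rewrite /D; lra.
(* In the box [bumpq] changes by at most [D * |h|], and [posp (bumpq x)] is at most [e ^+ 2]. The
   first two terms bound the remainder of [bump], the last two the increments of its partial
   derivatives. *)
exists (D ^+ 2 + 4 * e ^+ 2 + 4 * L * D).
move=> x h h1; rewrite indicE; have [xb|xb] := boolP (x \in _); last first.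
  have xL : e + 1 < `|x|.
    by rewrite ltNge; move: xb; rewrite notin_setE => /negP.
  have xh : e <= `|x + h|.
    have : `|x| <= `|x + h| + `|h|.
      by rewrite -{1}(addrK h x) (le_trans (ler_normB _ _)).
    by lra.
  have xe : e <= `|x| by rewrite (le_trans _ (ltW xL))// lerDl.
  rewrite /bump /bump1 /bump2 (posp_bumpq_eq0 xe) (posp_bumpq_eq0 xh).
  by split; rewrite ?(mulr0, addr0, subr0, expr0n)/= ?normr0 ?subr0 ?normr0.
rewrite !mulr1; move: xb; rewrite inE /box/= => xL.
have [x1 x2] : `|x.1| <= L /\ `|x.2| <= L.
  by move: xL; rewrite prod_normE ge_max => /andP.
have [hh1 hh2] : `|h.1| <= `|h| /\ `|h.2| <= `|h|.
  by rewrite prod_normE !le_max !lexx orbT.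
set n := `|h| in h1 hh1 hh2 *.
have n0 : 0 <= n by exact: normr_ge0.
pose d := bumpq (x + h) - bumpq x.
have dE : d = - (2 * x.1 * h.1 + 2 * x.2 * h.2) - (h.1 ^+ 2 + h.2 ^+ 2).
  by rewrite /d /bumpq/=; ring.
have ab (a b A B : R) : `|a| <= A -> `|b| <= B -> `|a * b| <= A * B.
  by move=> aA bB; rewrite normrM ler_pM.
have s1 : `|h.1 ^+ 2| <= n * n by rewrite expr2 ab.
have s2 : `|h.2 ^+ 2| <= n * n by rewrite expr2 ab.
have m1 := ab _ _ _ _ x1 hh1; have m2 := ab _ _ _ _ x2 hh2.
have nn : n * n <= n by rewrite ler_piMl.
have dD : `|d| <= D * n.
  rewrite dE /D; move: m1 m2 s1 s2; rewrite !ler_norml.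
  by move=> /andP[? ?] /andP[? ?] /andP[? ?] /andP[? ?]; apply/andP; split; lra.
have q0 := posp_ge0 (bumpq x); have qe := posp_bumpq_le x.
have q0' := posp_ge0 (bumpq (x + h)); have qe' := posp_bumpq_le (x + h).
have e20 : 0 <= e ^+ 2 by exact: sqr_ge0.
have dE' : bumpq (x + h) = bumpq x + d by rewrite /d; ring.
have lip := posp_lip (bumpq x) d; rewrite -dE' in lip.
have d2 : d ^+ 2 <= D ^+ 2 * n ^+ 2.
  by rewrite -exprMn -(real_normK (num_real d)) ler_sqr ?nnegrE// mulr_ge0// ltW.
have LD0 : 0 <= L * D by rewrite mulr_ge0// ltW.
have grad (y k : R) : `|y| <= L -> `|k| <= n ->
    `|- 4 * (y + k) * posp (bumpq (x + h)) - - 4 * y * posp (bumpq x)|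
    <= (D ^+ 2 + 4 * e ^+ 2 + 4 * L * D) * n.
  move=> yL kn.
  have -> : - 4 * (y + k) * posp (bumpq (x + h)) - - 4 * y * posp (bumpq x) =
    - 4 * (k * posp (bumpq (x + h)) + y * (posp (bumpq (x + h)) - posp (bumpq x))) by ring.
  rewrite normrM normrN (ger0_norm (_ : 0 <= 4))//.
  have t1 : `|k * posp (bumpq (x + h))| <= n * e ^+ 2 by rewrite ab// ger0_norm.
  have t2 : `|y * (posp (bumpq (x + h)) - posp (bumpq x))| <= L * (D * n).
    by rewrite ab// (le_trans lip).
  have t3 := ler_normD (k * posp (bumpq (x + h))) (y * (posp (bumpq (x + h)) - posp (bumpq x))).
  have t4 : 0 <= D ^+ 2 * n by rewrite mulr_ge0// sqr_ge0.
  lra.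
split; [|exact: grad|exact: grad].
have tay := posp_sqr_taylor (bumpq x) d; rewrite -dE' in tay.
have -> : bump (x + h) - bump x - (h.1 * bump1 x + h.2 * bump2 x) =
  (posp (bumpq (x + h)) ^+ 2 - posp (bumpq x) ^+ 2 - 2 * posp (bumpq x) * d)
  + 2 * posp (bumpq x) * - (h.1 ^+ 2 + h.2 ^+ 2).
  by rewrite /bump /bump1 /bump2 dE; ring.
apply: le_trans (ler_normD _ _) _.
have t1 : `|2 * posp (bumpq x) * - (h.1 ^+ 2 + h.2 ^+ 2)| <= 2 * e ^+ 2 * (2 * (n * n)).
  apply: ab; first by rewrite ger0_norm ?mulr_ge0//; lra.
  rewrite normrN (le_trans (ler_normD _ _))//; lra.
have t2 : 0 <= 4 * L * D * n ^+ 2 by rewrite !mulr_ge0// ?sqr_ge0 ?ltW.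
move: tay d2 t1 t2; rewrite expr2; lra.
Qed.

Lemma bump_continuous : [/\ continuous bump, continuous bump1 & continuous bump2].
Proof.
have c1 : continuous (fst : R * R -> R) by move=> ?; exact: cvg_fst.
have c2 : continuous (snd : R * R -> R) by move=> ?; exact: cvg_snd.
have cX (f : R * R -> R) : continuous f -> continuous (fun x => f x ^+ 2).
  move=> cf x; apply: (@continuous_comp _ _ _ f (fun t => t ^+ 2)); first exact: cf.
  exact: exprn_continuous.
have cq : continuous bumpq.
  move=> x; apply: cvgB; last exact: cX.
  by apply: cvgB; [exact: cvg_cst|exact: cX].
have cp : continuous (fun x => posp (bumpq x)).
  move=> x; apply: (@continuous_comp _ _ _ bumpq posp); first exact: cq.
  by apply: continuous_max; [exact: cvg_id|exact: cvg_cst].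
split=> x.
- exact: cX.
- by apply: cvgM; [apply: cvgM; [exact: cvg_cst|exact: c1]|exact: cp].
- by apply: cvgM; [apply: cvgM; [exact: cvg_cst|exact: c2]|exact: cp].
Qed.

Lemma bump_nice : [/\ nice bump, nice bump1 & nice bump2].
Proof.
have [cb cb1 cb2] := bump_continuous.
split; [apply: (continuous_nice cb) | apply: (continuous_nice cb1) |
  apply: (continuous_nice cb2)] => x /ltW /posp_bumpq_eq0 h.
- by rewrite /bump h expr0n.
- by rewrite /bump1 h mulr0.
- by rewrite /bump2 h mulr0.
Qed.

Lemma integ_bump_gt0 : 0 < integ bump.
Proof.
have [nb _ _] := bump_nice.
have e20 : 0 < e / 2 by rewrite divr_gt0.
(* On the box of half-side [e / 2] both squared coordinates are at most [e ^+ 2 / 4], so [bumpq] is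
   at least [e ^+ 2 / 2]. *)
apply: (@lt_le_trans _ _ (integ (fun x => (e ^+ 2 / 2) ^+ 2 * \1_(box (e / 2)) x))).
  rewrite integZ; last exact: nice_box.
  rewrite integ_indic; last exact: measurable_box.
  rewrite area_box ?ltW//= mulr_gt0// exprn_gt0// ?divr_gt0// ?exprn_gt0//.
  by rewrite pmulrn_rgt0.
apply: le_integ => //; first exact/niceZ/nice_box.
move=> x; rewrite indicE; have [xb|_] := boolP (x \in _); last first.
  by rewrite mulr0 sqr_ge0.
rewrite mulr1 ler_sqr ?nnegrE ?posp_ge0 ?divr_ge0 ?sqr_ge0//.
move: xb; rewrite inE /box/= prod_normE ge_max => /andP[x1 x2].
rewrite /posp le_max; apply/orP; left; rewrite /bumpq.
have sq (t : R) : `|t| <= e / 2 -> t ^+ 2 <= e ^+ 2 / 4.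
  have -> : e ^+ 2 / 4 = (e / 2) ^+ 2 by field.
  by move=> et; rewrite -(real_normK (num_real t)) ler_sqr ?nnegrE// ltW.
by have := sq _ x1; have := sq _ x2; lra.
Qed.

End bump.

Section convolution.
Context {R : realType}.
Implicit Types (f u K k g : R * R -> R) (A : set (R * R)).

Lemma lipschitz_continuous f (c : R) :
  (forall x h : R * R, `|h| <= 1 -> `|f (x + h) - f x| <= c * `|h|) -> continuous f.
Proof.
move=> fc x; apply/cvgrPdist_lt => e e0.
have c0 : 0 < `|c| + 1 by rewrite ltr_wpDl.
have d0 : 0 < Num.min 1 (e / (`|c| + 1)) by rewrite lt_min ltr01 divr_gt0.
near=> y.
have yx : `|y - x| < Num.min 1 (e / (`|c| + 1)).
  by rewrite distrC; near: y; have := nbhsx_ballx x _ d0; rewrite -ball_normE.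
move: yx; rewrite lt_min => /andP[/ltW y1 ye].
rewrite distrC; have := fc x _ y1; rewrite [x + _]addrC subrK => /le_lt_trans; apply.
rewrite (@le_lt_trans _ _ ((`|c| + 1) * `|y - x|))//.
  by rewrite ler_wpM2r// (le_trans (ler_norm _))// lerDl.
by rewrite mulrC -ltr_pdivlMr.
Unshelve. all: by end_near. Qed.

Lemma quadratic_remainder_is_diff u (a b c : R) (x : R * R) :
  (forall h : R * R, `|h| <= 1 ->
     `|u (x + h) - u x - (h.1 * a + h.2 * b)| <= c * `|h| ^+ 2) ->
  is_diff x u (fun h : R * R => h.1 * a + h.2 * b).
Proof.
(* Subtracting the candidate differential leaves a function whose increments are quadratic, hence
   with differential zero. *)
move=> uc; pose r y := u y - (y.1 * a + y.2 * b).
have rx h : r (x + h) - r x = u (x + h) - u x - (h.1 * a + h.2 * b).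
  by rewrite /r/=; ring.
pose z : {linear (R * R)%type -> R} := \0.
have c0 : 0 < `|c| + 1 by rewrite ltr_wpDl.
have rlo : r \o shift x = cst (r x) + z +o_ (0 : R * R) id.
  apply/eqaddoP => _/posnumP[e].
  have d0 : 0 < Num.min 1 (e%:num / (`|c| + 1)) by rewrite lt_min ltr01 divr_gt0.
  near=> h.
  rewrite !fctE/= addr0 [h + x]addrC rx.
  have he : `|h| < Num.min 1 (e%:num / (`|c| + 1)).
    rewrite -normrN -sub0r; near: h.
    by have := nbhsx_ballx (0 : R * R) _ d0; rewrite -ball_normE.
  move: he; rewrite lt_min => /andP[/ltW h1 he].
  apply: le_trans (uc h h1) _.
  rewrite expr2 mulrA ler_wpM2r//.
  rewrite (@le_trans _ _ ((`|c| + 1) * `|h|))//.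
    by rewrite ler_wpM2r// (le_trans (ler_norm _))// lerDl.
  by rewrite mulrC -ler_pdivlMr// ltW.
have cz : continuous z by move=> y; exact: cvg_cst.
have dr := diff_unique cz rlo.
have isr : is_diff x r (cst 0).
  split=> //; apply/diff_locallyP; split; first by rewrite dr.
  by rewrite dr.
have C := C1D (C1M (@C1_fst R) (C1_cst a)) (C1M (@C1_snd R) (C1_cst b)).
have [_ _ /(_ x) isl] := C.
have uE : u = r \+ (fun y => y.1 * cst a y + y.2 * cst b y).
  by apply/funext => y /=; rewrite /r; ring.
rewrite uE; apply: (is_diff_eq (is_diffD isr isl)).
by apply/funext => h; rewrite fctE/=; ring.
Unshelve. all: by end_near. Qed.

Lemma le_integ_bound f (c L : R) (x : R * R) : nice f -> 0 <= L ->
  (forall y, `|f y| <= c * \1_(box L) (y - x)) ->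
  `|integ f| <= c * (L *+ 2) ^+ 2.
Proof.
move=> nf L0 fc; apply: le_trans (le_normr_integ nf) _.
have nb := nice_shift (- x) (@nice_box R L).
apply: le_trans (le_integ (nice_norm nf) (niceZ c nb) fc) _.
rewrite integZ// integ_shift; last exact: nice_box.
by rewrite integ_indic ?area_box//; exact: measurable_box.
Qed.

Lemma niceMg K g (c : R) : mfun g -> (forall x, `|g x| <= c) -> nice K ->
  nice (fun x => K x * g x).
Proof. by move=> mg gc nK; under eq_fun do rewrite mulrC; exact: niceMb nK. Qed.

(** The derivatives fall on the kernel, which is evaluated at [y - x]: a step [h] of [x] is a step
    [- h] of the kernel, whence the minus signs. The uniform remainder bounds of [K] integrate over
    a box around [x] to bounds of the same order. *)
Lemma conv_C1 K k1 k2 g (C L : R) : nice K -> nice k1 -> nice k2 ->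
  mfun g -> (forall x, `|g x| <= 1) -> 0 <= L ->
  (forall x h : R * R, `|h| <= 1 ->
  [/\ `|K (x + h) - K x - (h.1 * k1 x + h.2 * k2 x)| <= C * `|h| ^+ 2 * \1_(box L) x,
      `|k1 (x + h) - k1 x| <= C * `|h| * \1_(box L) x &
      `|k2 (x + h) - k2 x| <= C * `|h| * \1_(box L) x]) ->
  C1 (fun x => integ (fun y => K (y - x) * g y))
     (fun x => - integ (fun y => k1 (y - x) * g y))
     (fun x => - integ (fun y => k2 (y - x) * g y)).
Proof.
move=> nK n1 n2 mg g1 L0 est.
have ng k x : nice k -> nice (fun y => k (y - x) * g y).
  by move=> nk; apply: (niceMg mg g1); exact: nice_shift.
have bg k (x y : R * R) (c : R) : `|k (y - x)| <= c * \1_(box L) (y - x) ->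
    `|k (y - x) * g y| <= c * \1_(box L) (y - x).
  by move=> kc; rewrite normrM -[leRHS]mulr1 ler_pM.
have lip k (x h : R * R) : nice k -> `|h| <= 1 ->
    (forall y, `|k (y - h) - k y| <= C * `|h| * \1_(box L) y) ->
    `|- integ (fun y => k (y - (x + h)) * g y) - - integ (fun y => k (y - x) * g y)|
      <= C * (L *+ 2) ^+ 2 * `|h|.
  move=> nk h1 kC; rewrite -opprD normrN -integB//; try exact: ng.
  rewrite mulrAC; apply: (le_integ_bound (x := x)) => //.
    by apply: niceB; exact: ng.
  move=> y; rewrite -mulrBl opprD addrA.
  by rewrite (bg (fun w => k (w - h) - k w)).
have est' (h : R * R) : `|h| <= 1 -> forall y,
    [/\ `|K (y - h) - K y + (h.1 * k1 y + h.2 * k2 y)| <= C * `|h| ^+ 2 * \1_(box L) y,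
      `|k1 (y - h) - k1 y| <= C * `|h| * \1_(box L) y &
      `|k2 (y - h) - k2 y| <= C * `|h| * \1_(box L) y].
  move=> h1 y; have := est y (- h); rewrite normrN => /(_ h1)[e1 e2 e3]; split=> //.
  by move: e1; rewrite /= !mulNr -opprD opprK.
split.
- by apply: lipschitz_continuous => x h h1; apply: lip => // y; case: (est' _ h1 y).
- by apply: lipschitz_continuous => x h h1; apply: lip => // y; case: (est' _ h1 y).
move=> x; apply: (quadratic_remainder_is_diff (c := C * (L *+ 2) ^+ 2)) => h h1.
rewrite !mulrN -opprD opprK.
rewrite -!integZ; try exact: ng.
rewrite -integB; [|exact: ng..].
have nh1 := niceZ h.1 (ng k1 x n1); have nh2 := niceZ h.2 (ng k2 x n2).
have nKx := niceB (ng K (x + h) nK) (ng K x nK).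
rewrite -!integD//; last exact: niceD.
rewrite mulrAC; apply: (le_integ_bound (x := x)) => //.
  by apply: niceD => //; exact: niceD.
move=> y.
have -> : K (y - (x + h)) * g y - K (y - x) * g y +
    (h.1 * (k1 (y - x) * g y) + h.2 * (k2 (y - x) * g y)) =
    (K (y - x - h) - K (y - x) + (h.1 * k1 (y - x) + h.2 * k2 (y - x))) * g y.
  by rewrite (_ : y - (x + h) = y - x - h) ?opprD ?addrA//; ring.
by rewrite (bg (fun w => K (w - h) - K w + (h.1 * k1 w + h.2 * k2 w)))//; case: (est' _ h1 (y - x)).
Qed.

(** [F] is bounded and carried by a product of boxes, hence integrable on the product; the two
    partial integrals are again [nice]. *)
Lemma integ_fubini (F : R * R -> R * R -> R) (N C : R) :
  measurable_fun [set: plane R * plane R] (fun p : plane R * plane R => F p.1 p.2) ->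
  (forall x y, `|F x y| <= C) ->
  (forall x y : R * R, N < `|x| \/ N < `|y| -> F x y = 0) ->
  [/\ nice (fun x => integ (F x)), nice (fun y => integ (F^~ y)) &
      integ (fun x => integ (F x)) = integ (fun y => integ (F^~ y))].
Proof.
move=> mF FC FN; pose G (p : plane R * plane R) := (F p.1 p.2)%:E.
have mG : measurable_fun [set: plane R * plane R] G by exact/measurable_EFinP.
pose M := Num.max N 0.
have M0 : 0 <= M by rewrite le_max lexx orbT.
have mB : measurable ((box M : set (plane R)) `*` (box M : set (plane R))).
  by apply: measurableX; exact: measurable_box.
have FM x y : ~ (box M `*` box M) (x, y) -> F x y = 0.
  move=> xy; apply: FN; rewrite !ltNge; apply/orP; rewrite -negb_and.
  apply/negP => /andP[xN yN]; apply: xy; split=> /=; rewrite /box/= /M le_max ?xN ?yN//.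
have mFx x : mfun (F x).
  exact: (measurableT_comp mF (measurable_pair1 (x : plane R))).
have mFy y : mfun (F^~ y).
  exact: (measurableT_comp mF (measurable_pair2 (y : plane R))).
have nx x : nice (F x).
  by split=> //; exists N, C; split=> // y yN; apply: FN; right.
have ny y : nice (F^~ y).
  by split=> //; exists N, C; split=> // x xN; apply: FN; left.
have iG : (area \x area)%E.-integrable [set: plane R * plane R] G.
  have ib : (area \x area)%E.-integrable [set: plane R * plane R]
      (EFin \o (fun p => C * \1_(box M `*` box M) p)).
    rewrite (_ : EFin \o _ = (fun p : plane R * plane R =>
      (C%:E * (\1_(box M `*` box M) p)%:E)%E))//.
    apply: integrableZl => //; apply/integrableP; split.
      exact/measurable_EFinP/measurable_indic.
    under eq_integral do rewrite gee0_abs ?lee_fin//.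
    have pE : ((area \x area) (box M `*` box M) = area (box M) * area (box M))%E.
      by apply: product_measure1E; exact: measurable_box.
    by rewrite integral_indic// setIT [X in (X < _)%E]pE area_box// -EFinM ltry.
  apply: (le_integrable _ _ _ ib) => // -[x y] _ /=; rewrite lee_fin indicE.
  have [_|xy] := boolP (_ \in _).
    by rewrite mulr1 (le_trans (FC x y))// ler_norm.
  by rewrite /G/= FM ?normr0//; move: xy; rewrite notin_setE.
have Ex : (fun x => \int[area]_y G (x, y))%E = EFin \o (fun x => integ (F x)).
  by apply/funext => x /=; rewrite EFin_integ.
have Ey : (fun y => \int[area]_x G (x, y))%E = EFin \o (fun y => integ (F^~ y)).
  by apply/funext => x /=; rewrite EFin_integ.
have bnd f x : nice f -> (forall y, `|f y| <= C) -> (forall y : R * R, N < `|y| -> f y = 0) ->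
    x = integ f -> `|x| <= C * (M *+ 2) ^+ 2.
  move=> nf fC fN ->; apply: (le_integ_bound (x := 0)) => // y; rewrite subr0 indicE.
  have [_|yM] := boolP (_ \in _); first by rewrite mulr1.
  rewrite fN ?normr0 ?mulr0//; move: yM; rewrite notin_setE /box/= => /negP.
  by rewrite -ltNge gt_max => /andP[].
have nX : nice (fun x => integ (F x)).
  split.
    apply/measurable_EFinP; rewrite -Ex.
    exact: (measurable_fubini_F iG).
  exists N, (C * (M *+ 2) ^+ 2); split=> x.
    by apply: (@bnd (F x)) => // y yN; apply: FN; right.
  move=> xN; rewrite (_ : F x = cst 0); first by rewrite /integ Rintegral_cst// mul0r.
  by apply/funext => y; apply: FN; left.
have nY : nice (fun y => integ (F^~ y)).
  split.
    apply/measurable_EFinP; rewrite -Ey.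
    exact: (measurable_fubini_G iG).
  exists N, (C * (M *+ 2) ^+ 2); split=> x.
    by apply: (@bnd (F^~ x)) => // y yN; apply: FN; left.
  move=> xN; rewrite (_ : F^~ x = cst 0); first by rewrite /integ Rintegral_cst// mul0r.
  by apply/funext => y; apply: FN; right.
split; [exact: nX|exact: nY|apply: EFin_inj].
rewrite (EFin_integ nX) (EFin_integ nY).
by have := Fubini iG; rewrite Ex Ey.
Qed.

End convolution.

(** * Perimeter bounds and mollified indicators *)

Section perimeter_bound.
Context {R : realType}.
Implicit Types (f g d K : R * R -> R) (A B : set (R * R)) (z : R * R).

(* [f] and [g] are the components of an admissible field, [f1], [f2], [g1],
   [g2] their partial derivatives; the divergence is [f1 + g2]. *)
Definition admissible f f1 f2 g g1 g2 := [/\ C1 f f1 f2, C1 g g1 g2,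
  exists N : R, forall x : R * R, N < `|x| -> f x = 0 /\ g x = 0 &
  forall x, f x ^+ 2 + g x ^+ 2 <= 1].

Definition perimeter_le A (a : R) := forall f f1 f2 g g1 g2,
  admissible f f1 f2 g g1 g2 -> integ (fun x => \1_A x * (f1 x + g2 x)) <= a.

Lemma admissible_nice f f1 f2 g g1 g2 : admissible f f1 f2 g g1 g2 ->
  nice (fun x => f1 x + g2 x).
Proof.
move=> [Cf Cg [N fgN] _].
have [nf _] := C1_nice_partials Cf (fun x Nx => (fgN x Nx).1).
have [_ ng] := C1_nice_partials Cg (fun x Nx => (fgN x Nx).2).
exact: niceD.
Qed.

Lemma integ_divergence f f1 f2 g g1 g2 : admissible f f1 f2 g g1 g2 ->
  integ (fun x => f1 x + g2 x) = 0.
Proof.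
move=> [Cf Cg [N fgN] _].
have [nf _] := C1_nice_partials Cf (fun x Nx => (fgN x Nx).1).
have [_ ng] := C1_nice_partials Cg (fun x Nx => (fgN x Nx).2).
have [i1 _] := integ_partials Cf (fun x Nx => (fgN x Nx).1).
have [_ i2] := integ_partials Cg (fun x Nx => (fgN x Nx).2).
by rewrite integD// i1 i2 addr0.
Qed.

Lemma C1_shift z f f1 f2 : C1 f f1 f2 ->
  C1 (fun x => f (x + z)) (fun x => f1 (x + z)) (fun x => f2 (x + z)).
Proof.
move=> [c1 c2 df].
have cs : continuous (fun x : R * R => x + z).
  by move=> x; apply: cvgD; [exact: cvg_id|exact: cvg_cst].
split=> x.
- exact: (@continuous_comp _ _ _ (fun y : R * R => y + z) f1 x (cs x) (c1 _)).
- exact: (@continuous_comp _ _ _ (fun y : R * R => y + z) f2 x (cs x) (c2 _)).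
have ds := is_diffD (is_diff_id x) (is_diff_cst z x).
apply: (is_diff_eq (is_diff_comp ds (df _))).
by apply/funext => h; rewrite /= !addr0; exact: erefl.
Qed.

Lemma admissible_shift z f f1 f2 g g1 g2 : admissible f f1 f2 g g1 g2 ->
  admissible (fun x => f (x + z)) (fun x => f1 (x + z)) (fun x => f2 (x + z))
    (fun x => g (x + z)) (fun x => g1 (x + z)) (fun x => g2 (x + z)).
Proof.
move=> [Cf Cg [N fgN] fg1]; split=> //; [exact: C1_shift..|].
exists (N + `|z|) => x xN; apply: fgN.
rewrite -(ltrD2r `|z|) (lt_le_trans xN)//.
by rewrite -{1}(addrK z x) (le_trans (ler_normB _ _)).
Qed.

Lemma admissible0 : admissible (cst 0) (cst 0) (cst 0) (cst 0) (cst 0) (cst 0).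
Proof.
split; [exact: C1_cst..|by exists 0|].
by move=> x; rewrite /= expr0n addr0 ler01.
Qed.

Lemma perimeter_le_ge0 A a : perimeter_le A a -> 0 <= a.
Proof.
move=> /(_ _ _ _ _ _ _ admissible0); congr (_ <= _).
rewrite (_ : (fun x => _) = cst 0); first by rewrite /integ Rintegral_cst// mul0r.
by apply/funext => x; rewrite /= addr0 mulr0.
Qed.

Lemma admissibleN f f1 f2 g g1 g2 : admissible f f1 f2 g g1 g2 ->
  admissible (fun x => -1 * f x) (fun x => -1 * f1 x) (fun x => -1 * f2 x)
    (fun x => -1 * g x) (fun x => -1 * g1 x) (fun x => -1 * g2 x).
Proof.
move=> [Cf Cg [N fgN] fg1]; split; [exact: C1Z..| |].
- by exists N => x /fgN[-> ->]; rewrite mulr0.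
- by move=> x; rewrite !mulN1r !sqrrN.
Qed.

(** The divergence of an admissible field has integral 0, so testing the complement with a field is
    testing [A] with the opposite field. *)
Lemma perimeter_leC A a : measurable (A : set (plane R)) ->
  perimeter_le A a -> perimeter_le (~` A) a.
Proof.
move=> mA pA f f1 f2 g g1 g2 adm; have := pA _ _ _ _ _ _ (admissibleN adm).
have nd := admissible_nice adm; have id := integ_divergence adm.
have -> : (fun x => \1_(~` A) x * (f1 x + g2 x)) =
    (fun x => (f1 x + g2 x) - \1_A x * (f1 x + g2 x)).
  apply/funext => x; rewrite indicC/= indicE.
  by case: (x \in A); rewrite /= ?(mul0r, mul1r, subrr, subr0).
rewrite integB//; last exact: nice_indic.
rewrite id sub0r -integN//; last exact: nice_indic.
by congr (_ <= _); congr (integ _); apply/funext => x; ring.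
Qed.

Lemma measurable_addrr : measurable_fun [set: plane R * plane R]
  ((fun p => (p.1 : R * R) + p.2) : plane R * plane R -> plane R).
Proof.
apply: (@measurable_fun_pair _ _ _ (plane R * plane R)%type (measurableTypeR R) (measurableTypeR R)
  (fun p => (p.1.1 : R) + p.2.1) (fun p => (p.1.2 : R) + p.2.2)).
- apply: measurable_funD; apply: measurableT_comp => //.
- apply: measurable_funD; apply: measurableT_comp => //.
Qed.

Lemma mollifier (r : R) : 0 < r -> exists K k1 k2 (C L : R),
  [/\ nice K, nice k1, nice k2 & 0 <= L] /\
  [/\ forall x, 0 <= K x, integ K = 1, forall x, r <= `|x| -> K x = 0 &
  forall x h : R * R, `|h| <= 1 ->
  [/\ `|K (x + h) - K x - (h.1 * k1 x + h.2 * k2 x)| <= C * `|h| ^+ 2 * \1_(box L) x,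
      `|k1 (x + h) - k1 x| <= C * `|h| * \1_(box L) x &
      `|k2 (x + h) - k2 x| <= C * `|h| * \1_(box L) x]].
Proof.
move=> r0; have [nb nb1 nb2] := bump_nice r0.
have Z0 := integ_bump_gt0 r0.
set Z := integ _ in Z0; pose K x := Z^-1 * bump r x.
have Z'0 : 0 < Z^-1 by rewrite invr_gt0.
have [C est] := bump_estimate r0.
exists K, (fun x => Z^-1 * bump1 r x), (fun x => Z^-1 * bump2 r x), (Z^-1 * C), (r + 1).
split; split; [exact: niceZ..|by rewrite addr_ge0// ltW| | | |].
- by move=> x; rewrite mulr_ge0 ?sqr_ge0// ltW.
- by rewrite integZ// mulVf// gt_eqF.
- by move=> x /(posp_bumpq_eq0 r0); rewrite /K /bump => ->; rewrite expr0n mulr0.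
move=> x h h1; have [e1 e2 e3] := est x h h1; split.
- have -> : K (x + h) - K x - (h.1 * (Z^-1 * bump1 r x) + h.2 * (Z^-1 * bump2 r x)) =
    Z^-1 * (bump r (x + h) - bump r x - (h.1 * bump1 r x + h.2 * bump2 r x)).
    by rewrite /K; ring.
  by rewrite normrM (ger0_norm (ltW Z'0)) (le_trans (ler_wpM2l (ltW Z'0) e1))// !mulrA.
- by rewrite -mulrBr normrM (ger0_norm (ltW Z'0)) (le_trans (ler_wpM2l (ltW Z'0) e2))// !mulrA.
- by rewrite -mulrBr normrM (ger0_norm (ltW Z'0)) (le_trans (ler_wpM2l (ltW Z'0) e3))// !mulrA.
Qed.

Lemma mfun_indic A : measurable (A : set (plane R)) -> mfun (\1_A : R * R -> R).
Proof. exact: measurable_indic. Qed.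

Lemma normr_indic_le1 A x : `|\1_A x : R| <= 1.
Proof. by rewrite indicE; case: (_ \in _); rewrite ?normr1 ?normr0. Qed.

(** Continuity bounds [u] on the compact box that carries [d]. *)
Lemma nice_continuousM (u d : R * R -> R) : continuous u -> nice d ->
  nice (fun x => u x * d x).
Proof.
move=> cu [md [N [C [dC dN]]]]; split; first exact: (measurable_funM (continuous_mfun cu) md).
have : compact (u @` box N).
  by apply: continuous_compact (@compact_box R N); exact: continuous_subspaceT.
move=> /compact_bounded[M [_ Mu]].
have C0 : 0 <= C by exact: le_trans (dC 0).
exists N, ((`|M| + 1) * C); split=> x; last by move=> /dN ->; rewrite mulr0.
have [xN|/dN ->] := leP `|x| N; last by rewrite mulr0 normr0 mulr_ge0// addr_ge0.
rewrite normrM ler_pM//.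
by apply: Mu; [rewrite (le_lt_trans (ler_norm _))// ltrDl|exists x].
Qed.

Lemma nice_indic_dist (w : R * R -> R) A (N : R) : continuous w ->
  measurable (A : set (plane R)) ->
  nice (fun x => \1_(box N) x * `|w x - \1_A x|).
Proof.
move=> cw mA; rewrite (_ : (fun x => _) =
    (fun x => `|w x * \1_(box N) x - \1_A x * \1_(box N) x|)).
  apply: nice_norm; apply: niceB; first exact: (nice_continuousM cw (nice_box N)).
  exact: (nice_indic mA (nice_box N)).
apply/funext => x; rewrite -mulrBl normrM mulrC; congr (_ * _).
by rewrite ger0_norm// indicE.
Qed.

Lemma nice_indic_boxI A (N : R) : measurable (A : set (plane R)) ->
  nice (\1_(box N `&` A) : R * R -> R).
Proof.
move=> mA; rewrite setIC indicI; exact: (nice_indic mA (nice_box N)).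
Qed.

Lemma integ_indic_boxI_le A (N e : R) : measurable (A : set (plane R)) ->
  (area (box N `&` A) <= e%:E)%E -> integ \1_(box N `&` A) <= e.
Proof.
move=> mA Ae; rewrite integ_indic; last exact: measurable_boxI.
by rewrite -lee_fin fineK// ge0_fin_numE// area_boxI_lty.
Qed.

Lemma conv_indicE K A x : nice K -> measurable (A : set (plane R)) ->
  integ (fun y => K (y - x) * \1_A y) = integ (fun z => K z * \1_A (z + x)).
Proof.
move=> nK mA.
have nKA := niceMg (mfun_indic mA) (normr_indic_le1 A) (nice_shift (- x) nK).
rewrite -(integ_shift x nKA); congr (integ _); apply/funext => z.
by rewrite addrK.
Qed.

Lemma measurable_indic_addrr A : measurable (A : set (plane R)) ->
  measurable_fun [set: plane R * plane R]
    (fun p : plane R * plane R => \1_A ((p.2 : R * R) + p.1) : R).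
Proof.
move=> mA; rewrite (_ : (fun p => _) = \1_A \o (fun p : plane R * plane R => (p.1 : R * R) + p.2)).
  exact: (measurableT_comp (mfun_indic mA : measurable_fun _ _) measurable_addrr).
by apply/funext => p; rewrite /= addrC.
Qed.

Lemma mfun_fst f : mfun f -> measurable_fun [set: plane R * plane R]
  (fun p : plane R * plane R => f p.1).
Proof. move=> mf; exact: (measurableT_comp (mf : measurable_fun _ _) measurable_fst). Qed.

Lemma mfun_snd f : mfun f -> measurable_fun [set: plane R * plane R]
  (fun p : plane R * plane R => f p.2).
Proof. move=> mf; exact: (measurableT_comp (mf : measurable_fun _ _) measurable_snd). Qed.

Lemma integ_cst0 : integ (cst 0 : R * R -> R) = 0.
Proof. by rewrite /integ Rintegral_cst// mul0r. Qed.

(** By Fubini, testing the mollified indicator with [d] is averaging, with the weights [K z] of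
    total mass 1, the tests of [\1_A] with the translates of [d]. Mollification thus preserves
    perimeter bounds. *)
Lemma integ_conv_le K A d (a : R) : nice K -> (forall x, 0 <= K x) -> integ K = 1 ->
  measurable (A : set (plane R)) -> nice d ->
  (forall z, integ (fun x => \1_A x * d (x - z)) <= a) ->
  integ (fun x => integ (fun y => K (y - x) * \1_A y) * d x) <= a.
Proof.
move=> nK K0 iK mA nd da.
have [N [C [KC KN]]] := nK.2; have [N' [C' [dC dN]]] := nd.2.
have C0 : 0 <= C by exact: le_trans (KC 0).
pose F x z := K z * \1_A (z + x) * d x.
have mF : measurable_fun [set: plane R * plane R] (fun p : plane R * plane R => F p.1 p.2).
  apply: (measurable_funM _ (mfun_fst nd.1)).
  exact: (measurable_funM (mfun_snd nK.1) (measurable_indic_addrr mA)).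
have FC x z : `|F x z| <= C * C'.
  rewrite /F normrM ler_pM// normrM -[C]mulr1 ler_pM//; exact: normr_indic_le1.
have F0 (x z : R * R) : Num.max N N' < `|x| \/ Num.max N N' < `|z| -> F x z = 0.
  rewrite !gt_max /F => -[/andP[_ /dN ->]|/andP[/KN -> _]]; first by rewrite mulr0.
  by rewrite !mul0r.
have [_ nF FE] := integ_fubini mF FC F0.
have -> : integ (fun x => integ (fun y => K (y - x) * \1_A y) * d x) =
    integ (fun x => integ (F x)).
  congr (integ _); apply/funext => x; rewrite conv_indicE// mulrC -integZ.
    by congr (integ _); apply/funext => z; exact: mulrC.
  have mAx : mfun (fun z => \1_A (z + x) : R).
    exact: (measurableT_comp (mfun_indic mA : measurable_fun _ _) (measurable_shift x)).
  exact: (niceMg mAx (fun z => normr_indic_le1 A (z + x)) nK).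
have -> : a = integ (fun z => a * K z) by rewrite (integZ a nK) iK mulr1.
rewrite FE; apply: (le_integ nF (niceZ a nK)) => z.
have nAd := nice_indic mA (nice_shift (- z) nd).
have -> : F^~ z = (fun x => K z * (\1_A (x + z) * d (x + z - z))).
  by apply/funext => x; rewrite addrK /F (addrC z) mulrA.
rewrite (integZ _ (nice_shift z nAd)) (integ_shift z nAd) mulrC.
exact: ler_wpM2r.
Qed.

(** The distance at [x] is at most the [K]-average of [|\1_A (z + x) - \1_A x|]. After exchanging
    the integrals, each [z] contributes the area in the box between [A] and its translate. *)
Lemma integ_conv_indic_dist K A (N e : R) : nice K -> (forall x, 0 <= K x) -> integ K = 1 ->
  measurable (A : set (plane R)) ->
  continuous (fun x : R * R => integ (fun y => K (y - x) * \1_A y)) ->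
  (forall z, K z != 0 -> (area (box N `&` (shift_set z A `+` A)) <= e%:E)%E) ->
  integ (fun x => \1_(box N) x * `|integ (fun y => K (y - x) * \1_A y) - \1_A x|) <= e.
Proof.
move=> nK K0 iK mA cu Ae.
have [N' [C [KC KN]]] := nK.2.
have C0 : 0 <= C by exact: le_trans (KC 0).
have mN : mfun (\1_(box N) : R * R -> R) by exact: (mfun_indic (@measurable_box R N)).
pose D x z : R := `|\1_A (z + x) - \1_A x|.
have D1 x z : `|D x z| <= 1.
  rewrite /D normr_id !indicE.
  by do 2 case: (_ \in _); rewrite ?subrr ?subr0 ?sub0r ?normrN ?normr1 ?normr0.
have mD : measurable_fun [set: plane R * plane R] (fun p : plane R * plane R => D p.1 p.2).
  apply: measurableT_comp; first exact: normr_measurable.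
  exact: (measurable_funB (measurable_indic_addrr mA) (mfun_fst (mfun_indic mA))).
pose F x z := \1_(box N) x * (K z * D x z).
have mF : measurable_fun [set: plane R * plane R] (fun p : plane R * plane R => F p.1 p.2).
  exact: (measurable_funM (mfun_fst mN) (measurable_funM (mfun_snd nK.1) mD)).
have FC x z : `|F x z| <= C.
  rewrite /F normrM -[C]mul1r ler_pM//; first exact: normr_indic_le1.
  by rewrite normrM -[C]mulr1 ler_pM.
have F0 (x z : R * R) : Num.max N N' < `|x| \/ Num.max N N' < `|z| -> F x z = 0.
  rewrite !gt_max /F => -[/andP[xN _]|/andP[_ /KN ->]]; last by rewrite mul0r mulr0.
  by rewrite indicE memNset ?mul0r// /box/= => /le_lt_trans - /(_ _ xN); rewrite ltxx.
have [nX nF FE] := integ_fubini mF FC F0.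
have nKD x : nice (fun z => K z * D x z).
  have mDx : mfun (D x) by exact: (measurableT_comp mD (measurable_pair1 (x : plane R))).
  exact: (niceMg mDx (D1 x) nK).
have mAx x : mfun (fun z => \1_A (z + x) : R).
  exact: (measurableT_comp (mfun_indic mA : measurable_fun _ _) (measurable_shift x)).
have nKA x := niceMg (mAx x) (fun z => normr_indic_le1 A (z + x)) nK.
have nL := nice_indic_dist N cu mA.
apply: (@le_trans _ _ (integ (fun x => integ (F x)))).
  apply: (le_integ nL nX) => x; rewrite /F (integZ _ (nKD x)).
  apply: ler_wpM2l; first by rewrite indicE.
  have nKc : nice (fun z => K z * \1_A x).
    by under eq_fun do rewrite mulrC; exact: (niceZ _ nK).
  have iKc : integ (fun z => K z * \1_A x) = \1_A x.
    by under eq_fun do rewrite mulrC; rewrite (integZ _ nK) iK mulr1.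
  rewrite (conv_indicE x nK mA) -[X in _ - X]iKc -(integB (nKA x) nKc).
  apply: le_trans (le_normr_integ (niceB (nKA x) nKc)) _.
  rewrite le_eqVlt; apply/orP; left; apply/eqP; congr (integ _); apply/funext => z.
  by rewrite -mulrBr normrM (ger0_norm (K0 z)).
have -> : e = integ (fun z => e * K z) by rewrite (integZ e nK) iK mulr1.
rewrite FE; apply: (le_integ nF (niceZ e nK)) => z.
have [Kz|/Ae Az] := eqVneq (K z) 0.
  have -> : F^~ z = cst 0 by apply/funext => x; rewrite /F Kz mul0r mulr0.
  by rewrite Kz mulr0 integ_cst0; exact: lexx.
have mS := measurableY (measurable_shift_set z mA) mA.
have nS := nice_indic_boxI N mS.
have -> : F^~ z = (fun x => K z * \1_(box N `&` (shift_set z A `+` A)) x).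
  apply/funext => x; rewrite /F mulrCA; congr (_ * _).
  rewrite indicI/=; congr (_ * _); rewrite /D (addrC z) !indicE.
  rewrite setY_def in_setU !in_setD.
  have -> : (x \in shift_set z A) = (x + z \in A) by [].
  by do 2 case: (_ \in _); rewrite /= ?subrr ?subr0 ?sub0r ?normrN ?normr1 ?normr0.
rewrite (integZ _ nS) mulrC; apply: (ler_wpM2r (K0 z)).
exact: integ_indic_boxI_le.
Qed.

(** Translates of admissible fields are admissible, so a single [u] inherits every perimeter bound
    of [A]. A kernel supported where translation moves [A] by area at most [e] gives the L1
    estimate. *)
Lemma C1_indic_approx A (N e : R) : measurable (A : set (plane R)) -> 0 < e ->
  exists u u1 u2, [/\ C1 u u1 u2,
    forall a f f1 f2 g g1 g2, perimeter_le A a -> admissible f f1 f2 g g1 g2 ->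
      integ (fun x => u x * (f1 x + g2 x)) <= a &
    integ (fun x => \1_(box N) x * `|u x - \1_A x|) <= e].
Proof.
move=> mA e0.
have [_ /(_ N e e0)[r r0 tA]] := measurable_translation_continuous mA.
have [K [k1 [k2 [C [L [[nK nk1 nk2 L0] [K0 iK Kr est]]]]]]] := mollifier r0.
have Cu := conv_C1 nK nk1 nk2 (mfun_indic mA) (normr_indic_le1 A) L0 est.
exists (fun x => integ (fun y => K (y - x) * \1_A y)).
exists (fun x => - integ (fun y => k1 (y - x) * \1_A y)).
exists (fun x => - integ (fun y => k2 (y - x) * \1_A y)).
split; first exact: Cu.
- move=> a f f1 f2 g g1 g2 pA adm.
  apply: (integ_conv_le nK K0 iK mA (admissible_nice adm)) => z.
  exact: (pA _ _ _ _ _ _ (admissible_shift (- z) adm)).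
- apply: (integ_conv_indic_dist nK K0 iK mA (C1_continuous Cu)) => z Kz.
  by apply: tA; rewrite ltNge; apply/negP => /Kr /eqP; rewrite (negbTE Kz).
Qed.

End perimeter_bound.

(** * Submodularity of the perimeter *)

Section smooth_max.
Context {R : realType}.
Variable e : R.
Hypothesis e0 : 0 < e.

Let s (t : R) : R := Num.sqrt (t ^+ 2 + e ^+ 2).

Let arg_gt0 t : 0 < t ^+ 2 + e ^+ 2.
Proof. by rewrite ltr_wpDl ?sqr_ge0// exprn_gt0. Qed.

Let s_gt0 t : 0 < s t. Proof. by rewrite sqrtr_gt0. Qed.

Let s_sqr t : s t ^+ 2 = t ^+ 2 + e ^+ 2.
Proof. by rewrite sqr_sqrtr// ltW. Qed.

Let s_ge t : `|t| <= s t.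
Proof. by rewrite /s -sqrtr_sqr; apply: ler_wsqrtr; rewrite lerDl sqr_ge0. Qed.

Let s_le t : s t <= `|t| + e.
Proof.
have h : s t ^+ 2 <= (`|t| + e) ^+ 2.
  rewrite s_sqr sqrrD real_normK ?num_real//.
  by rewrite -addrA lerD2l lerDr mulrn_wge0// mulr_ge0// ltW.
by move: h; rewrite ler_sqr ?nnegrE ?addr_ge0// ltW.
Qed.

(* [ramp] is a smooth approximation of [t |-> max t 0], with derivative [ramp1]. *)
Definition ramp (t : R) := (t + s t) / 2.
Definition ramp1 (t : R) := (1 + t / s t) / 2.
(** The derivative of [ramp1], written as the differentiation rules produce it; it equals
    [e ^+ 2 / (2 * s t ^+ 3)]. *)
Definition ramp2 (t : R) := (s t * s t)^-1 * (s t - t * (t / s t)) / 2.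

Lemma ramp1_ge0_le1 t : 0 <= ramp1 t <= 1.
Proof.
have : `|t / s t| <= 1 by rewrite normrM normfV (gtr0_norm (s_gt0 t)) ler_pdivrMr// mul1r.
by rewrite /ramp1 ler_norml => /andP[? ?]; apply/andP; split; lra.
Qed.

(** [Num.max t 0] is [(t + |t|) / 2], and [s t] lies between [|t|] and [|t| + e]. *)
Lemma ramp_approx t : `|ramp t - Num.max t 0| <= e.
Proof.
rewrite /ramp; have := s_ge t; have := s_le t; have e1 := e0.
have [t0|t0] := leP t 0.
  by rewrite ler0_norm// => h1 h2; rewrite ler_norml; apply/andP; split; lra.
by rewrite gtr0_norm// => h1 h2; rewrite ler_norml; apply/andP; split; lra.
Qed.

Let is_derive_s t : is_derive t (1 : R) s (t / s t).
Proof.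
have h1 := is_derive1_sqrt (arg_gt0 t).
have h2 : is_derive t (1 : R) (fun x : R => x ^+ 2 + e ^+ 2) (t *+ 2).
  apply: (is_derive_eq (is_deriveD (is_deriveX 2 (is_derive_id t 1)) (is_derive_cst (e ^+ 2) t 1))).
  by rewrite addr0 /GRing.scale/= expr1 mulr1 mulr_natl.
have := @is_derive1_comp _ Num.sqrt (fun x : R => x ^+ 2 + e ^+ 2) t _ _ h1 h2.
move=> h; apply: (is_derive_eq h).
rewrite -/(s t) /GRing.scale/= invfM mulrC -mulr_natr; field.
by rewrite gt_eqF.
Qed.

Lemma is_derive_ramp t : is_derive t (1 : R) ramp (ramp1 t).
Proof.
have h := is_deriveZ (2^-1 : R) (is_deriveD (is_derive_id t 1) (is_derive_s t)).
have -> : ramp = 2^-1 \*: (id + s).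
  by apply/funext => x; rewrite /ramp /= fctE /GRing.scale/= mulrC.
by apply: (is_derive_eq h); rewrite /ramp1 /GRing.scale/= mulrC.
Qed.

Lemma is_derive_ramp1 t : is_derive t (1 : R) ramp1 (ramp2 t).
Proof.
have sn0 : s t != 0 by rewrite gt_eqF.
have hs := is_derive_s t.
have hV : is_derive t (1 : R) (fun x => (s x)^-1) (- (s t) ^- 2 * (t / s t)).
  have [ds es] := hs; split; first exact: derivableV.
  by rewrite deriveV// es.
have hM := is_deriveM (is_derive_id t (1 : R)) hV.
have h := is_deriveZ (2^-1 : R) (is_deriveD (is_derive_cst (1 : R) t 1) hM).
have -> : ramp1 = 2^-1 \*: (cst 1 + id * (fun x => (s x)^-1)).
  by apply/funext => x; rewrite /ramp1 /= !fctE /GRing.scale/= mulrC.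
by apply: (is_derive_eq h); rewrite /ramp2 /GRing.scale/= ; field.
Qed.

Lemma ramp1_ramp2_continuous : continuous ramp1 /\ continuous ramp2.
Proof.
have cd (f f' : R -> R) : (forall t, is_derive t (1 : R) f (f' t)) -> continuous f.
  move=> df x; apply/differentiable_continuous/derivable1_diffP.
  by case: (df x).
have cs := cd _ _ is_derive_s.
split; first exact: cd is_derive_ramp1.
move=> t; apply: cvgM; last exact: cvg_cst.
have sn0 : s t != 0 by rewrite gt_eqF.
apply: cvgM.
  by apply: cvgV; [rewrite mulf_neq0|apply: cvgM; exact: cs].
apply: cvgB; first exact: cs.
apply: cvgM; first exact: cvg_id.
apply: cvgM; first exact: cvg_id.
by apply: cvgV => //; exact: cs.
Qed.

End smooth_max.

Section submodularity.
Context {R : realType}.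
Implicit Types (A B : set (R * R)).

(** Mixed fields stay admissible because the Euclidean unit disc is convex; the identity in the
    proof displays the convexity deficit, [c * (1 - c)] times a squared distance. *)
Lemma convex_comb_norm (c a b a' b' : R) : 0 <= c <= 1 ->
  a ^+ 2 + b ^+ 2 <= 1 -> a' ^+ 2 + b' ^+ 2 <= 1 ->
  (a' + c * (a - a')) ^+ 2 + (b' + c * (b - b')) ^+ 2 <= 1.
Proof.
move=> /andP[c0 c1] ab ab'.
have : (a' + c * (a - a')) ^+ 2 + (b' + c * (b - b')) ^+ 2 =
  c * (a ^+ 2 + b ^+ 2) + (1 - c) * (a' ^+ 2 + b' ^+ 2)
  - c * (1 - c) * ((a - a') ^+ 2 + (b - b') ^+ 2) by ring.
move=> ->.
have h1 : c * (a ^+ 2 + b ^+ 2) <= c * 1 by rewrite ler_wpM2l.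
have h2 : (1 - c) * (a' ^+ 2 + b' ^+ 2) <= (1 - c) * 1 by rewrite ler_wpM2l// subr_ge0.
have h3 : 0 <= c * (1 - c) * ((a - a') ^+ 2 + (b - b') ^+ 2).
  by rewrite !mulr_ge0 ?subr_ge0// addr_ge0// sqr_ge0.
lra.
Qed.

(* With [w = u - v] and [c = ramp1 w], test [u] against the field
   [F' + c (F - F')] and [v] against [F - c (F - F')]; the difference of the two
   sides is the divergence of [(ramp w - w c) (F - F')]. *)
Lemma smooth_submodularity (e : R) u u1 u2 v v1 v2 (a b : R)
    f f1 f2 g g1 g2 f' f1' f2' g' g1' g2' : 0 < e ->
  C1 u u1 u2 -> C1 v v1 v2 ->
  (forall f f1 f2 g g1 g2, @admissible R f f1 f2 g g1 g2 ->
      integ (fun x => u x * (f1 x + g2 x)) <= a) ->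
  (forall f f1 f2 g g1 g2, @admissible R f f1 f2 g g1 g2 ->
      integ (fun x => v x * (f1 x + g2 x)) <= b) ->
  @admissible R f f1 f2 g g1 g2 -> @admissible R f' f1' f2' g' g1' g2' ->
  integ (fun x => (v x + ramp e (u x - v x)) * (f1 x + g2 x) +
                  (u x - ramp e (u x - v x)) * (f1' x + g2' x)) <= a + b.
Proof.
move=> e0 Cu Cv ua vb adm adm'.
have [cr1 cr2] := ramp1_ramp2_continuous e0.
have Cw := C1B Cu Cv.
have Cr := C1_comp cr1 (is_derive_ramp e0) Cw.
have Cc := C1_comp cr2 (is_derive_ramp1 e0) Cw.
have dr := is_derive_ramp e0.
case: (adm) (adm') => [Cf Cg [N fgN] fg1] [Cf' Cg' [N' fgN'] fg1'].
have c01 t := ramp1_ge0_le1 e0 t.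
move: Cr Cc c01; move: (ramp e) (ramp1 e) (ramp2 e) => r c c' Cr Cc c01.
have Cdf := C1B Cf Cf'; have Cdg := C1B Cg Cg'.
have Ccf := C1M Cc Cdf; have Ccg := C1M Cc Cdg.
have supp (x : R * R) : Num.max N N' < `|x| -> [/\ f x = 0, g x = 0, f' x = 0 & g' x = 0].
  by rewrite gt_max => /andP[/fgN[-> ->] /fgN'[-> ->]].
have s1 : exists M : R, forall x : R * R, M < `|x| ->
    f' x + c (u x - v x) * (f x - f' x) = 0 /\ g' x + c (u x - v x) * (g x - g' x) = 0.
  by exists (Num.max N N') => x /supp[-> -> -> ->]; rewrite subrr mulr0 addr0.
have s2 : exists M : R, forall x : R * R, M < `|x| ->
    f x - c (u x - v x) * (f x - f' x) = 0 /\ g x - c (u x - v x) * (g x - g' x) = 0.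
  by exists (Num.max N N') => x /supp[-> -> -> ->]; rewrite subrr mulr0 subr0.
have n1 x : (f' x + c (u x - v x) * (f x - f' x)) ^+ 2 +
    (g' x + c (u x - v x) * (g x - g' x)) ^+ 2 <= 1 by exact: convex_comb_norm.
have n2 x : (f x - c (u x - v x) * (f x - f' x)) ^+ 2 +
    (g x - c (u x - v x) * (g x - g' x)) ^+ 2 <= 1.
  (* Subtracting [c (F - F')] from [F] is adding [c (F' - F)]: the same convex combination with the
     two fields exchanged. *)
  rewrite -mulrN -[X in _ + (_ + X) ^+ 2]mulrN !opprB; exact: convex_comb_norm.
have admh : admissible _ _ _ _ _ _ := And4 (C1D Cf' Ccf) (C1D Cg' Ccg) s1 n1.
have admk : admissible _ _ _ _ _ _ := And4 (C1B Cf Ccf) (C1B Cg Ccg) s2 n2.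
(* As [c] is the derivative of [r], the gradient of [r - w c] is [- w c'] times that of [w]: exactly
   the term that arises from differentiating the weight. *)
have CX := C1B Cr (C1M Cw Cc).
have CXf := C1M CX Cdf; have CXg := C1M CX Cdg.
have Xf0 (x : R * R) : Num.max N N' < `|x| ->
    (r (u x - v x) - (u x - v x) * c (u x - v x)) * (f x - f' x) = 0.
  by move=> /supp[-> _ -> _]; rewrite subrr mulr0.
have Xg0 (x : R * R) : Num.max N N' < `|x| ->
    (r (u x - v x) - (u x - v x) * c (u x - v x)) * (g x - g' x) = 0.
  by move=> /supp[_ -> _ ->]; rewrite subrr mulr0.
have [If _] := integ_partials CXf Xf0; have [nf _] := C1_nice_partials CXf Xf0.
have [_ Ig] := integ_partials CXg Xg0; have [_ ng] := C1_nice_partials CXg Xg0.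
have nh := nice_continuousM (C1_continuous Cu) (admissible_nice admh).
have nk := nice_continuousM (C1_continuous Cv) (admissible_nice admk).
have := lerD (ua _ _ _ _ _ _ admh) (vb _ _ _ _ _ _ admk).
rewrite -(integD nh nk) -[X in X <= _]addr0 -[X in _ + X <= _]addr0.
rewrite -{1}If -Ig -(integD nf ng) -(integD (niceD nh nk) (niceD nf ng)).
congr (_ <= _); congr (integ _); apply/funext => x; ring.
Qed.

(** Union and intersection are the maximum and the minimum of the indicators. Written with a
    positive part, they match the two coefficients in [smooth_submodularity] with [ramp] replaced by
    its limit. *)
Lemma indic_setU_setI A B (x : R * R) :
  \1_(A `|` B) x = \1_B x + Num.max (\1_A x - \1_B x) 0 :> R /\
  \1_(A `&` B) x = \1_A x - Num.max (\1_A x - \1_B x) 0 :> R.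
Proof.
rewrite !indicE in_setU in_setI; case: (x \in A); case: (x \in B); rewrite /=.
- by rewrite subrr maxxx addr0 subr0.
- by rewrite subr0 add0r max_l// subrr.
- by rewrite sub0r max_r ?addr0 ?subr0// oppr_le0.
- by rewrite subrr maxxx addr0 subr0.
Qed.

Lemma max0_lip (s t : R) : `|Num.max s 0 - Num.max t 0| <= `|s - t|.
Proof.
have := posp_lip t (s - t); rewrite /posp.
by rewrite (_ : t + (s - t) = s)//; ring.
Qed.

(** The two test fields are independent, so taking suprema would give the usual inequality between
    perimeters. The proof passes to the limit in [smooth_submodularity]; both divergences vanish
    outside one box, and only L1 errors on this box matter. *)
Lemma submodularity A B (a b : R) f f1 f2 g g1 g2 f' f1' f2' g' g1' g2' :
  measurable (A : set (plane R)) -> measurable (B : set (plane R)) ->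
  perimeter_le A a -> perimeter_le B b ->
  @admissible R f f1 f2 g g1 g2 -> @admissible R f' f1' f2' g' g1' g2' ->
  integ (fun x => \1_(A `|` B) x * (f1 x + g2 x)) +
  integ (fun x => \1_(A `&` B) x * (f1' x + g2' x)) <= a + b.
Proof.
move=> mA mB pA pB adm adm'.
have nd := admissible_nice adm; have nd' := admissible_nice adm'.
have [N [C [dC dN]]] := nd.2; have [N' [C' [dC' dN']]] := nd'.2.
pose M := Num.max (Num.max N N') 0; pose D := C + C'.
have M0 : 0 <= M by rewrite /M le_max lexx orbT.
have C0 : 0 <= C by exact: le_trans (dC 0).
have C0' : 0 <= C' by exact: le_trans (dC' 0).
have D0 : 0 <= D by rewrite addr_ge0.
(* [W * e] is the total error. On [box M] the integrands differ by at most [D] times three times the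
   sum of the distances of [u] and [v] from the indicators, plus [2 * e]; the integrals of the
   distances are at most [e] each, and the box has area [(M *+ 2) ^+ 2]. *)
pose W := D * (6 + 2 * (M *+ 2) ^+ 2).
have W0 : 0 <= W by rewrite mulr_ge0// addr_ge0// mulr_ge0// sqr_ge0.
apply/ler_addgt0Pr => t t0.
pose e := t / (W + 1).
have W1 : 0 < W + 1 by rewrite ltr_wpDl.
have e0 : 0 < e by rewrite divr_gt0.
have We : W * e <= t.
  rewrite /e mulrA ler_pdivrMr// mulrC ler_wpM2l//; last by rewrite lerDl.
  exact: ltW.
have [u [u1 [u2 [Cu ua uA]]]] := C1_indic_approx M mA e0.
have [v [v1 [v2 [Cv vb vB]]]] := C1_indic_approx M mB e0.
have := smooth_submodularity e0 Cu Cv (fun _ _ _ _ _ _ => ua _ _ _ _ _ _ _ pA)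
  (fun _ _ _ _ _ _ => vb _ _ _ _ _ _ _ pB) adm adm'.
set d := (fun x => f1 x + g2 x) in nd dC dN *.
set d' := (fun x => f1' x + g2' x) in nd' dC' dN' *.
pose m x := v x + ramp e (u x - v x); pose m' x := u x - ramp e (u x - v x).
have cw : continuous (fun x => ramp e (u x - v x)).
  have [cr1 _] := ramp1_ramp2_continuous e0.
  exact: (C1_continuous (C1_comp cr1 (is_derive_ramp e0) (C1B Cu Cv))).
have nm : nice (fun x => m x * d x).
  apply: (nice_continuousM _ nd) => x; apply: cvgD; last exact: cw.
  exact: (C1_continuous Cv).
have nm' : nice (fun x => m' x * d' x).
  apply: (nice_continuousM _ nd') => x; apply: cvgB; last exact: cw.
  exact: (C1_continuous Cu).
rewrite (integD nm nm').
have mU := measurableU _ _ mA mB; have mI := measurableI _ _ mA mB.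
have nU := nice_indic mU nd; have nI := nice_indic mI nd'.
pose E x := \1_(box M) x * `|u x - \1_A x|; pose E' x := \1_(box M) x * `|v x - \1_B x|.
have nEu := nice_indic_dist M (C1_continuous Cu) mA.
have nEv := nice_indic_dist M (C1_continuous Cv) mB.
pose Q x := 3 * (E x + E' x) + 2 * e * \1_(box M) x.
have nQ : nice (fun x => D * Q x).
  apply/niceZ/niceD; first exact: (niceZ 3 (niceD nEu nEv)).
  exact: (niceZ _ (nice_box M)).
have iQ : integ (fun x => D * Q x) <= W * e.
  rewrite (integZ _ (niceD (niceZ 3 (niceD nEu nEv)) (niceZ (2 * e) (nice_box M)))).
  rewrite (integD (niceZ 3 (niceD nEu nEv)) (niceZ (2 * e) (nice_box M))).
  rewrite (integZ 3 (niceD nEu nEv)) (integD nEu nEv) (integZ _ (nice_box M)).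
  rewrite integ_indic; last exact: measurable_box.
  rewrite area_box//= /W -mulrA; apply: ler_wpM2l => //.
  rewrite -/E -/E'.
  have -> : (6 + 2 * (M *+ 2) ^+ 2) * e = 3 * (e + e) + 2 * e * (M *+ 2) ^+ 2 by ring.
  by rewrite lerD2r ler_pM2l// lerD.
move=> Ile; rewrite -(integD nU nI).
apply: le_trans (lerD Ile (le_trans iQ We)).
rewrite -(integD nm nm') -(integD (niceD nm nm') nQ).
apply: (le_integ (niceD nU nI) (niceD (niceD nm nm') nQ)) => x.
have [xM|xM] := leP `|x| M; last first.
  move: xM; rewrite /M !gt_max => /andP[/andP[xN xN'] _].
  rewrite (dN x xN : d x = 0) (dN' x xN' : d' x = 0).
  have i0 : 0 <= \1_(box M) x :> R by rewrite indicE.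
  rewrite !mulr0 !add0r; apply: mulr_ge0 => //; apply: addr_ge0.
    by apply: mulr_ge0 => //; apply: addr_ge0; exact: mulr_ge0.
  by apply: mulr_ge0 => //; apply: mulr_ge0 => //; exact: ltW.
have [-> ->] := indic_setU_setI A B x.
have -> : Q x = 3 * (`|u x - \1_A x| + `|v x - \1_B x|) + 2 * e.
  by rewrite /Q /E /E' indicE mem_set// !mul1r mulr1.
set al := \1_A x; set be := \1_B x; set P := `|u x - al|; set P' := `|v x - be|.
have r1 := ramp_approx e0 (u x - v x).
have r2 := max0_lip (al - be) (u x - v x).
have r3 : `|al - be - (u x - v x)| <= P + P'.
  have -> : al - be - (u x - v x) = (v x - be) - (u x - al) by ring.
  by rewrite [leRHS]addrC (le_trans (ler_normB _ _)).
set mx := Num.max (al - be) 0 in r2 *; set mx' := Num.max (u x - v x) 0 in r1 r2.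
have P0 : 0 <= P by exact: normr_ge0.
have P0' : 0 <= P' by exact: normr_ge0.
have q1 : `|be + mx - m x| <= 2 * (P + P') + e.
  have -> : be + mx - m x = - (v x - be) + ((mx - mx') - (ramp e (u x - v x) - mx')).
    by rewrite /m; ring.
  apply: le_trans (ler_normD _ _) _; rewrite normrN -/P'.
  have := ler_normB (mx - mx') (ramp e (u x - v x) - mx').
  lra.
have q2 : `|al - mx - m' x| <= 2 * (P + P') + e.
  have -> : al - mx - m' x = - (u x - al) - ((mx - mx') - (ramp e (u x - v x) - mx')).
    by rewrite /m'; ring.
  apply: le_trans (ler_normB _ _) _; rewrite normrN -/P.
  have := ler_normB (mx - mx') (ramp e (u x - v x) - mx').
  lra.
have t1 : (be + mx - m x) * d x <= (2 * (P + P') + e) * C.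
  apply: le_trans (ler_norm _) _; rewrite normrM.
  exact: (ler_pM (normr_ge0 _) (normr_ge0 _) q1 (dC x)).
have t2 : (al - mx - m' x) * d' x <= (2 * (P + P') + e) * C'.
  apply: le_trans (ler_norm _) _; rewrite normrM.
  exact: (ler_pM (normr_ge0 _) (normr_ge0 _) q2 (dC' x)).
have t3 : 0 <= (P + P' + e) * D by rewrite mulr_ge0// !addr_ge0// ltW.
rewrite /D in t3 *; lra.
Qed.

End submodularity.

(** * Existence of minimizers *)

Section energy_bound.
Context {R : realType}.
Variable lam : R.
Hypothesis lam0 : 0 < lam.
Variable Om : set (R * R).
Hypothesis mOm : measurable (Om : set (plane R)).
Implicit Types (A B : set (R * R)).

(* The energy of [A] is at most [c], tested field by field so that only real
   numbers occur. *)
Definition energy_le A (c : R) := [/\ measurable (A : set (plane R)),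
  (area (A `+` Om) < +oo)%E &
  forall f f1 f2 g g1 g2, admissible f f1 f2 g g1 g2 ->
    integ (fun x => \1_A x * (f1 x + g2 x)) + lam * fine (area (A `+` Om)) <= c].

Lemma fine_area_ge0 A : 0 <= fine (area A). Proof. exact: fine_ge0. Qed.

Lemma energy_le_ge0 A c : energy_le A c -> 0 <= c.
Proof.
move=> [_ _ Ac]; apply: (@perimeter_le_ge0 R A) => f f1 f2 g g1 g2 /Ac.
by apply: le_trans; rewrite lerDl mulr_ge0 ?fine_area_ge0// ltW.
Qed.

Lemma le_energy_le A (a b : R) : a <= b -> energy_le A a -> energy_le A b.
Proof.
move=> ab [mA Aoo Aa]; split=> // f f1 f2 g g1 g2 /Aa h; exact: le_trans h ab.
Qed.

Lemma area_le_boxes A (r : R) : measurable (A : set (plane R)) ->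
  (forall N : R, (area (box N `&` A) <= r%:E)%E) -> (area A <= r%:E)%E.
Proof.
move=> mA Ar.
pose F (n : nat) := box n%:R `&` A : set (plane R).
have mF n : measurable (F n) by exact: measurable_boxI.
have UF : \bigcup_n F n = A.
  apply/seteqP; split=> [x [n _ []]//|x Ax]; exists (Num.bound `|x|) => //.
  by split=> //; rewrite /box/=; apply/ltW/archi_boundP.
have ndF : {homo F : n m / (n <= m)%N >-> (n <= m)%O}.
  move=> n k nk; apply/subsetPset => x [xn Ax]; split=> //.
  by rewrite /box/= (le_trans xn)// ler_nat.
have mU : measurable (\bigcup_n F n) by exact: bigcupT_measurable.
have cv := @nondecreasing_cvg_mu _ _ _ (@area R) F mF mU ndF; rewrite UF in cv.
have <- := cvg_lim (@ereal_hausdorff R) cv.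
apply: lime_le; first by apply/cvg_ex; exists (area A).
by apply: nearW => n; exact: Ar.
Qed.

(** Lower semicontinuity under local convergence in measure. One test field sees only a bounded box,
    and an area is the supremum of its parts in boxes, so the inequality passes to the limit for
    each field and each box separately. *)
Lemma energy_le_closed B c : measurable (B : set (plane R)) ->
  (forall N e : R, 0 < e -> exists A, energy_le A (c + e) /\
    (area (box N `&` (A `+` B)) <= e%:E)%E) ->
  energy_le B c.
Proof.
move=> mB approx.
have mBO := measurableY mB mOm.
(* Solving the bound for the area makes its finiteness a consequence: the zero field already gives
   it. *)
have key f f1 f2 g g1 g2 : admissible f f1 f2 g g1 g2 ->
    (area (B `+` Om) <= ((c - integ (fun x => \1_B x * (f1 x + g2 x))) / lam)%:E)%E.
  move=> adm; have nd := admissible_nice adm.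
  set d := fun x => f1 x + g2 x in nd *.
  have [M [C [dC dM]]] := nd.2.
  have C0 : 0 <= C by exact: le_trans (dC 0).
  apply: area_le_boxes => // N'.
  pose N := Num.max N' M.
  apply: (@le_trans _ _ (area (box N `&` (B `+` Om)))).
    apply: le_area; [exact: measurable_boxI..|].
    by move=> x [xN xB]; split=> //; rewrite /box/= /N le_max (xN : `|x| <= N').
  have fN : area (box N `&` (B `+` Om)) \is a fin_num.
    by rewrite ge0_fin_numE// area_boxI_lty.
  rewrite -(fineK fN) lee_fin ler_pdivlMr// lerBrDl mulrC.
  apply/ler_addgt0Pr => t t0.
  (* The three terms pay for the excess energy of [A], for replacing [B] by [A] in the test
     integral, and for replacing it in the area. *)
  pose e := t / (1 + C + lam).
  have W0 : 0 < 1 + C + lam by rewrite ltr_wpDl// addr_ge0.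
  have e0 : 0 < e by rewrite divr_gt0.
  have [A [[mA Aoo Ac] AB]] := approx N e e0.
  have mS := measurableY mA mB.
  have h1 : integ (fun x => \1_B x * d x) <= integ (fun x => \1_A x * d x) + C * e.
    have nS := nice_indic_boxI N mS.
    apply: (@le_trans _ _ (integ (fun x => \1_A x * d x + C * \1_(box N `&` (A `+` B)) x))).
      apply: (le_integ (nice_indic mB nd) (niceD (nice_indic mA nd) (niceZ C nS))) => x.
      have [xN|xN] := leP `|x| N; last first.
        rewrite (dM x)//; last by move: xN; rewrite gt_max => /andP[].
        by rewrite !mulr0 add0r mulr_ge0// indicE.
      rewrite indicI/= [\1_(box N) x]indicE (mem_set (xN : box N x)) mul1r.
      have := dC x; rewrite ler_norml => /andP[d1 d2].
      rewrite setY_def !indicE in_setU !in_setD.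
      by case: (x \in A); case: (x \in B); rewrite /= ?mulr1 ?mulr0 ?mul1r ?mul0r; lra.
    rewrite (integD (nice_indic mA nd) (niceZ C nS)) (integZ C nS) lerD2l.
    by apply: ler_wpM2l => //; exact: integ_indic_boxI_le.
  have h2 : fine (area (box N `&` (B `+` Om))) <= fine (area (A `+` Om)) + e.
    have mAO := measurableY mA mOm.
    have fA : area (A `+` Om) \is a fin_num by rewrite ge0_fin_numE.
    rewrite -lee_fin EFinD fineK// fineK//.
    apply: le_trans (leeD (le_refl _) AB).
    apply: le_trans (measureU2 _ mAO (measurable_boxI N mS)).
    apply: le_area; [exact: measurable_boxI|apply: measurableU => //; exact: measurable_boxI|].
    move=> x [xN /setYP xB]; have [xA|xA] := pselect ((A `+` Om) x); first by left.
    right; suff : (A `+` B) x by split.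
    by apply/setYP => AB'; apply: xA; apply/setYP => AO; apply: xB; tauto.
  have h3 := Ac _ _ _ _ _ _ adm.
  have h4 : e * (1 + C + lam) = t by rewrite /e divfK// gt_eqF.
  have h5 := ler_wpM2l (ltW lam0) h2.
  by rewrite -/d in h3; lra.
have Boo : (area (B `+` Om) < +oo)%E.
  by apply: (le_lt_trans (key _ _ _ _ _ _ admissible0)); rewrite ltry.
split=> // f f1 f2 g g1 g2 /key.
rewrite -[X in (X <= _)%E -> _]fineK ?ge0_fin_numE// lee_fin ler_pdivlMr// => h.
lra.
Qed.

(** The symmetric differences with [Om] of the union and the intersection have the same union and
    the same intersection as those of [A] and [B], so modularity of the measure applies. *)
Lemma fine_area_modular A B : measurable (A : set (plane R)) ->
  measurable (B : set (plane R)) ->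
  (area (A `+` Om) < +oo)%E -> (area (B `+` Om) < +oo)%E ->
  [/\ (area ((A `|` B) `+` Om) < +oo)%E, (area ((A `&` B) `+` Om) < +oo)%E &
  fine (area ((A `|` B) `+` Om)) + fine (area ((A `&` B) `+` Om)) =
  fine (area (A `+` Om)) + fine (area (B `+` Om))].
Proof.
move=> mA mB.
have mX := measurableY (measurableU _ _ mA mB) mOm.
have mY := measurableY (measurableI _ _ mA mB) mOm.
have mX' := measurableY mA mOm; have mY' := measurableY mB mOm.
have UE : ((A `|` B) `+` Om) `|` ((A `&` B) `+` Om) = (A `+` Om) `|` (B `+` Om).
  rewrite !setY_def; apply/seteqP; split=> x /=;
  have [Ax|Ax] := pselect (A x); have [Bx|Bx] := pselect (B x);
  have [Ox|Ox] := pselect (Om x); tauto.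
have IE : ((A `|` B) `+` Om) `&` ((A `&` B) `+` Om) = (A `+` Om) `&` (B `+` Om).
  rewrite !setY_def; apply/seteqP; split=> x /=;
  have [Ax|Ax] := pselect (A x); have [Bx|Bx] := pselect (B x);
  have [Ox|Ox] := pselect (Om x); tauto.
have modE (S T : set (plane R)) : measurable S -> measurable T ->
    (area S + area T = area (S `|` T) + area (S `&` T))%E.
  move=> mS mT.
  have -> : S `|` T = S `|` (T `\` S).
    by apply/seteqP; split=> x /=; have [Sx|Sx] := pselect (S x); tauto.
  rewrite (measureU _ mS (measurableD mT mS)); last by rewrite setDE setICA setICr setI0.
  by rewrite -[RHS]addeA; congr (_ + _)%E; rewrite setIC; exact: measureDI.
have := modE _ _ mX mY; rewrite UE IE -(modE _ _ mX' mY').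
have a0 (S : set (plane R)) : (0 <= area S)%E by exact: measure_ge0.
move: (a0 (A `+` Om)) (a0 (B `+` Om)) (a0 ((A `|` B) `+` Om)) (a0 ((A `&` B) `+` Om)).
move: (area _) (area _) (area _) (area _) => [x| |] [y| |] [z| |] [t| |] //= _ _ _ _.
move=> [E] _ _; split; rewrite ?ltry//.
Qed.

(** Fix a field for the union, with tested energy [p + lam * x]. Submodularity turns this number
    into the energy bound [a + b - (p + lam * x)] for the intersection, and no energy bound lies
    below [m]. *)
Lemma energy_le_submodular A B (a b m : R) : energy_le A a -> energy_le B b ->
  (forall X c, energy_le X c -> m <= c) -> energy_le (A `|` B) (a + b - m).
Proof.
move=> [mA Aoo Aa] [mB Boo Bb] mle.
have mU := measurableU _ _ mA mB; have mI := measurableI _ _ mA mB.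
have [Uoo Ioo E] := fine_area_modular mA mB Aoo Boo.
move: E Aa Bb; set x := fine _; set y := fine _; set z := fine _; set t := fine _.
move=> E Aa Bb.
have pA : perimeter_le A (a - lam * z).
  by move=> f f1 f2 g g1 g2 /Aa; rewrite lerBrDr.
have pB : perimeter_le B (b - lam * t).
  by move=> f f1 f2 g g1 g2 /Bb; rewrite lerBrDr.
split; [exact: mU|exact: Uoo|move=> f f1 f2 g g1 g2 adm; rewrite -/x].
set p := integ _.
suff : energy_le (A `&` B) (a + b - (p + lam * x)) by move=> /mle; rewrite !lerBrDr addrC.
split; [exact: mI|exact: Ioo|move=> f' f1' f2' g' g1' g2' adm'; rewrite -/y].
have := submodularity mA mB pA pB adm adm'; rewrite -/p.
have := congr1 (fun z => lam * z) E; rewrite !mulrDr.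
move: (integ _) (lam * x) (lam * y) (lam * z) (lam * t) => q x' y' z' t'.
clearbody p; clear; lra.
Qed.

Lemma area_increasing_approx (A : (set (R * R))^nat) (N e : R) :
  (forall n, measurable (A n : set (plane R))) ->
  (forall n, A n `<=` A n.+1) -> 0 < e ->
  exists n, (area (box N `&` (A n `+` \bigcup_n A n)) <= e%:E)%E.
Proof.
move=> mA iA e0.
have mU : measurable (\bigcup_n A n : set (plane R)) by exact: bigcupT_measurable.
have E n : A n `+` \bigcup_n A n = \bigcup_n A n `\` A n.
  apply/seteqP; split=> x; rewrite setY_def /=; last by move=> ?; right.
  by move=> [[Ax nU]|//]; exfalso; apply: nU; exists n.
have [n nP] : exists n, (area (box N `&` (\bigcup_n A n `\` A n)) <= e%:E)%E.
  apply: (@area_vanish R (fun n => box N `&` (\bigcup_n A n `\` A n))) => //.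
  - by move=> n; apply: measurable_boxI; exact: measurableD.
  - by apply: area_boxI_lty; exact: measurableD.
  - by move=> n x [xN [Ux Ax]]; split=> //; split=> // /iA.
  - rewrite -subset0 => x h; have [_ [[i _ Ai] _]] := h 0%N I.
    by have [_ [_]] := h i I; apply.
by exists n; rewrite E.
Qed.

Lemma energy_le_bigcup (A : (set (R * R))^nat) c :
  (forall n, A n `<=` A n.+1) -> (forall n, energy_le (A n) c) ->
  energy_le (\bigcup_n A n) c.
Proof.
move=> iA Ac; have mA n : measurable (A n : set (plane R)) by case: (Ac n).
apply: energy_le_closed; first exact: bigcupT_measurable.
move=> N e e0; have [n nP] := area_increasing_approx N mA iA e0.
exists (A n); split=> //; apply: le_energy_le (Ac n).
by rewrite lerDl ltW.
Qed.

Lemma area_decreasing_approx (A : (set (R * R))^nat) (N e : R) :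
  (forall n, measurable (A n : set (plane R))) ->
  (forall n, A n.+1 `<=` A n) -> 0 < e ->
  exists k, forall n, (k <= n)%N ->
    (area (box N `&` (A n `+` \bigcap_n A n)) <= e%:E)%E.
Proof.
move=> mA dA e0.
have mI : measurable (\bigcap_n A n : set (plane R)) by exact: bigcapT_measurable.
have E n : A n `+` \bigcap_n A n = A n `\` \bigcap_n A n.
  apply/seteqP; split=> x; rewrite setY_def /=; last by move=> ?; left.
  by move=> [//|[Ix nA]]; exfalso; apply: nA; exact: Ix.
have [k kP] : exists n, (area (box N `&` (A n `\` \bigcap_n A n)) <= e%:E)%E.
  apply: (@area_vanish R (fun n => box N `&` (A n `\` \bigcap_n A n))) => //.
  - by move=> n; apply: measurable_boxI; exact: measurableD.
  - by apply: area_boxI_lty; exact: measurableD.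
  - by move=> n x [xN [/dA Ux Ax]]; split.
  - rewrite -subset0 => x h; have [_ [_]] := h 0%N I; apply => n _.
    by have [_ []] := h n I.
exists k => n kn; rewrite E; apply: le_trans kP.
have ndA : {homo A : n m / (n <= m)%N >-> (m <= n)%O}.
  by apply/nonincreasing_seqP => i; apply/subsetPset.
apply: le_area; [by apply: measurable_boxI; exact: measurableD..|].
move=> x [xN [Ax Ix]]; split=> //; split=> //.
by have /subsetPset := ndA _ _ kn; exact.
Qed.

Lemma energy_minimum : (area Om < +oo)%E ->
  exists A m, energy_le A m /\ forall X c, energy_le X c -> m <= c.
Proof.
move=> Oo.
pose E := [set c | exists A, energy_le A c].
have E0 : E !=set0.
  (* The empty set has zero perimeter and differs from [Om] by [Om] itself, whose area is finite. *)
  exists (lam * fine (area Om)), set0; split=> //.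
    by rewrite setY_def set0D setD0 set0U.
  move=> f f1 f2 g g1 g2 adm; rewrite setY_def set0D setD0 set0U.
  rewrite (_ : (fun x => _) = cst 0) ?integ_cst0 ?add0r//.
  by apply/funext => x; rewrite indic0 mul0r.
have lE : has_lbound E by exists 0 => c [A /energy_le_ge0].
pose m := inf E.
have mle X c : energy_le X c -> m <= c by move=> Xc; apply: ge_inf => //; exists X.
have near_m (e : R) : 0 < e -> exists A, energy_le A (m + e).
  move=> e0; have [c [A Ac] /ltW cm] := inf_adherent e0 (conj E0 lE).
  by exists A; exact: le_energy_le Ac.
have p0 n : 0 < (2^-1 : R) ^+ n by rewrite exprn_gt0// invr_gt0.
have [S SP] := choice (fun n => near_m _ (p0 n)).
pose U n k := \big[setU/set0]_(i < k.+1) S (n + i)%N.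
(* Adjoining the set of index [n + k] costs its excess [2^-1 ^+ (n + k)] over [m]; the right-hand
   side is [m] plus the partial geometric sum. *)
have UP n k : energy_le (U n k) (m + 2 * 2^-1 ^+ n - 2^-1 ^+ (n + k)).
  elim: k => [|k IH].
    rewrite /U big_ord_recr big_ord0/= set0U !addn0; apply: le_energy_le (SP n); lra.
  have -> : U n k.+1 = U n k `|` S (n + k.+1)%N by rewrite /U big_ord_recr.
  apply: le_energy_le (energy_le_submodular IH (SP (n + k.+1)%N) mle).
  by rewrite addnS exprS; lra.
pose V n := \bigcup_k U n k.
have VP n : energy_le (V n) (m + 2 * 2^-1 ^+ n).
  apply: energy_le_bigcup => k.
    by rewrite /U [X in _ `<=` X]big_ord_recr/=; exact: subsetUl.
  by apply: le_energy_le (UP n k); have := p0 (n + k)%N; lra.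
have VS n x : V n x <-> exists2 i, (n <= i)%N & S i x.
  split=> [[k _]|[i ni Six]].
    rewrite /U -(@bigcup_mkord _ k.+1 (fun i => S (n + i)%N)) => -[i _ Six].
    by exists (n + i)%N => //; exact: leq_addr.
  exists (i - n)%N => //; rewrite /U big_ord_recr/=; right.
  by rewrite subnKC.
have dV n : V n.+1 `<=` V n by move=> x /VS[i /ltnW ni Si]; apply/VS; exists i.
have mV n : measurable (V n : set (plane R)) by case: (VP n).
exists (\bigcap_n V n), m; split=> //.
apply: energy_le_closed; first exact: bigcapT_measurable.
move=> N e e0; have [k kP] := area_decreasing_approx N mV dV e0.
have [j je] : exists j, 2 * (2^-1 : R) ^+ j <= e.
  have cv : (2^-1 : R) ^+ n @[n --> \oo] --> 0.
    by apply: cvg_expr; rewrite ger0_norm ?invr_ge0// invf_lt1// ltr1n.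
  have e20 : 0 < e / 2 by rewrite divr_gt0.
  have /cvgr_lt - /(_ _ e20)[j _ /(_ j (leqnn j)) jP] := cv.
  by exists j; move: jP; lra.
exists (V (maxn k j)); split; last by apply: kP; exact: leq_maxl.
apply: le_energy_le (VP _); rewrite lerD2l (le_trans _ je)// ler_pM2l//.
by apply: ler_wiXn2l; rewrite ?invr_ge0 ?leq_maxr// invf_le1// ler1n.
Qed.

End energy_bound.

(** * Comparison with balls *)

Section ball_cutoff.
Context {R : realType}.

Lemma is_derive_posp_sqr (t : R) :
  is_derive t (1 : R) (fun x => posp x ^+ 2) (2 * posp t).
Proof.
(* The function is viewed as one of the first coordinate in the plane, where a quadratic remainder
   yields the differential; a slice returns to one variable. *)
pose u (x : R * R) := posp x.1 ^+ 2.
have cp : continuous (fun x : R * R => 2 * posp x.1).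
  move=> x; apply: cvgM; first exact: cvg_cst.
  apply: (@continuous_comp _ _ _ (fst : R * R -> R) (@posp R)); first exact: cvg_fst.
  by apply: continuous_max; [exact: cvg_id|exact: cvg_cst].
have Cu : C1 u (fun x => 2 * posp x.1) (cst 0).
  split; [exact: cp|exact: cst_continuous|move=> x].
  apply: (quadratic_remainder_is_diff (c := 1)) => h _.
  rewrite /u /= mulr0 addr0 mulrC mul1r.
  apply: le_trans (posp_sqr_taylor _ _) _.
  rewrite -(real_normK (num_real h.1)) ler_sqr ?nnegrE//.
  by rewrite prod_normE le_max lexx.
by have [] := C1_slices t 0 Cu.
Qed.

Lemma is_derive_inv (f : R -> R) (t d : R) : f t != 0 ->
  is_derive t (1 : R) f d ->
  is_derive t (1 : R) (fun x => (f x)^-1) (- (f t) ^- 2 * d).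
Proof.
move=> f0 [df <-]; split; first exact: derivableV.
by rewrite deriveV.
Qed.

Variables (al be : R).
Hypothesis albe : al < be.

Let w (s : R) := posp (be - s).
Let v (s : R) := posp (s - al).

Let D_gt0 s : 0 < w s ^+ 2 + v s ^+ 2.
Proof.
have [sa|sa] := leP s al.
  apply: ltr_pwDl; last exact: sqr_ge0.
  by rewrite exprn_gt0// /w /posp lt_max subr_gt0 (le_lt_trans sa).
apply: ltr_wpDl; first exact: sqr_ge0.
by rewrite exprn_gt0// /v /posp lt_max subr_gt0 sa.
Qed.

(** A C1 transition from 1 up to [al] to 0 from [be] on. The two squares never vanish together
    because [al < be]. It is nonincreasing, and the calibration depends on this sign. *)
Definition cutoff (s : R) := w s ^+ 2 / (w s ^+ 2 + v s ^+ 2).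
Definition cutoff1 (s : R) :=
  - (2 * w s * v s * (w s + v s)) / ((w s ^+ 2 + v s ^+ 2) * (w s ^+ 2 + v s ^+ 2)).

Lemma cutoff_ge0_le1 s : 0 <= cutoff s <= 1.
Proof.
rewrite /cutoff; have D0 := D_gt0 s; apply/andP; split.
  by rewrite divr_ge0 ?sqr_ge0// ltW.
by rewrite ler_pdivrMr// mul1r lerDl sqr_ge0.
Qed.

Lemma cutoff_eq1 s : s <= al -> cutoff s = 1.
Proof.
move=> sa; have D0 := D_gt0 s.
have v0 : v s = 0 by apply/max_idPr; rewrite subr_le0.
by move: D0; rewrite /cutoff v0 expr0n addr0 => D0; rewrite divff// gt_eqF.
Qed.

Lemma cutoff_eq0 s : be <= s -> cutoff s = 0.
Proof.
move=> sb; have w0 : w s = 0 by apply/max_idPr; rewrite subr_le0.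
by rewrite /cutoff w0 expr0n mul0r.
Qed.

Lemma cutoff1_le0 s : cutoff1 s <= 0.
Proof.
have w0 : 0 <= w s := posp_ge0 _; have v0 : 0 <= v s := posp_ge0 _.
rewrite /cutoff1 mulNr oppr_le0 divr_ge0//; last by rewrite mulr_ge0// ltW.
by rewrite mulr_ge0 ?addr_ge0// mulr_ge0// mulr_ge0.
Qed.

Lemma cutoff1_eq0 s : s <= al -> cutoff1 s = 0.
Proof.
move=> sa; have v0 : v s = 0 by apply/max_idPr; rewrite subr_le0.
by rewrite /cutoff1 v0 mulr0 mul0r oppr0 mul0r.
Qed.

Lemma is_derive_cutoff s : is_derive s (1 : R) cutoff (cutoff1 s).
Proof.
have hw : is_derive s (1 : R) (fun x => w x ^+ 2) (- (2 * w s)).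
  have h1 := is_derive_posp_sqr (be - s).
  have h2 : is_derive s (1 : R) (fun x : R => be - x) (-1).
    by apply: (is_derive_eq (is_deriveB (is_derive_cst be s 1) (is_derive_id s 1))); rewrite sub0r.
  by apply: (is_derive_eq (@is_derive1_comp _ _ (fun x : R => be - x) s _ _ h1 h2)); rewrite mulrN1.
have hv : is_derive s (1 : R) (fun x => v x ^+ 2) (2 * v s).
  have h1 := is_derive_posp_sqr (s - al).
  have h2 : is_derive s (1 : R) (fun x : R => x - al) 1.
    by apply: (is_derive_eq (is_deriveB (is_derive_id s 1) (is_derive_cst al s 1))); rewrite subr0.
  by apply: (is_derive_eq (@is_derive1_comp _ _ (fun x : R => x - al) s _ _ h1 h2)); rewrite mulr1.
have D0 := D_gt0 s.
have Dn0 : w s ^+ 2 + v s ^+ 2 != 0 by rewrite gt_eqF.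
have hD : is_derive s (1 : R) (fun x => w x ^+ 2 + v x ^+ 2) (- (2 * w s) + 2 * v s).
  exact: is_deriveD hw hv.
have hV := @is_derive_inv (fun x => w x ^+ 2 + v x ^+ 2) s _ Dn0 hD.
have hM := is_deriveM hw hV.
apply: (is_derive_eq hM); rewrite /cutoff1 /GRing.scale/=.
by move: Dn0; move: (w s) (v s) => a b ab0; field.
Qed.

Lemma cutoff1_continuous : continuous cutoff1.
Proof.
have cp : continuous (@posp R).
  by move=> x; apply: continuous_max; [exact: cvg_id|exact: cvg_cst].
have cw : continuous w.
  move=> s; apply: (@continuous_comp _ _ _ (fun s => be - s) (@posp R)); last exact: cp.
  by apply: cvgB; [exact: cvg_cst|exact: cvg_id].
have cv : continuous v.
  move=> s; apply: (@continuous_comp _ _ _ (fun s => s - al) (@posp R)); last exact: cp.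
  by apply: cvgB; [exact: cvg_id|exact: cvg_cst].
have cX (f : R -> R) : continuous f -> continuous (fun x => f x ^+ 2).
  move=> cf x; apply: (@continuous_comp _ _ _ f (fun t => t ^+ 2)); first exact: cf.
  exact: exprn_continuous.
have cD : continuous (fun s => w s ^+ 2 + v s ^+ 2).
  by move=> s; apply: cvgD; exact: cX.
move=> s; apply: cvgM.
  apply: cvgN; apply: cvgM; last by apply: cvgD; [exact: cw|exact: cv].
  apply: cvgM; last exact: cv.
  by apply: cvgM; [exact: cvg_cst|exact: cw].
apply: cvgV; first by rewrite mulf_neq0// gt_eqF.
by apply: cvgM; exact: cD.
Qed.

End ball_cutoff.

Section ball_calibration.
Context {R : realType}.
Variables (x0 : R * R) (r : R).
Hypothesis r0 : 0 < r.
Implicit Types (A : set (R * R)).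

(** The squared distance is a polynomial, hence C1 at the center too; cutoffs are taken as functions
    of it. *)
Let rad (x : R * R) := (x.1 - x0.1) ^+ 2 + (x.2 - x0.2) ^+ 2.

Lemma euclid_ballE (cl : bool) x :
  euclid_ball cl x0 r x = (rad x < r ^+ 2 ?<= if cl).
Proof.
rewrite /euclid_ball /euclid_norm /= -/(rad x).
have s0 : 0 <= rad x by rewrite addr_ge0// sqr_ge0.
have E : Num.sqrt (rad x) ^+ 2 = rad x by rewrite sqr_sqrtr.
by case: cl => /=; rewrite -{2}E ?ler_sqr ?ltr_sqr// nnegrE ?sqrtr_ge0// ltW.
Qed.

Lemma C1_rad : C1 rad (fun x => 2 * (x.1 - x0.1)) (fun x => 2 * (x.2 - x0.2)).
Proof.
have Ca := C1B (@C1_fst R) (C1_cst x0.1).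
have Cb := C1B (@C1_snd R) (C1_cst x0.2).
have C := C1D (C1M Ca Ca) (C1M Cb Cb).
by apply: (C1_eq C) => x /=; ring.
Qed.

Lemma rad_continuous : continuous rad. Proof. exact: C1_continuous C1_rad. Qed.

Lemma open_euclid_ball : open (euclid_ball false x0 r).
Proof.
have -> : euclid_ball false x0 r = rad @^-1` [set t | t < r ^+ 2].
  by apply/seteqP; split=> x; rewrite euclid_ballE.
by apply: open_comp; [move=> ? _; exact: rad_continuous|exact: open_lt].
Qed.

Lemma measurable_euclid_ball : measurable (euclid_ball false x0 r : set (plane R)).
Proof. exact: open_measurable_plane open_euclid_ball. Qed.

Lemma rad_large (x : R * R) : r + `|x0| < `|x| -> r ^+ 2 <= rad x.
Proof.
move=> xr; have : r < `|x - x0|.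
  have := ler_normD (x - x0) x0; rewrite subrK; lra.
rewrite prod_normE lt_max /= /rad => h.
have sq (t : R) : r < `|t| -> r ^+ 2 <= t ^+ 2.
  by move=> rt; rewrite -(real_normK (num_real t)) ler_sqr ?nnegrE// ltW.
by case/orP: h => /sq; have := sqr_ge0 (x.1 - x0.1); have := sqr_ge0 (x.2 - x0.2); lra.
Qed.

(** At distance at least [k * r] from the center, the calibration has radial component at least [k];
    that of [k] times the field is at most [k] by Cauchy-Schwarz. The proof compares squares. *)
Lemma radial_flux (k s a b f g : R) : 0 <= k -> s = a ^+ 2 + b ^+ 2 ->
  k ^+ 2 * r ^+ 2 <= s -> f ^+ 2 + g ^+ 2 <= 1 ->
  0 <= a * (a / r - k * f) + b * (b / r - k * g).
Proof.
move=> k0 sE ks fg.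
have s0 : 0 <= s by rewrite sE addr_ge0// sqr_ge0.
have -> : a * (a / r - k * f) + b * (b / r - k * g) = s / r - k * (a * f + b * g).
  by rewrite sE; ring.
rewrite subr_ge0.
have cs : (a * f + b * g) ^+ 2 <= s.
  have e : s * (f ^+ 2 + g ^+ 2) = (a * f + b * g) ^+ 2 + (a * g - b * f) ^+ 2.
    by rewrite sE; ring.
  have := ler_wpM2l s0 fg; rewrite mulr1 e; have := sqr_ge0 (a * g - b * f); lra.
apply: le_trans (ler_norm _) _.
rewrite -ler_sqr ?nnegrE ?divr_ge0 ?(ltW r0)// real_normK ?num_real//.
rewrite exprMn exprMn exprVn ler_pdivlMr ?exprn_gt0//.
have h1 := ler_wpM2l (sqr_ge0 k) cs.
have h2 := ler_wpM2r (sqr_ge0 r) h1.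
apply: le_trans h2 _; rewrite -mulrA [s * _]mulrC mulrA expr2.
exact: ler_wpM2r.
Qed.

(** [A] is tested with [G = k F + X], where [X = phi Y], [Y = (x - x0) / r - k F], and [phi] cuts
    off between the radii [k * r] and [r]. Since the divergence of [X] has integral 0, its part on
    [A] is minus its part on the complement. There it equals [phi (2 / r - k div F)] plus the
    product of the gradient of [phi] with [Y], which is nonpositive by [radial_flux]. *)
Lemma calibrated_field (k : R) A (p : R) f f1 f2 g g1 g2 : 0 < k < 1 ->
  measurable (A : set (plane R)) -> perimeter_le A p ->
  admissible f f1 f2 g g1 g2 ->
  let B := euclid_ball false x0 r in
  exists phi : R * R -> R, [/\ mfun phi,
    forall x, 0 <= phi x <= 1, forall x, rad x <= k ^+ 2 * r ^+ 2 -> phi x = 1,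
    forall x, r ^+ 2 <= rad x -> phi x = 0 &
    k * integ (fun x => (\1_A x + \1_(~` A) x * phi x) * (f1 x + g2 x)) <=
    p + 2 / r * integ (fun x => \1_(~` A) x * phi x)].
Proof.
move=> /andP[k0 k1] mA pA adm B.
have albe : k ^+ 2 * r ^+ 2 < r ^+ 2.
  rewrite -[ltRHS]mul1r ltr_pM2r ?exprn_gt0// -[ltRHS](expr1n _ 2).
  by rewrite ltr_sqr ?nnegrE// ltW.
have Cphi := C1_comp (cutoff1_continuous albe) (is_derive_cutoff albe) C1_rad.
have c01 x : 0 <= cutoff (k ^+ 2 * r ^+ 2) (r ^+ 2) (rad x) <= 1 by exact: cutoff_ge0_le1.
have cE1 x : rad x <= k ^+ 2 * r ^+ 2 -> cutoff (k ^+ 2 * r ^+ 2) (r ^+ 2) (rad x) = 1.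
  exact: cutoff_eq1.
have cE0 x : r ^+ 2 <= rad x -> cutoff (k ^+ 2 * r ^+ 2) (r ^+ 2) (rad x) = 0.
  by exact: cutoff_eq0.
have d0 s := @cutoff1_le0 R _ _ albe s.
have dE0 s : s <= k ^+ 2 * r ^+ 2 -> cutoff1 (k ^+ 2 * r ^+ 2) (r ^+ 2) s = 0.
  exact: cutoff1_eq0.
move: Cphi c01 cE1 cE0 d0 dE0.
move: (cutoff _ _) (cutoff1 _ _) => P P' Cphi c01 cE1 cE0 d0 dE0.
exists (fun x => P (rad x)).
have mphi := continuous_mfun (C1_continuous Cphi).
split=> //.
case: (adm) => Cf Cg [N fgN] fg1.
have CY1 := C1B (C1Z r^-1 (C1B (@C1_fst R) (C1_cst x0.1))) (C1Z k Cf).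
have CY2 := C1B (C1Z r^-1 (C1B (@C1_snd R) (C1_cst x0.2))) (C1Z k Cg).
have CX1 := C1M Cphi CY1; have CX2 := C1M Cphi CY2.
have sX (Y : R * R -> R) (x : R * R) : r + `|x0| < `|x| -> P (rad x) * Y x = 0.
  by move=> /rad_large/cE0 ->; rewrite mul0r.
have [I1 _] := integ_partials CX1 (sX _); have [n1 _] := C1_nice_partials CX1 (sX _).
have [_ I2] := integ_partials CX2 (sX _); have [_ n2] := C1_nice_partials CX2 (sX _).
have sG : exists M : R, forall x : R * R, M < `|x| ->
    k * f x + P (rad x) * (r^-1 * (x.1 - x0.1) - k * f x) = 0 /\
    k * g x + P (rad x) * (r^-1 * (x.2 - x0.2) - k * g x) = 0.
  exists (Num.max N (r + `|x0|)) => x; rewrite gt_max => /andP[xN /rad_large/cE0 ->].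
  by have [-> ->] := fgN x xN; rewrite !mul0r mulr0 addr0.
have nG x : (k * f x + P (rad x) * (r^-1 * (x.1 - x0.1) - k * f x)) ^+ 2 +
    (k * g x + P (rad x) * (r^-1 * (x.2 - x0.2) - k * g x)) ^+ 2 <= 1.
  have kfg : (k * f x) ^+ 2 + (k * g x) ^+ 2 <= 1.
    rewrite !exprMn -mulrDr -[leRHS]mulr1 ler_pM ?sqr_ge0 ?addr_ge0 ?sqr_ge0//.
    by rewrite expr_le1// ltW.
  (* Inside the ball [G] is a convex combination of [k F] and the calibration, both of length at
     most 1; outside it is [k F]. *)
  have [xr|/cE0 ->] := ltP (rad x) (r ^+ 2); last by rewrite !mul0r !addr0.
  apply: convex_comb_norm => //.
  rewrite !exprMn -mulrDr exprVn mulrC ler_pdivrMr ?exprn_gt0// mul1r.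
  exact: ltW.
have admG : admissible _ _ _ _ _ _ :=
  And4 (C1D (C1Z k Cf) CX1) (C1D (C1Z k Cg) CX2) sG nG.
have := pA _ _ _ _ _ _ admG.
have nd := admissible_nice adm.
have nG' := admissible_nice admG.
have mC := measurableC mA.
have nP : nice (fun x => P (rad x)).
  by apply: (continuous_nice (C1_continuous Cphi)) => x /rad_large/cE0.
have nCP := nice_indic mC nP.
have nAd : nice (fun x => (\1_A x + \1_(~` A) x * P (rad x)) * (f1 x + g2 x)).
  have h := niceD (nice_indic mA nd) (nice_indic mC (nice_continuousM (C1_continuous Cphi) nd)).
  rewrite (_ : (fun x => _) = (fun x => \1_A x * (f1 x + g2 x) +
    \1_(~` A) x * (P (rad x) * (f1 x + g2 x)))); first exact: h.
  by apply/funext => x; ring.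
have IX := integD n1 n2; rewrite I1 I2 addr0 in IX.
have nX := niceD n1 n2.
move=> pG; rewrite -(integZ k nAd) -(integZ (2 / r) nCP) -lerBlDr.
rewrite -(integB (niceZ k nAd) (niceZ (2 / r) nCP)).
(* Subtracting the zero integral of the divergence of [X] leaves a pointwise inequality between
   integrands. *)
have := integB (nice_indic mA nG') nX; rewrite IX subr0 => eqn.
move: eqn pG; cbv beta; move=> <- pG; apply: le_trans pG.
apply: (le_integ (niceB (niceZ k nAd) (niceZ (2 / r) nCP)) (niceB (nice_indic mA nG') nX)) => x.
have flux : P' (rad x) * ((x.1 - x0.1) * ((x.1 - x0.1) / r - k * f x) +
    (x.2 - x0.2) * ((x.2 - x0.2) / r - k * g x)) <= 0.
  have [xk|xk] := leP (rad x) (k ^+ 2 * r ^+ 2); first by rewrite dE0// mul0r.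
  apply: mulr_le0_ge0; first exact: d0.
  exact: (@radial_flux k (rad x) _ _ _ _ (ltW k0) erefl (ltW xk) (fg1 x)).
rewrite !indicE in_setC; case: (x \in A); rewrite /= ?mul0r ?mul1r ?addr0 ?add0r.
  by rewrite mulr0; lra.
lra.
Qed.

End ball_calibration.

Section ball_comparison.
Context {R : realType}.
Implicit Types (A Om : set (R * R)).

(** The annuli decrease to the empty set as [k] tends to 1, because the ball is open. The bound [K]
    lets [k] be as close to 1 as desired at the same time. *)
Lemma annulus_small (x0 : R * R) (r e : R) (K : R) : 0 < r -> 0 < e -> K < 1 ->
  exists k, [/\ 0 < k < 1, K <= k &
  (area (euclid_ball false x0 r `\`
     [set x | (x.1 - x0.1) ^+ 2 + (x.2 - x0.2) ^+ 2 <= k ^+ 2 * r ^+ 2]%R) <= e%:E)%E].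
Proof.
move=> r0 e0 K1.
pose B := euclid_ball false x0 r.
pose rad (x : R * R) := (x.1 - x0.1) ^+ 2 + (x.2 - x0.2) ^+ 2.
(* The offset 2 keeps [kk n] strictly between 0 and 1; shifting the index by [j] makes it at least
   [K]. *)
pose kk (n : nat) : R := 1 - n.+2%:R^-1.
pose j := Num.bound (1 - K)^-1.
have inv0 n : 0 < n.+2%:R^-1 :> R by rewrite invr_gt0.
have inv1 n : n.+2%:R^-1 < 1 :> R by rewrite invf_lt1// ltr1n.
have kk0 n : 0 < kk n by rewrite subr_gt0.
have kk1 n : kk n < 1 by rewrite ltrBlDr ltrDl.
have kkS n m : (n <= m)%N -> kk n <= kk m.
  by move=> nm; rewrite lerD2l lerN2 lef_pV2 ?posrE// ler_nat.
have mrad t : measurable ([set x | rad x <= t] : set (plane R)).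
  have mr := continuous_mfun (@rad_continuous R x0).
  have -> : [set x | rad x <= t] = rad @^-1` `]-oo, t].
    by apply/seteqP; split=> x /=; rewrite in_itv/=.
  by rewrite -[X in measurable X]setTI; apply: mr => //; exact: measurable_itv.
have mB : measurable (B : set (plane R)) by exact: measurable_euclid_ball.
pose F n : set (plane R) := B `\` [set x | rad x <= kk (n + j)%N ^+ 2 * r ^+ 2].
have mF n : measurable (F n) by apply: measurableD.
have [n nF] : exists n, (area (F n) <= e%:E)%E.
  apply: area_vanish => //.
  - apply: (@le_lt_trans _ _ (area (box (r + `|x0|) `&` B))); last exact: area_boxI_lty.
    apply: le_area => //; first exact: measurable_boxI.
    move=> x [Bx _]; split=> //; rewrite /box/= leNgt; apply/negP => /(rad_large r0).
    by move: Bx; rewrite /B (euclid_ballE x0 r0)/= => /lt_le_trans h /h; rewrite ltxx.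
  - move=> n x [Bx xk]; split=> // xk'; apply: xk => /=.
    apply: le_trans xk' _; apply: ler_wpM2r; first exact: sqr_ge0.
    by rewrite ler_sqr ?nnegrE ?(ltW (kk0 _))// kkS// addSn.
  - rewrite -subset0 => x h.
    have [Bx _] := h 0%N I.
    move: Bx; rewrite /B (euclid_ballE x0 r0)/= -/(rad x) => xr.
    (* [rad x] is [(1 - th) * r ^+ 2], and [(1 - t) ^+ 2 >= 1 - 2 * t], so [x] has left the annulus
       once [2 * t <= th]. *)
    pose th := (r ^+ 2 - rad x) / r ^+ 2.
    have r20 : 0 < r ^+ 2 by rewrite exprn_gt0.
    have th0 : 0 < th by rewrite divr_gt0// subr_gt0.
    pose n := Num.bound (2 / th).
    have nth : 2 / th < n%:R by apply: archi_boundP; rewrite divr_ge0// ltW.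
    have [_] := h n I; apply => /=; rewrite -/(rad x).
    have i0 := inv0 (n + j)%N.
    have le2 : 2 * (n + j).+2%:R^-1 <= th.
      rewrite ler_pdivrMr// mulrC -ler_pdivrMr//.
      by rewrite (le_trans (ltW nth))// ler_nat -addnS -addnS leq_addr.
    have -> : rad x = (1 - th) * r ^+ 2 by rewrite /th; field; rewrite gt_eqF.
    apply: ler_wpM2r; first exact: ltW.
    rewrite /kk; move: le2 i0; move: ((n + j).+2%:R^-1) => t le2 i0.
    rewrite sqrrB expr1n mul1r; have := sqr_ge0 t; lra.
exists (kk (n + j)%N); split; [by rewrite kk0 kk1| |exact: nF].
have jK : (1 - K)^-1 < j%:R by apply: archi_boundP; rewrite invr_ge0 subr_ge0 ltW.
have K0 : 0 < 1 - K by rewrite subr_gt0.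
rewrite /kk lerBrDr -lerBrDl.
rewrite -[X in _ <= X]invrK lef_pV2 ?posrE ?invr_gt0//.
by rewrite (le_trans (ltW jK))// ler_nat (leq_trans (leq_addl n j))// !leqW.
Qed.

(** The limit of [calibrated_field] as [k] tends to 1. Of the error [t], one half pays for the
    annulus where [phi] may differ from the indicator of the ball, the other for the factor [k] in
    front of the test integral. *)
Lemma perimeter_le_setU_ball (x0 : R * R) (r : R) A (p : R)
    f f1 f2 g g1 g2 : 0 < r ->
  measurable (A : set (plane R)) -> perimeter_le A p ->
  admissible f f1 f2 g g1 g2 ->
  integ (fun x => \1_(A `|` euclid_ball false x0 r) x * (f1 x + g2 x)) <=
  p + 2 / r * fine (area (euclid_ball false x0 r `\` A)).
Proof.
move=> r0 mA pA adm; set B := euclid_ball false x0 r.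
have mB : measurable (B : set (plane R)) by exact: measurable_euclid_ball.
have nd := admissible_nice adm.
have [N [C [dC dN]]] := nd.2.
have C0 : 0 <= C by exact: le_trans (dC 0).
have mBA := measurableD mB mA.
have Bbox : B `<=` box (r + `|x0|).
  move=> x; rewrite /B (euclid_ballE x0 r0)/= => xr; rewrite /box/= leNgt.
  by apply/negP => /(rad_large r0) /(lt_le_trans xr); rewrite ltxx.
have Boo S : S `<=` B -> measurable (S : set (plane R)) -> (area S < +oo)%E.
  move=> SB mS; apply: le_lt_trans (area_boxI_lty (r + `|x0|) mS).
  apply: le_area => //; first exact: measurable_boxI.
  by move=> x Sx; split=> //; exact/Bbox/SB.
set I := integ _; set q := p + _.
apply/ler_addgt0Pr => t t0.
have W0 : 0 < C + 1 by rewrite ltr_wpDl.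
have V0 : 0 < `|I| + 1 by rewrite ltr_wpDl.
have ea : 0 < t / 2 / (C + 1) by rewrite !divr_gt0.
have ka : 1 - t / 2 / (`|I| + 1) < 1 by rewrite ltrBlDr ltrDl !divr_gt0.
have [k [k01 Kk ann]] := annulus_small x0 r0 ea ka.
have [k0 k1] := andP k01.
have [phi [mphi phi01 phi1 phi0 kphi]] := @calibrated_field R x0 r r0 k A p _ _ _ _ _ _ k01 mA pA adm.
pose S := B `\` [set x : R * R | (x.1 - x0.1) ^+ 2 + (x.2 - x0.2) ^+ 2 <= k ^+ 2 * r ^+ 2].
have mS : measurable (S : set (plane R)).
  apply: measurableD => //.
  have mr := continuous_mfun (@rad_continuous R x0).
  rewrite (_ : [set x | _] = (fun x : R * R => (x.1 - x0.1) ^+ 2 + (x.2 - x0.2) ^+ 2) @^-1` `]-oo, k ^+ 2 * r ^+ 2]); last first.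
    by apply/seteqP; split=> x /=; rewrite in_itv/=.
  by rewrite -[X in measurable X]setTI; apply: mr => //; exact: measurable_itv.
have nind T : measurable (T : set (plane R)) -> T `<=` B -> nice (\1_T : R * R -> R).
  move=> mT TB; rewrite -(setIidr (subset_trans TB Bbox)); exact: nice_indic_boxI.
have Bphi x : ~ B x -> phi x = 0.
  move=> nB; apply: phi0; rewrite leNgt; apply/negP => xr; apply: nB.
  by rewrite /B (euclid_ballE x0 r0).
have Sphi x : B x -> ~ S x -> phi x = 1.
  by move=> Bx nS; apply: phi1; rewrite leNgt; apply/negP => xr; apply: nS; split=> //=; apply/negP; rewrite -ltNge.
have nphi : nice phi.
  split=> //; exists (r + `|x0|), 1; split=> x.
    by have /andP[? ?] := phi01 x; rewrite ger0_norm.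
  by move=> /(rad_large r0); exact: phi0.
have mC := measurableC mA.
have nCphi := nice_indic mC nphi.
have nJ : nice (fun x => (\1_A x + \1_(~` A) x * phi x) * (f1 x + g2 x)).
  have phib x : `|phi x| <= 1 by have /andP[? ?] := phi01 x; rewrite ger0_norm.
  have h := niceD (nice_indic mA nd) (nice_indic mC (niceMb mphi phib nd)).
  rewrite (_ : (fun x => _) = (fun x => \1_A x * (f1 x + g2 x) +
    \1_(~` A) x * (phi x * (f1 x + g2 x)))); first exact: h.
  by apply/funext => x; ring.
have e1 : integ (fun x => \1_(~` A) x * phi x) <= fine (area (B `\` A)).
  rewrite -(integ_indic mBA); apply: (le_integ nCphi (nind _ mBA (@subDsetl _ B A))) => x.
  rewrite !indicE in_setD in_setC.
  have [/set_mem Bx|Bx] := boolP (x \in B).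
    by have /andP[_ h] := phi01 x; case: (x \in A); rewrite /= ?mul0r ?mul1r.
  by rewrite Bphi ?mulr0//; move/negP: Bx => nB Bx; apply: nB; exact: mem_set.
have nU := nice_indic (measurableU _ _ mA mB) nd.
have e2 : I <= integ (fun x => (\1_A x + \1_(~` A) x * phi x) * (f1 x + g2 x)) +
    C * fine (area S).
  have nS := niceZ C (nind _ mS (@subDsetl _ B _)).
  rewrite -(integ_indic mS) -(integZ C (nind _ mS (@subDsetl _ B _))) -(integD nJ nS).
  apply: (le_integ nU (niceD nJ nS)) => x.
  have := dC x; rewrite ler_norml => /andP[d1 d2].
  have := phi01 x => /andP[p0 p1].
  rewrite !indicE in_setU in_setC.
  case: (x \in A); rewrite /= ?mul0r ?addr0 ?add0r ?mul1r.
    by rewrite lerDl mulr_ge0.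
  have [/set_mem Bx|Bx] := boolP (x \in B); last first.
    rewrite mul0r Bphi ?mul0r ?add0r ?mulr_ge0//.
    by move/negP: Bx => nB Bx; apply: nB; exact: mem_set.
  have [_|Sx] := boolP (x \in S); last first.
    rewrite (Sphi x Bx); first by rewrite mulr0 addr0.
    by move/negP: Sx => nS' Sx; apply: nS'; exact: mem_set.
  rewrite mul1r mulr1.
  have h1 := ler_wpM2l (_ : 0 <= 1 - phi x) d2; rewrite subr_ge0 in h1.
  have h2 : phi x * C >= 0 by exact: mulr_ge0.
  by have := h1 p1; lra.
have annS : C * fine (area S) <= t / 2.
  have fS : fine (area S) <= t / 2 / (C + 1).
    by rewrite -lee_fin fineK// ge0_fin_numE//; apply: Boo => //; exact: subDsetl.
  apply: le_trans (ler_wpM2l C0 fS) _.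
  rewrite mulrA ler_pdivrMr// mulrC ler_wpM2l ?divr_ge0 ?lerDl//; exact: ltW.
have kI : (1 - k) * I <= t / 2.
  have h : 1 - k <= t / 2 / (`|I| + 1) by lra.
  have k1' : 0 <= 1 - k by lra.
  apply: le_trans (ler_wpM2l k1' (ler_norm I)) _.
  apply: le_trans (ler_wpM2r (normr_ge0 I) h) _.
  rewrite mulrAC (ler_pdivrMr _ _ V0); apply: ler_wpM2l; last by rewrite lerDl.
  by rewrite divr_ge0 ?ltW.
have e3 := ler_wpM2l (_ : 0 <= 2 / r) e1.
have e3' : 0 <= 2 / r by rewrite divr_ge0// ltW.
have {e3' }e3 := e3 e3'.
have e4 := ler_wpM2l (ltW k0) e2; rewrite mulrDr in e4.
have e5 : k * (C * fine (area S)) <= C * fine (area S).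
  rewrite -[leRHS]mul1r; apply: ler_wpM2r (ltW k1).
  by rewrite mulr_ge0 ?fine_area_ge0.
move: kphi e3 e4 e5 annS kI; rewrite /q.
move: (integ _) (integ _) (fine _) (fine _) => ? ? ? ?.
lra.
Qed.

(** Up to a null set, the part of the ball outside [A] lies in the symmetric difference of [A] and
    [Om], and adding the ball removes it from there. The fidelity term thus drops by [lam] times its
    area, which covers the increase of the perimeter. Inclusion in [Om] is only up to a null set
    because [Om] will be a Borel version of the given set. *)
Lemma energy_le_setU_ball (lam : R) Om A (c : R) (x0 : R * R) : 0 < lam ->
  measurable (Om : set (plane R)) ->
  area (euclid_ball false x0 (2 / lam) `\` Om) = 0%E ->
  energy_le lam Om A c -> energy_le lam Om (A `|` euclid_ball false x0 (2 / lam)) c.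
Proof.
move=> lam0 mOm BO [mA Aoo Ac].
have r0 : 0 < 2 / lam by rewrite divr_gt0.
set B := euclid_ball false x0 (2 / lam) in BO *.
have mB : measurable (B : set (plane R)) by exact: measurable_euclid_ball.
have mU := measurableU _ _ mA mB.
have mBA := measurableD mB mA; have mBO := measurableD mB mOm.
have mS := measurableY mA mOm.
have mSD := measurableD mS mBA; have mSI := measurableI _ _ mS mBA.
have h1 : (area ((A `|` B) `+` Om) <= area ((A `+` Om) `\` (B `\` A)))%E.
  rewrite -[leRHS]adde0 -BO; apply: le_trans (measureU2 _ mSD mBO).
  apply: le_area; [exact: measurableY|exact: measurableU|].
  move=> x; rewrite !setY_def /=.
  have [Ax|Ax] := pselect (A x); have [Bx|Bx] := pselect (B x);
  have [Ox|Ox] := pselect (Om x); tauto.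
have h2 : (area (B `\` A) <= area ((A `+` Om) `&` (B `\` A)))%E.
  rewrite -[leRHS]adde0 -BO; apply: le_trans (measureU2 _ mSI mBO).
  apply: le_area; [exact: mBA|exact: measurableU|].
  move=> x; rewrite !setY_def /=.
  have [Ax|Ax] := pselect (A x); have [Bx|Bx] := pselect (B x);
  have [Ox|Ox] := pselect (Om x); tauto.
have h3 : (area ((A `|` B) `+` Om) + area (B `\` A) <= area (A `+` Om))%E.
  have -> : area (A `+` Om) = (area ((A `+` Om) `\` (B `\` A)) + area ((A `+` Om) `&` (B `\` A)))%E.
    exact: measureDI.
  exact: leeD.
have a0 (S : set (plane R)) : (0 <= area S)%E by exact: measure_ge0.
have [Uoo h4] : (area ((A `|` B) `+` Om) < +oo)%E /\
    fine (area ((A `|` B) `+` Om)) + fine (area (B `\` A)) <= fine (area (A `+` Om)).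
  move: h3 Aoo (a0 ((A `|` B) `+` Om)) (a0 (B `\` A)) (a0 (A `+` Om)).
  move: (area _) (area _) (area _) => [x| |] [y| |] [z| |]//= h _ _ _ _.
  by rewrite ltry.
split=> // f f1 f2 g g1 g2 adm.
have pA : perimeter_le A (c - lam * fine (area (A `+` Om))).
  by move=> f' f1' f2' g' g1' g2' /Ac; rewrite lerBrDr.
have := perimeter_le_setU_ball x0 r0 mA pA adm; rewrite -/B invf_div (mulrC 2) divfK//.
have := ler_wpM2l (ltW lam0) h4; rewrite mulrDr.
move: (integ _) (fine _) (fine _) (fine _) => ? ? ? ?.
lra.
Qed.

End ball_comparison.

(** * Unions of balls and their boundary points *)

Section ball_unions.
Context {R : realType}.
Implicit Types (A Om : set (R * R)).

Lemma energy_leC (lam : R) Om A (c : R) : energy_le lam Om A c ->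
  energy_le lam (~` Om) (~` A) c.
Proof.
move=> [mA Aoo Ac].
have E : ~` A `+` ~` Om = A `+` Om.
  rewrite !setY_def; apply/seteqP; split=> x /=;
  have [Ax|Ax] := pselect (A x); have [Ox|Ox] := pselect (Om x); tauto.
have pA : perimeter_le A (c - lam * fine (area (A `+` Om))).
  by move=> f f1 f2 g g1 g2 /Ac; rewrite lerBrDr.
split; [exact: measurableC|by rewrite E|move=> f f1 f2 g g1 g2 adm].
by rewrite E -lerBrDr; exact: (perimeter_leC mA pA adm).
Qed.

Definition open_balls (C : set (R * R)) (r : R) : set (R * R) :=
  \bigcup_(x in C) euclid_ball false x r.

Lemma open_open_balls C (r : R) : 0 < r -> open (open_balls C r).
Proof. by move=> r0; apply: bigcup_open => x _; exact: open_euclid_ball. Qed.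

Lemma energy_le_setU_open_balls (lam : R) Om A (c : R) (C : set (R * R)) : 0 < lam ->
  measurable (Om : set (plane R)) ->
  (forall x, C x -> area (euclid_ball false x (2 / lam) `\` Om) = 0%E) ->
  energy_le lam Om A c -> energy_le lam Om (A `|` open_balls C (2 / lam)) c.
Proof.
move=> lam0 mOm CO Ac; have r0 : 0 < 2 / lam by rewrite divr_gt0.
pose good i x := C x /\ qbox i `<=` euclid_ball false x (2 / lam).
(* Lindelof: one ball is chosen for each basic square that fits into some ball with center in
   [C]. *)
pose W i : set (R * R) := if pselect (exists x, good i x) is left h
  then euclid_ball false (projT1 (cid h)) (2 / lam) else set0.
have WC i : (exists2 x, C x & W i = euclid_ball false x (2 / lam)) \/ W i = set0.
  rewrite /W; case: pselect => [h|_]; last by right.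
  by left; case: cid => x [Cx _] /=; exists x.
have UW : open_balls C (2 / lam) = \bigcup_i W i.
  apply/seteqP; split=> [y [x Cx yx]|y [i _]].
    have [i [yi ix]] := open_qbox (@open_euclid_ball _ x _ r0) yx.
    exists i => //; rewrite /W; case: pselect => [h|nh]; last first.
      by exfalso; apply: nh; exists x.
    by case: cid => x' [_ ix'] /=; exact: ix'.
  by have [[x Cx ->]|->] := WC i; [exists x|].
pose T n := A `|` \big[setU/set0]_(i < n) W i.
have -> : A `|` open_balls C (2 / lam) = \bigcup_n T n.
  rewrite UW; apply/seteqP; split=> [x [Ax|[i _ Wx]]|x [n _ [Ax|]]].
  - by exists 0%N => //; left.
  - by exists i.+1 => //; right; rewrite big_ord_recr/=; right.
  - by left.
  - by rewrite -bigcup_mkord => -[i _ Wx]; right; exists i.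
apply: energy_le_bigcup => // n.
  by rewrite /T big_ord_recr/= setUA; exact: subsetUl.
elim: n => [|n IH]; first by rewrite /T big_ord0 setU0.
rewrite /T big_ord_recr/= setUA; have [[x Cx ->]|->] := WC n; last by rewrite setU0.
exact: (energy_le_setU_ball lam0 mOm (CO x Cx) IH).
Qed.

(* The set lies in the symmetric difference of [U] and arbitrarily small
   translates of [U]. *)
Lemma area_one_sided_boundary (U : set (R * R)) (r : R) (d : R * R) : 0 < r -> `|d| <= 1 -> open U ->
  area [set y : R * R | ~ U y /\ forall k : nat, U (y + (r / k.+2%:R * d.1, r / k.+2%:R * d.2))] = 0%E.
Proof.
move=> r0 d1 oU; set M := [set y | _].
have mU : measurable (U : set (plane R)) by exact: open_measurable_plane.
pose z (k : nat) : R * R := (r / k.+2%:R * d.1, r / k.+2%:R * d.2).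
have ME : M = ~` U `&` \bigcap_k shift_set (z k) U.
  by apply/seteqP; split=> y [nU h]; split=> // k; [move=> _; exact: h|exact: h].
have mM : measurable (M : set (plane R)).
  rewrite ME; apply: measurableI; first exact: measurableC.
  by apply: bigcapT_measurable => k; exact: measurable_shift_set.
apply/eqP; rewrite eq_le measure_ge0 andbT.
apply: area_le_boxes => // N; apply/lee_addgt0Pr => e e0; rewrite add0e.
have [_ /(_ N e e0)[t t0 tU]] := measurable_translation_continuous mU.
have [k kt] : exists k, `|z k| < t.
  exists (Num.bound (r / t)); set k := Num.bound _.
  have kP : r / t < k%:R by apply: archi_boundP; rewrite divr_ge0// ltW.
  have ht : r / k.+2%:R < t.
    rewrite ltr_pdivrMr// mulrC -ltr_pdivrMr// (lt_le_trans kP)// ler_nat.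
    by rewrite -addn2 leq_addr.
  have p0 : 0 <= r / k.+2%:R by rewrite divr_ge0// ltW.
  move: d1; rewrite !prod_normE ge_max gt_max /z /= (normrM _ d.1) (normrM _ d.2) (ger0_norm p0) => /andP[d1 d2].
  by rewrite !(le_lt_trans _ ht)// -[leRHS]mulr1 ler_wpM2l.
apply: le_trans (tU _ kt); apply: le_area.
- exact: measurable_boxI.
- by apply: measurable_boxI; apply: measurableY => //; exact: measurable_shift_set.
move=> x [xN [nUx Ux]].
suff : (shift_set (z k) U `+` U) x by split.
by apply/setYP => h; apply: nUx; apply/h; exact: Ux.
Qed.

(** On the circle some coordinate of [y - x0] has size at least [r / 2], for otherwise the squares
    sum to less than [r ^+ 2 / 2]. Moving that coordinate toward the center by less than [r]
    decreases its square. Four fixed directions, instead of the radial one, leave only finitely many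
    exceptional sets for all balls together. *)
Lemma closed_ball_inward (x0 y : R * R) (r : R) : 0 < r ->
  euclid_ball true x0 r y -> ~ euclid_ball false x0 r y ->
  exists2 d : R * R, d \in [:: (1, 0); (-1, 0); (0, 1); (0, -1)] &
  forall k : nat, euclid_ball false x0 r (y + (r / k.+2%:R * d.1, r / k.+2%:R * d.2)).
Proof.
move=> r0; rewrite !euclid_ballE//= => yr /negP; rewrite -leNgt => ry.
set a := y.1 - x0.1 in yr ry; set b := y.2 - x0.2 in yr ry.
have t0 (k : nat) : 0 < r / k.+2%:R by rewrite divr_gt0.
(* The denominator starts at 2 to keep every step strictly shorter than [r], as [key] requires. *)
have tr (k : nat) : r / k.+2%:R < r by rewrite ltr_pdivrMr// ltr_pMr// ltr1n.
have E : a ^+ 2 + b ^+ 2 = r ^+ 2 by apply/eqP; rewrite eq_le yr ry.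
have key (s c t : R) : c ^+ 2 = 1 -> c * s <= - (r / 2) -> 0 < t -> t < r ->
    (s + t * c) ^+ 2 < s ^+ 2.
  move=> c2 cs h0 h1.
  have -> : (s + t * c) ^+ 2 = s ^+ 2 + t * (2 * (c * s)) + t ^+ 2 * c ^+ 2 by ring.
  rewrite c2 mulr1 -addrA gtrDl expr2 -mulrDr pmulr_rlt0//; lra.
have [ha|ha] := leP (r / 2) a.
  exists (-1, 0); first by rewrite !inE eqxx orbT.
  move=> k; rewrite euclid_ballE//= mulr0 addr0 -E -/b ltrD2r.
  rewrite (_ : y.1 + _ - x0.1 = a + r / k.+2%:R * -1); last by rewrite /a; ring.
  by apply: key => //; [rewrite sqrrN expr1n|lra].
have [ha'|ha'] := leP a (- (r / 2)).
  exists (1, 0); first by rewrite !inE eqxx.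
  move=> k; rewrite euclid_ballE//= mulr0 addr0 -E -/b ltrD2r.
  rewrite (_ : y.1 + _ - x0.1 = a + r / k.+2%:R * 1); last by rewrite /a; ring.
  by apply: key => //; [rewrite expr1n|lra].
have [hb|hb] := leP (r / 2) b.
  exists (0, -1); first by rewrite !inE eqxx !orbT.
  move=> k; rewrite euclid_ballE//= mulr0 addr0 -E -/a ltrD2l.
  rewrite (_ : y.2 + _ - x0.2 = b + r / k.+2%:R * -1); last by rewrite /b; ring.
  by apply: key => //; [rewrite sqrrN expr1n|lra].
have [hb'|hb'] := leP b (- (r / 2)).
  exists (0, 1); first by rewrite !inE eqxx !orbT.
  move=> k; rewrite euclid_ballE//= mulr0 addr0 -E -/a ltrD2l.
  rewrite (_ : y.2 + _ - x0.2 = b + r / k.+2%:R * 1); last by rewrite /b; ring.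
  by apply: key => //; [rewrite expr1n|lra].
exfalso.
have sq (s : R) : - (r / 2) < s -> s < r / 2 -> s ^+ 2 < r ^+ 2 / 4.
  move=> h1 h2; have -> : r ^+ 2 / 4 = (r / 2) ^+ 2 by field.
  rewrite -(real_normK (num_real s)) ltr_sqr ?nnegrE ?divr_ge0 ?(ltW r0)//.
  by rewrite ltr_norml h1.
have := sq _ ha' ha; have := sq _ hb' hb; have : 0 < r ^+ 2 by rewrite exprn_gt0.
lra.
Qed.

(** Every such point lies in the one-sided boundary of the union of open balls for one of the four
    directions. A Borel null superset is produced because the union of the closed balls, over an
    arbitrary set of centers, need not be Borel. *)
Lemma closed_balls_minus_open_null (cl : bool) (C : set (R * R)) (r : R) : 0 < r ->
  exists2 Z : set (plane R), measurable Z /\ area Z = 0%E &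
  \bigcup_(x in C) euclid_ball cl x r `\` open_balls C r `<=` Z.
Proof.
move=> r0; have oU : open (open_balls C r) by exact: open_open_balls.
have mU := open_measurable_plane oU.
pose M (d : R * R) : set (plane R) := [set y | ~ open_balls C r y /\
  forall k : nat, open_balls C r (y + (r / k.+2%:R * d.1, r / k.+2%:R * d.2))].
pose ds : seq (R * R) := [:: (1, 0); (-1, 0); (0, 1); (0, -1)].
have dn d : d \in ds -> `|d| <= 1.
  rewrite !inE prod_normE => /or4P[] /eqP -> /=;
  by rewrite ?normrN normr1 normr0 ge_max lexx ler01.
have mM d : measurable (M d).
  have -> : M d = ~` open_balls C r `&` \bigcap_k shift_set (r / k.+2%:R * d.1, r / k.+2%:R * d.2) (open_balls C r).
    by apply/seteqP; split=> y [nU h]; split=> // k; [move=> _; exact: h|exact: h].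
  apply: measurableI; first exact: measurableC.
  by apply: bigcapT_measurable => k; exact: measurable_shift_set.
have aM d : d \in ds -> area (M d) = 0%E.
  by move=> /dn d1; exact: area_one_sided_boundary.
exists ((M (1, 0) `|` M (-1, 0)) `|` (M (0, 1) `|` M (0, -1))).
  have m1 := measurableU _ _ (mM (1, 0)) (mM (-1, 0)).
  have m2 := measurableU _ _ (mM (0, 1)) (mM (0, -1)).
  have nU (S T : set (plane R)) : measurable S -> measurable T -> area S = 0%E ->
      area T = 0%E -> area (S `|` T) = 0%E.
    move=> mS mT S0 T0; apply/eqP; rewrite eq_le measure_ge0 andbT.
    by rewrite (le_trans (measureU2 _ mS mT))//= S0 T0 adde0.
  split; first exact: measurableU.
  by apply: (nU _ _ m1 m2); apply: (nU _ _ (mM _) (mM _)); apply: aM; rewrite !inE eqxx ?orbT.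
move=> y [[x Cx yx] nU].
have nyx : ~ euclid_ball false x r y by move=> h; apply: nU; exists x.
case: cl yx => yx; last by [].
have [d dds dk] := closed_ball_inward r0 yx nyx.
have Md : M d y by split=> // k; exists x => //; exact: dk.
move: dds Md; rewrite !inE => /or4P[] /eqP -> ?; by [left; left|left; right|right; left|right; right].
Qed.

End ball_unions.

(** * Completion of the Borel measure *)

Section completion.
Context {R : realType}.
Implicit Types (A B X Y Z : set (R * R)).

Local Notation outer := (@borel_lebesgue2 R)^*%mu.

Lemma outer_area A : measurable (A : set (plane R)) -> outer A = area A.
Proof. by move=> mA; exact: measurable_mu_extE. Qed.

Lemma lebesgue2E A : lebesgue2 A = outer A. Proof. by []. Qed.

Lemma measurable_lebesgue_measurable2 A : measurable (A : set (plane R)) ->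
  lebesgue_measurable2 A.
Proof. by move=> mA; exact: caratheodory_measurable_mu_ext. Qed.

Lemma outer_setU X Y : (outer (X `|` Y) <= outer X + outer Y)%E.
Proof. exact: outer_measureU2. Qed.

Lemma le_outer X Y : X `<=` Y -> (outer X <= outer Y)%E.
Proof. exact: le_mu_ext. Qed.

Lemma outer_ge0 X : (0 <= outer X)%E. Proof. exact: mu_ext_ge0. Qed.

Definition null Z := outer Z = 0%E.

Lemma null_sub Z Z' : Z `<=` Z' -> null Z' -> null Z.
Proof.
by move=> ZZ' nZ'; apply/eqP; rewrite eq_le outer_ge0 andbT -nZ' le_outer.
Qed.

Lemma nullU Z Z' : null Z -> null Z' -> null (Z `|` Z').
Proof.
move=> nZ nZ'; apply/eqP; rewrite eq_le outer_ge0 andbT.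
by rewrite (le_trans (outer_setU _ _))// nZ nZ' adde0.
Qed.

Lemma null_measurable Z : null Z -> lebesgue_measurable2 Z.
Proof.
move=> nZ; apply: le_caratheodory_measurable => X.
suff h : (outer (X `&` Z) + outer (X `&` ~` Z) <= outer X)%E by exact: h.
have -> : outer (X `&` Z) = 0%E by apply: (null_sub _ nZ); exact: subIsetr.
by rewrite add0e; apply: le_outer; exact: subIsetl.
Qed.

Lemma outer_eq X Y : null (X `+` Y) -> outer X = outer Y.
Proof.
move=> nXY.
have h S T : null (S `+` T) -> (outer S <= outer T)%E.
  move=> nST; rewrite -[leRHS]adde0 -nST; apply: le_trans (outer_setU _ _).
  apply: le_outer => x Sx; have [Tx|Tx] := pselect (T x); first by left.
  by right; rewrite setY_def; left.
by apply/eqP; rewrite eq_le !h// setYC.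
Qed.

Lemma null_modification B X : measurable (B : set (plane R)) ->
  null (X `+` B) -> lebesgue_measurable2 X.
Proof.
move=> mB nXB.
have n1 : null (X `\` B) by apply: (null_sub _ nXB) => x ?; rewrite setY_def; left.
have n2 : null (B `\` X) by apply: (null_sub _ nXB) => x ?; rewrite setY_def; right.
have -> : X = (B `\` (B `\` X)) `|` (X `\` B).
  by apply/seteqP; split=> x /=; have [Bx|Bx] := pselect (B x);
    have [Xx|Xx] := pselect (X x); tauto.
apply: (@measurableU _ (caratheodory_type outer)); last exact: null_measurable.
apply: (@measurableD _ (caratheodory_type outer)); last exact: null_measurable.
exact: measurable_lebesgue_measurable2.
Qed.

(** Countable covers from the definition of the outer measure exceed it by at most [1 / (n + 1)];
    their intersection is the hull. *)
Lemma outer_borel_hull X : (outer X < +oo)%E ->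
  exists G : set (plane R), [/\ measurable G, X `<=` G & area G = outer X].
Proof.
move=> Xoo.
have fX : outer X \is a fin_num by rewrite ge0_fin_numE// outer_ge0.
have cov (n : nat) : exists U : set (plane R), [/\ measurable U, X `<=` U &
    (area U <= outer X + (n.+1%:R^-1)%:E)%E].
  have n0 : 0 < n.+1%:R^-1 :> R by rewrite invr_gt0.
  have [_ [A [mA XA] <-] lt] := lb_ereal_inf_adherent n0 fX.
  exists (\bigcup_k A k); split=> //; first exact: bigcupT_measurable.
  apply: le_trans (ltW lt).
  exact: (@measure_sigma_subadditive _ _ _ (@area R) _ _ mA (bigcupT_measurable A mA) (@subset_refl _ _)).
have [U UP] := choice cov.
have mG : measurable (\bigcap_n U n : set (plane R)).
  by apply: bigcapT_measurable => n; case: (UP n).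
have XG : X `<=` \bigcap_n U n by move=> x Xx n _; case: (UP n) => _ + _; apply.
exists (\bigcap_n U n); split=> //.
apply/eqP; rewrite eq_le -{2}(outer_area mG) le_outer// andbT.
apply/lee_addgt0Pr => e e0.
pose n := Num.bound e^-1.
have ne : n.+1%:R^-1 <= e.
  rewrite -[leRHS]invrK lef_pV2 ?posrE ?invr_gt0//.
  have : e^-1 < n%:R by apply: archi_boundP; rewrite invr_ge0 ltW.
  by move=> /ltW /le_trans; apply; rewrite ler_nat.
have [mU _ Un] := UP n.
apply: (@le_trans _ _ (area (U n))); first by apply: le_area => // x; apply.
by rewrite (le_trans Un)// leeD2l// lee_fin.
Qed.

(** The pieces of [X] in boxes have finite measure. Caratheodory measurability of a piece splits its
    hull, and finiteness allows subtraction, so the hull exceeds the piece by a null set. *)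
Lemma borel_version X : lebesgue_measurable2 X ->
  exists2 B : set (plane R), measurable B & null (X `+` B).
Proof.
move=> mX.
pose Xn (n : nat) : set (R * R) := box n%:R `&` X.
have mXn n : lebesgue_measurable2 (Xn n).
  apply: (@measurableI _ (caratheodory_type outer)) => //.
  exact: (measurable_lebesgue_measurable2 (@measurable_box R n%:R)).
have Xoo n : (outer (Xn n) < +oo)%E.
  rewrite (@le_lt_trans _ _ (outer (box n%:R)))//.
    by apply: le_outer; exact: subIsetl.
  by rewrite (outer_area (@measurable_box R n%:R)) area_box// ltry.
have [G GP] := choice (fun n => outer_borel_hull (Xoo n)).
have mG n : measurable (G n) by case: (GP n).
have nG n : null (G n `\` Xn n).
  have [_ XG GE] := GP n.
  have E : outer (G n) = (outer (G n `&` Xn n) + outer (G n `&` ~` Xn n))%E := mXn n (G n).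
  move: E; rewrite (setIidr XG) (outer_area (mG n)) GE.
  have fX : outer (Xn n) \is a fin_num by rewrite ge0_fin_numE// outer_ge0.
  move=> E; rewrite /null setDE.
  move: E fX (outer_ge0 (G n `&` ~` Xn n)).
  move: (outer (Xn n)) (outer (G n `&` ~` Xn n)) => [x| |] [y| |]//= [E] _ _.
  by congr EFin; lra.
exists (\bigcup_n G n); first exact: bigcupT_measurable.
have sub : X `+` \bigcup_n G n `<=` \bigcup_n (G n `\` Xn n).
  move=> x; rewrite setY_def => -[[Xx nG']|[[n _ Gx] nX]].
    exfalso; apply: nG'; exists (Num.bound `|x|) => //.
    have [_ + _] := GP (Num.bound `|x|); apply; split=> //.
    by rewrite /box/=; apply/ltW/archi_boundP.
  by exists n => //; split=> // -[_].
apply: (null_sub sub); apply/eqP; rewrite eq_le outer_ge0 andbT.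
apply: le_trans (outer_measure_sigma_subadditive _ _) _.
by rewrite eseries0// => n _ _; exact: nG.
Qed.

(** The identity map from the Caratheodory sigma-algebra to the Borel one is measurable and pushes
    [lebesgue2] forward to [area]. The change of variables formula transfers the integral, and [A]
    is exchanged for [B] almost everywhere. *)
Lemma integral_lebesgue2 A B (g : R * R -> R) : lebesgue_measurable2 A ->
  measurable (B : set (plane R)) -> null (A `+` B) -> nice g ->
  (\int[@lebesgue2 R]_(x in A) (g x)%:E)%E = (integ (fun x => \1_B x * g x))%:E.
Proof.
move=> mA mB nAB ng; have nBg := nice_indic mB ng.
rewrite (EFin_integ nBg).
pose T := caratheodory_type outer.
have mid : measurable_fun [set: T] (id : T -> plane R).
  by move=> _ Y mY; rewrite setTI; exact: measurable_lebesgue_measurable2.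
have mcomp (h : R * R -> R) : mfun h -> measurable_fun [set: T] (EFin \o h).
  move=> mh; apply/measurable_EFinP.
  exact: (measurableT_comp (mh : measurable_fun _ _) mid).
have pushE (D : set (plane R)) : measurable D -> pushforward (@lebesgue2 R) (id : T -> plane R) D = area D.
  by move=> mD; exact: outer_area.
have ig (h : R * R -> R) : nice h -> (@lebesgue2 R).-integrable [set: T] (EFin \o h).
  move=> nh; apply/integrableP; split; first exact: mcomp nh.1.
  have mab : measurable_fun [set: plane R] (fun x => `|(h x)%:E|%E).
    by apply: measurableT_comp => //; apply/measurable_EFinP; exact: nh.1.
  have := @ge0_integral_pushforward _ _ _ _ R (id : T -> plane R) mid (@lebesgue2 R)
    [set: plane R] (fun x => `|(h x)%:E|%E) measurableT mab (fun _ _ => abse_ge0 _).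
  rewrite preimage_setT /comp => <-.
  have -> : (\int[pushforward (@lebesgue2 R) (id : T -> plane R)]_x `|(h x)%:E| =
      \int[area]_x `|(h x)%:E|)%E.
    by apply: eq_measure_integral => D mD _; exact: pushE.
  by have /integrableP[] := nice_integrable nh.
have -> : (\int[area]_x (\1_B x * g x)%:E = \int[@lebesgue2 R]_x (\1_B x * g x)%:E)%E.
  have := @integral_pushforward _ _ _ _ R (id : T -> plane R) mid (@lebesgue2 R)
    [set: plane R] (fun x => (\1_B x * g x)%:E).
  rewrite preimage_setT /comp => <-//.
  - by apply: eq_measure_integral => D mD _; exact/esym/pushE.
  - by apply/measurable_EFinP; exact: nBg.1.
  - exact: ig nBg.
rewrite integral_mkcond.
have mAg : measurable_fun [set: T] ((fun x => (g x)%:E) \_ A).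
  apply: (@measurable_restrictT _ _ _ _ _ _ mA).1.
  exact: (measurable_funTS (mcomp g ng.1)).
apply: (ae_eq_integral _ _ measurableT mAg (mcomp _ nBg.1)).
exists (A `+` B); split; [|exact: nAB|].
  exact: null_measurable.
move=> x /= h; apply/setYP => AB; apply: h => _.
rewrite patchE indicE; have [/set_mem Ax|Ax] := boolP (x \in A).
  by rewrite (mem_set (AB.1 Ax)) mul1r.
rewrite memNset ?mul0r// => Bx; move/negP: Ax; apply; exact/mem_set/AB.2.
Qed.

End completion.

(** * Translation between the stated energy and its Borel form *)

Section energies.
Context {R : realType}.
Implicit Types (A B Om : set (R * R)).

Local Notation outer := (@borel_lebesgue2 R)^*%mu.

Lemma admissible_field_components (f : R * R -> R * R) : admissible_field f ->
  admissible (fun x => (f x).1) (fun x => ('D_((1, 0) : R * R) f x).1)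
    (fun x => ('D_((0, 1) : R * R) f x).1)
    (fun x => (f x).2) (fun x => ('D_((1, 0) : R * R) f x).2)
    (fun x => ('D_((0, 1) : R * R) f x).2).
Proof.
move=> [Cf cf f1]; have [Cf1 Cf2] := C1_plane_components Cf.
split=> //.
- have [M [_ Mf]] := compact_bounded cf.
  exists (`|M| + 1) => x xM.
  suff -> : f x = 0 by [].
  apply/eqP/negPn/negP => fx0.
  have := Mf (`|M| + 1) _ x (@subset_closure _ _ x fx0).
  rewrite (le_lt_trans (ler_norm M)) ?ltrDl// => /(_ isT) /le_lt_trans - /(_ _ xM).
  by rewrite ltxx.
- move=> x; have := f1 x; rewrite /euclid_norm => fx.
  have s0 : 0 <= (f x).1 ^+ 2 + (f x).2 ^+ 2 by rewrite addr_ge0// sqr_ge0.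
  by rewrite -(sqr_sqrtr s0) expr_le1.
Qed.

Lemma admissible_admissible_field f f1 f2 g g1 g2 :
  @admissible R f f1 f2 g g1 g2 ->
  admissible_field (fun x => (f x, g x)) /\
  (forall x, divergence (fun x => (f x, g x)) x = f1 x + g2 x).
Proof.
move=> [Cf Cg [N fgN] fg1]; have [C dE] := C1_pair Cf Cg.
split=> //; split=> //.
- apply: (subclosed_compact _ (@compact_box R N)); first exact: closed_closure.
  have cb : closed (@box R N).
    by apply: compact_closed (@compact_box R N); exact: norm_hausdorff.
  rewrite [X in _ `<=` X](closure_id _).1//; apply: closureS => x /= fgx.
  rewrite /box/= leNgt; apply/negP => xN; move: fgx.
  by have [-> ->] := fgN x xN; rewrite eqxx.
- move=> x; rewrite /euclid_norm/= -sqrtr1; apply: ler_wsqrtr; exact: fg1.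
Qed.

Lemma perimeter_integ A B : lebesgue_measurable2 A ->
  measurable (B : set (plane R)) -> null (A `+` B) ->
  perimeter A = ereal_sup [set (integ (fun x => \1_B x * divergence f x))%:E |
    f in admissible_field].
Proof.
move=> mA mB nAB; rewrite /perimeter; congr ereal_sup.
have E (f : R * R -> R * R) : admissible_field f ->
    (\int[@lebesgue2 R]_(x in A) (divergence f x)%:E)%E =
    (integ (fun x => \1_B x * divergence f x))%:E.
  move=> /admissible_field_components/admissible_nice nf.
  exact: integral_lebesgue2.
by apply/seteqP; split=> _ [f af <-]; exists f => //; rewrite E.
Qed.

Lemma perimeter_ge0 A : lebesgue_measurable2 A -> (0 <= perimeter A)%E.
Proof.
move=> mA; have [B mB nAB] := borel_version mA; rewrite (perimeter_integ mA mB nAB).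
apply: ereal_sup_ubound; have [a0 d0] := admissible_admissible_field (@admissible0 R).
exists (fun=> (0, 0)) => //; congr EFin.
rewrite (_ : (fun x => _) = cst 0) ?integ_cst0//.
by apply/funext => x; rewrite d0 /= addr0 mulr0.
Qed.

(** The bridge between the extended real energy for the completed measure and the tested real bounds
    for Borel sets. A finite bound [c] forces the fidelity area to be finite, since the perimeter is
    nonnegative. *)
Lemma energy_energy_le (lam : R) A B Om Om' (c : R) : 0 < lam ->
  lebesgue_measurable2 A -> measurable (B : set (plane R)) ->
  measurable (Om' : set (plane R)) -> null (A `+` B) -> null (Om `+` Om') ->
  (energy lam Om A <= c%:E)%E <-> energy_le lam Om' B c.
Proof.
move=> lam0 mA mB mO nAB nO.
have mBO := measurableY mB mO.
have E : lebesgue2 (A `+` Om) = area (B `+` Om').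
  rewrite lebesgue2E -(outer_area mBO); apply: outer_eq.
  apply: (null_sub _ (nullU nAB nO)) => x; rewrite !setY_def /=.
  have [Ax|Ax] := pselect (A x); have [Bx|Bx] := pselect (B x);
  have [Ox|Ox] := pselect (Om x); have [Ox'|Ox'] := pselect (Om' x); tauto.
have P0 := perimeter_ge0 mA.
have a0 : (0 <= area (B `+` Om'))%E by exact: measure_ge0.
rewrite /energy E; split=> [Ec|[_ Boo Bc]].
- have Boo : (area (B `+` Om') < +oo)%E.
    rewrite ltey; apply/eqP => Bi; move: Ec; rewrite Bi gt0_muley ?lte_fin//.
    by rewrite addey ?leye_eq//; apply/eqP => Pm; move: P0; rewrite Pm.
  split=> // f f1 f2 g g1 g2 adm.
  have fB : area (B `+` Om') \is a fin_num by rewrite ge0_fin_numE.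
  rewrite -lee_fin EFinD EFinM (fineK fB); apply: (le_trans _ Ec); apply: leeD => //.
  rewrite (perimeter_integ mA mB nAB).
  have [af df] := admissible_admissible_field adm.
  apply: ereal_sup_ubound; exists (fun x => (f x, g x)) => //.
  by congr EFin; congr (integ _); apply/funext => x; rewrite df.
- have fB : area (B `+` Om') \is a fin_num by rewrite ge0_fin_numE.
  rewrite -(fineK fB) -EFinM -leeBrDr// -EFinB (perimeter_integ mA mB nAB).
  apply: ge_ereal_sup => _ [f af <-]; rewrite lee_fin lerBrDr.
  exact: (Bc _ _ _ _ _ _ (admissible_field_components af)).
Qed.

End energies.

Theorem mainTheorem3 (R : realType) (cl : bool) (lambda : R)
    (Omega : set (R * R)) (lambda_gt0 : 0 < lambda)
    (Omega_bounded : bounded_set Omega)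
    (Omega_measurable : lebesgue_measurable2 Omega) :
  exists Sigma : set (R * R),
    [/\ energy_minimizer lambda Omega Sigma,
        ball_union cl (2 / lambda) Omega `<=` Sigma &
        ball_union cl (2 / lambda) (~` Omega) `<=` ~` Sigma].
Proof.
have r0 : 0 < 2 / lambda by rewrite divr_gt0.
have [Om mOm nOm] := borel_version Omega_measurable.
have Omoo : (area Om < +oo)%E.
  rewrite -(outer_area mOm) -(outer_eq nOm).
  have [M [_ bM]] := Omega_bounded.
  have sub : Omega `<=` box (`|M| + 1).
    by move=> x Ox; apply: bM => //; rewrite (le_lt_trans (ler_norm M))// ltrDl.
  apply: le_lt_trans (le_outer sub) _.
  by rewrite (outer_area (@measurable_box R _)) area_box ?ltry// addr_ge0.
have [S [m [Sm mmin]]] := energy_minimum lambda_gt0 mOm Omoo.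
pose C (A : set (R * R)) := [set x | euclid_ball cl x (2 / lambda) `<=` A].
pose U := open_balls (C Omega) (2 / lambda).
pose V := open_balls (C (~` Omega)) (2 / lambda).
have sub_cl x : euclid_ball false x (2 / lambda) `<=` euclid_ball cl x (2 / lambda).
  by move=> y; rewrite !euclid_ballE//=; exact: lteifS.
have UO : U `<=` Omega by move=> y [x Cx /sub_cl]; exact: Cx.
have VO : V `<=` ~` Omega by move=> y [x Cx /sub_cl]; exact: Cx.
have null_ball (A A' : set (R * R)) x : C A x -> measurable (A' : set (plane R)) ->
    null (A `+` A') -> area (euclid_ball false x (2 / lambda) `\` A') = 0%E.
  move=> Cx mA' nA; rewrite -outer_area.
    apply: (null_sub _ nA) => y [By nA'y]; rewrite setY_def; left; split=> //.
    exact/Cx/sub_cl.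
  by apply: measurableD => //; exact: measurable_euclid_ball.
have nOmC : null (~` Omega `+` ~` Om).
  apply: (null_sub _ nOm) => x; rewrite !setY_def /=.
  by have [Ax|Ax] := pselect (Omega x); have [Bx|Bx] := pselect (Om x); tauto.
have mOmC := measurableC mOm.
have S1 : energy_le lambda Om (S `|` U) m.
  by apply: energy_le_setU_open_balls Sm => // x Cx; exact: null_ball nOm.
have S2 : energy_le lambda Om (~` (~` (S `|` U) `|` V)) m.
  rewrite -[Om]setCK; apply: energy_leC.
  apply: energy_le_setU_open_balls (energy_leC S1) => // x Cx.
  exact: null_ball nOmC.
set T := ~` _ in S2.
(* [U] lies in [Omega] and [V] in its complement, so removing [V] leaves [U] untouched. *)
have UT : U `<=` T.
  by move=> x Ux [nU|/VO Vx]; [apply: nU; right|apply: Vx; exact: UO].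
have TV : T `<=` ~` V by move=> x nT Vx; apply: nT; right.
have mT : measurable (T : set (plane R)) by case: S2.
have [Z1 [mZ1 aZ1] sZ1] := closed_balls_minus_open_null cl (C Omega) r0.
have [Z2 [mZ2 aZ2] sZ2] := closed_balls_minus_open_null cl (C (~` Omega)) r0.
pose Uc := ball_union cl (2 / lambda) Omega.
pose Vc := ball_union cl (2 / lambda) (~` Omega).
have UVc x : Uc x -> ~ Vc x.
  by move=> [y Cy yx] [z Cz zx]; exact: (Cz _ zx (Cy _ yx)).
(* Adding and removing the complete unions of balls alters [T] only within [Z1] and [Z2]. The energy
   bound survives this, although the result need not be Borel. *)
pose Sigma := (T `|` Uc) `\` Vc.
have nS : null (Sigma `+` T).
  have n12 : null (Z1 `|` Z2).
    by apply: nullU; rewrite /null outer_area.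
  apply: (null_sub _ n12) => x; rewrite setY_def => -[[[[//|Ux] _] nT]|[Tx nS]].
    by left; apply: sZ1; split=> // Ux'; apply: nT; exact: UT.
  right; apply: sZ2; split; last exact: TV.
  by apply: contrapT => nV; apply: nS; split=> //; left.
have mSigma := null_modification mT nS.
exists Sigma; split.
- split=> // Sigma' mS'.
  have h := (energy_energy_le m lambda_gt0 mSigma mT mOm nS nOm).2 S2.
  apply: le_trans h _.
  have [B mB nB] := borel_version mS'.
  have E0 : (0 <= energy lambda Omega Sigma')%E.
    rewrite /energy adde_ge0 ?perimeter_ge0// mule_ge0// lee_fin ltW//.
  (* [m] bounds only real energy bounds from below, so infinite energies are treated apart: [+oo] is
     trivial and [-oo] contradicts [E0]. *)
  case EE : (energy lambda Omega Sigma') => [c| |]; last first.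
  + by move: E0; rewrite EE.
  + by rewrite leey.
  rewrite lee_fin; apply: (mmin B).
  apply/(energy_energy_le c lambda_gt0 mS' mB mOm nB nOm).
  by rewrite EE.
- by move=> x Ux; split; [right|exact: UVc].
- by move=> x Vx [_]; exact.
Qed.
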